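(* For every $t\geq 0$ and every $f\in\mathcal{C}^\infty_c(\mathbb{H})$ (smooth compactly supported real-valued functions on $\mathbb{H}$), one has, pointwise on $\mathbb{H}$, $$t\,\Gamma(P_tf,P_tf)\leq P_t(f^2)-(P_tf)^2 .$$
   Context: $\mathbb{H}=\mathbb{R}^3$ is the Heisenberg group with product $(x,y,z)\bullet(x',y',z')=(x+x',y+y',z+z'+\tfrac12(xy'-yx'))$. The left-invariant vector fields are $X=\partial_x-\tfrac y2\partial_z$, $Y=\partial_y+\tfrac x2\partial_z$, $Z=\partial_z=[X,Y]$. Put $L=X^2+Y^2$ and $\Gamma(f,f)=(Xf)^2+(Yf)^2$. The heat semigroup $(P_t)_{t\ge0}=(e^{tL})_{t\geq 0}$ is given by $P_0=\mathrm{Id}$ and, for $t>0$, $P_tf(\mathbf{x})=\int_{\mathbb{R}^3}f(\mathbf{x}\bullet\mathbf{y})\,p_t(\mathbf{y})\,d\mathbf{y}$ ($d\mathbf y$ Lebesgue measure), where, with $r^2=x^2+y^2$, $$p_t(x,y,z)=\frac1{8\pi^2}\int_{-\infty}^{+\infty}e^{i\lambda z}\frac{\lambda}{\sinh\lambda t}\exp\!\Big(-\frac{r^2}{4}\lambda\coth(\lambda t)\Big)d\lambda .$$ *)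

(* Defs.v *)
From HB Require Import structures.
From mathcomp Require Import all_boot all_order all_algebra.
From mathcomp Require Import all_classical all_reals all_analysis.
From mathcomp Require Import measurable_realfun complex.
Set Implicit Arguments.
Unset Strict Implicit.
Unset Printing Implicit Defensive.
Import Order.TTheory GRing.Theory Num.Theory.
Import numFieldNormedType.Exports.
Local Open Scope classical_set_scope.
Local Open Scope ring_scope.

(* A point (x, y, z) is p with x = p.1.1, y = p.1.2 and z = p.2. *)
Notation heis R := (R * R * R)%type.

Notation lebesgue3 :=
  ((lebesgue_measure \x lebesgue_measure) \x lebesgue_measure)%E.

Section Heisenberg.
Context {R : realType}.
Implicit Types (f : heis R -> R) (p q v : heis R) (t : R).

Definition hmul p q : heis R :=
  (p.1.1 + q.1.1, p.1.2 + q.1.2,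
   p.2 + q.2 + 2^-1 * (p.1.1 * q.1.2 - p.1.2 * q.1.1)).

Definition dirx : heis R := (1, 0, 0).
Definition diry : heis R := (0, 1, 0).
Definition dirz : heis R := (0, 0, 1).

Definition vfX f p : R := 'D_dirx f p - p.1.2 / 2 * 'D_dirz f p.
Definition vfY f p : R := 'D_diry f p + p.1.1 / 2 * 'D_dirz f p.

(* The diagonal Gamma(f, f), not the bilinear form. *)
Definition Gamma f p : R := vfX f p ^+ 2 + vfY f p ^+ 2.

(* Existence and continuity of the iterated coordinate partial derivatives;
   f is of class C^n when Ck m f holds for all m <= n. *)
Fixpoint Ck (n : nat) f : Prop :=
  if n is n'.+1 then
    forall v, v \in [:: dirx; diry; dirz] ->
      (forall p, derivable f p v) /\ Ck n' ('D_v f)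
  else continuous f.

Definition smooth f : Prop := forall n, Ck n f.

Definition compactly_supported f : Prop :=
  compact (closure [set p | f p != 0]).

Definition sinh (x : R) : R := (expR x - expR (- x)) / 2.
Definition cosh (x : R) : R := (expR x + expR (- x)) / 2.
Definition coth (x : R) : R := cosh x / sinh x.

Local Open Scope complex_scope.

(* e^(i x) for real x *)
Definition expi (x : R) : R[i] := cos x +i* sin x.

(* Integral over the real line of a complex-valued function. *)
Definition integralC (g : R -> R[i]) : R[i] :=
  (\int[lebesgue_measure]_l complex.Re (g l)) +i*
  (\int[lebesgue_measure]_l complex.Im (g l)).

(* At l = 0 the convention 0^-1 = 0 makes l / sinh (l * t) vanish instead of
   taking its limit 1 / t; the integral does not see this single point. *)
Definition heat_integrand t p (l : R) : R[i] :=
  expi (l * p.2) * (l / sinh (l * t))%:C *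
  (expR (- ((p.1.1 ^+ 2 + p.1.2 ^+ 2) / 4) * l * coth (l * t)))%:C.

Definition heat_kernelC t p : R[i] :=
  ((8 * pi ^+ 2)^-1)%:C * integralC (heat_integrand t p).

(* Nothing is lost by the real part: see heat_kernelC_real below. *)
Definition heat_kernel t p : R := complex.Re (heat_kernelC t p).

Local Close Scope complex_scope.

(* Only meaningful for 0 <= t. *)
Definition heat_semigroup t f p : R :=
  if t == 0 then f p
  else \int[lebesgue3]_q (f (hmul p q) * heat_kernel t q).

Lemma measurable_inv : measurable_fun setT (fun x : R => x^-1).
Proof.
rewrite (_ : (fun x => _) = (fun x : R => x * (x ^+ 2) `^ (- 1))).
  apply: measurable_funM => //.
  apply: (@measurableT_comp _ _ _ _ _ _ (fun x : R => x `^ (- 1))).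
    exact: measurable_powR.
  exact: measurable_funX.
apply/funext => x; have [->|x0] := eqVneq x 0; first by rewrite invr0 mul0r.
by rewrite powR_inv1 ?sqr_ge0// expr2 invfM mulrA mulfV// mul1r.
Qed.

Lemma measurable_funV (g : R -> R) :
  measurable_fun setT g -> measurable_fun setT (fun x => (g x)^-1).
Proof. exact: measurableT_comp measurable_inv. Qed.

Lemma Rintegral_odd (g : R -> R) : measurable_fun setT g ->
  (forall x, g (- x) = - g x) -> \int[lebesgue_measure]_x g x = 0.
Proof.
pose mu : measure (measurableTypeR R) R := lebesgue_measure.
move=> mg gN; have mGE : measurable_fun setT (EFin \o g).
  exact/measurable_EFinP.
have -> : \int[lebesgue_measure]_x g x = fine (\int[mu]_x (EFin \o g) x)%E.
  by [].
rewrite integralE.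
have -> : (\int[mu]_x (EFin \o g)^\- x = \int[mu]_x (EFin \o g)^\+ x)%E.
  have -> : ((EFin \o g)^\- = (EFin \o g)^\+ \o -%R)%E.
    by apply/funext => x; rewrite /= funenegE funeposE /= gN.
  have -> : (\int[mu]_x ((EFin \o g)^\+ \o -%R) x =
     \int[pushforward mu (-%R : _ -> measurableTypeR R)]_x (EFin \o g)^\+ x)%E.
    rewrite ge0_integral_pushforward//=.
    exact: measurable_funepos.
  apply: eq_measure_integral => A mA _.
  exact: lebesgue_measureN.
by case: (\int[mu]_x _)%E => //= r; rewrite subrr.
Qed.

Lemma Im_heat_integrand t p l : complex.Im (heat_integrand t p l) =
  sin (l * p.2) * (l / sinh (l * t)) *
  expR (- ((p.1.1 ^+ 2 + p.1.2 ^+ 2) / 4) * l * coth (l * t)).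
Proof. by rewrite /heat_integrand /expi/= !mulr0 !add0r. Qed.

Lemma sinhN (x : R) : sinh (- x) = - sinh x.
Proof. by rewrite /sinh opprK -mulNr opprB. Qed.

Lemma cothN (x : R) : coth (- x) = - coth x.
Proof. by rewrite /coth sinhN /cosh opprK addrC invrN mulrN. Qed.

Lemma heat_kernelC_real t p : complex.Im (heat_kernelC t p) = 0.
Proof.
have -> : complex.Im (heat_kernelC t p) = (8 * pi ^+ 2)^-1 *
   \int[lebesgue_measure]_l complex.Im (heat_integrand t p l).
  by rewrite /heat_kernelC /= mul0r addr0.
rewrite Rintegral_odd ?mulr0//; last first.
  move=> l; rewrite !Im_heat_integrand !mulNr sinN sinhN cothN.
  by rewrite invrN !(mulrN, mulNr) !opprK.
under eq_fun do rewrite Im_heat_integrand.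
have mt c : measurable_fun setT (fun l : R => l * c) by exact: measurable_funM.
have me : measurable_fun setT (fun l : R => expR (l * t)).
  exact: measurableT_comp (mt t).
have meN : measurable_fun setT (fun l : R => expR (- (l * t))).
  by apply: measurableT_comp => //; exact: measurableT_comp (mt t).
have msinh : measurable_fun setT (fun l : R => (sinh (l * t))^-1).
  by apply: measurable_funV; apply: measurable_funM => //; exact: measurable_funB.
have mcoth : measurable_fun setT (fun l : R => coth (l * t)).
  apply: measurable_funM => //; apply: measurable_funM => //.
  exact: measurable_funD.
apply: measurable_funM.
  apply: measurable_funM; last exact: measurable_funM.
  apply: (@measurableT_comp _ _ _ _ _ _ (@sin R)); last exact: mt.
  by apply: continuous_measurable_fun; exact: continuous_sin.
apply: measurableT_comp => //.
by apply: measurable_funM => //; exact: measurable_funM.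
Qed.

End Heisenberg.

(* Main.v *)
(* The inequality reduces to a Fisher information bound for the kernel [p] of
   [P_t].  Writing [P_t f] as an integral of [f] against translates of [p], the
   left-invariant gradient of [P_t f] at a point is minus the integral of
   [g = f (point * _)] against [V], the right-invariant gradient of [p].  Since the
   integral of [V] is [0], [g] may be replaced by [g - c] with [c = P_t f], and
   Cauchy-Schwarz against [V / sqrt p] bounds the squared gradient by the variance
   of [g] under [p] times the largest directional integral of [V ^ 2 / p].

   The rotations about the z-axis preserve [p] and make the Fisher information
   matrix scalar, so it is enough that its trace, the integral of
   [Gamma (p, p) / p], is at most [2 / t].  This is an integration by parts on large
   boxes: by self-similarity [L p + D p / (2 t) = - 2 p / t], where [D] generates
   the dilations [(x, y, z) -> (s x, s y, s^2 z)].  Dividing by [p + e] and using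
   the entropy [(p + e) ln (1 + p / e) - p] instead of [p ln p] keeps every quantity
   bounded, and no pointwise decay of [p] is needed.

   The facts used about [p] are its smoothness and heat equation, read off the
   integral formula, that its mass is at most [1], obtained by Abel summation in
   [z], and that it is nonnegative.  For the latter, [l coth (t l)] is the limit of
   a Riccati recursion built from [l ^ 2] by sums and resolvents, which preserve
   negative definite functions; hence [exp (- r ^ 2 l coth (t l) / 4)] and
   [l / sinh (t l)] are limits of positive definite functions of [l]. *)

Require Import Defs.
From HB Require Import structures.
From mathcomp Require Import all_boot all_order all_algebra.
From mathcomp Require Import all_classical all_reals all_analysis.
From mathcomp Require Import ring lra measurable_realfun complex.
Set Implicit Arguments.
Unset Strict Implicit.
Unset Printing Implicit Defensive.
Import Order.TTheory GRing.Theory Num.Theory.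
Import numFieldNormedType.Exports.
Local Open Scope classical_set_scope.
Local Open Scope ring_scope.

(** The constant comes from the homogeneous dimension. The dilations have divergence [4], so
    multiplying the self-similar equation by [ln p] and integrating by parts cancels the entropy
    terms and leaves [4 / (2 t)] times the mass as the trace. Each of the two horizontal directions
    takes half of it, which is the factor [1 / t] in front of the variance.

    The trace needed is that of the right-invariant fields, whereas the integration by parts uses
    the left-invariant ones. Since [p] is a function of [x ^ 2 + y ^ 2] and [z], both give the same
    sum of squares at every point.

    A mass [m <= 1] acts in the right direction at both places where it occurs: it bounds the trace
    from above, and it bounds the second moment of [g - c], which differs from that of [g] by
    [c ^ 2 m - 2 c ^ 2], by the variance. *)

Section integration.
Context d (T : measurableType d) (R : realType).
Variables (mu : {measure set T -> \bar R}) (D : set T).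
Hypothesis mD : measurable D.
Implicit Types f g : T -> R.

Lemma dominated_integrable f g : measurable_fun D f ->
  mu.-integrable D (EFin \o g) -> (forall x, D x -> `|f x| <= g x) ->
  mu.-integrable D (EFin \o f).
Proof.
move=> mf ig fg; apply: le_integrable ig => //; first exact/measurable_EFinP.
move=> x Dx /=; rewrite lee_fin (le_trans (fg x Dx))//.
exact: ler_norm.
Qed.

Lemma intgZ (c : R) f : mu.-integrable D (EFin \o f) ->
  mu.-integrable D (EFin \o (fun x => c * f x)).
Proof. by move=> fi; have := integrableZl mD c fi. Qed.

Lemma intgD f g : mu.-integrable D (EFin \o f) -> mu.-integrable D (EFin \o g) ->
  mu.-integrable D (EFin \o (fun x => f x + g x)).
Proof. by move=> fi gi; have := integrableD mD fi gi. Qed.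

Lemma intgB f g : mu.-integrable D (EFin \o f) -> mu.-integrable D (EFin \o g) ->
  mu.-integrable D (EFin \o (fun x => f x - g x)).
Proof. by move=> fi gi; have := integrableB mD fi gi. Qed.

Lemma intg_abs f : mu.-integrable D (EFin \o f) ->
  mu.-integrable D (EFin \o (fun x => `|f x|)).
Proof. by move=> fi; have := integrable_abse fi. Qed.

Lemma intg_measurable f : mu.-integrable D (EFin \o f) -> measurable_fun D f.
Proof. by move=> fi; apply/measurable_EFinP; exact: measurable_int fi. Qed.

Lemma integrable_mulbd f g (C : R) : measurable_fun D f ->
  (forall x, D x -> `|f x| <= C) -> mu.-integrable D (EFin \o g) ->
  mu.-integrable D (EFin \o (f \* g)).
Proof.
move=> mf fC ig; have mg : measurable_fun D g.
  by apply/measurable_EFinP; exact: measurable_int ig.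
have : mu.-integrable D (EFin \o (fun x => C * `|g x|)).
  exact/intgZ/intg_abs.
move=> iC; apply: (dominated_integrable _ iC); first exact: measurable_funM.
by move=> x Dx /=; rewrite normrM ler_wpM2r// fC.
Qed.

Lemma Rdominated_cvg (f_ : nat -> T -> R) f g :
  (forall n, measurable_fun D (f_ n)) ->
  (forall x, D x -> f_ n x @[n --> \oo] --> f x) ->
  mu.-integrable D (EFin \o g) ->
  (forall n x, D x -> `|f_ n x| <= g x) ->
  mu.-integrable D (EFin \o f) /\
  (\int[mu]_(x in D) f_ n x @[n --> \oo] --> \int[mu]_(x in D) f x).
Proof.
move=> mf cf ig fg.
have mfl : measurable_fun D f by exact: measurable_fun_cvg cf.
have cE x : D x -> (f_ n x)%:E @[n --> \oo] --> (f x)%:E.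
  by move=> Dx; apply: cvg_EFin; [exact: nearW|exact: cf].
have [|||//| |if_ _ cv] := @dominated_convergence _ _ _ mu _ mD
  (fun n x => (f_ n x)%:E) (EFin \o f) (EFin \o g).
- by move=> n; exact/measurable_EFinP.
- exact/measurable_EFinP.
- by apply: aeW => x Dx; exact: cE.
- by apply: aeW => x n Dx /=; rewrite lee_fin fg.
split => //; apply: fine_cvg.
rewrite fineK //; exact: integrable_fin_num.
Qed.

Lemma Rintegral_lin (a b : R) (f g : T -> R) :
  mu.-integrable D (EFin \o f) -> mu.-integrable D (EFin \o g) ->
  \int[mu]_(x in D) (a * f x + b * g x) =
  a * \int[mu]_(x in D) f x + b * \int[mu]_(x in D) g x.
Proof.
move=> fi gi; rewrite (RintegralD mD (intgZ a fi) (intgZ b gi)).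
by rewrite (RintegralZl _ mD fi) (RintegralZl _ mD gi).
Qed.

End integration.

Lemma le_Rintegral_subset d (T : measurableType d) (R : realType)
    (mu : {measure set T -> \bar R}) (D : set T) (f : T -> R) : measurable D ->
  mu.-integrable setT (EFin \o f) -> (forall x, 0 <= f x) ->
  \int[mu]_(x in D) f x <= \int[mu]_x f x.
Proof.
move=> mD fi f0; have fD : mu.-integrable D (EFin \o f) by exact: integrableS fi.
rewrite /Rintegral fine_le//.
- exact: integrable_fin_num fD.
- exact: integrable_fin_num fi.
- apply: ge0_subset_integral => //; first by case/integrableP : fi.
  by move=> x _; rewrite lee_fin.
Qed.

(** * Positivity of cosine transforms *)

Section cosine_multipliers.
Context {R : realType}.
Let mu : {measure set (measurableTypeR R) -> \bar R} := @lebesgue_measure R.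
Let D : set (measurableTypeR R) := `]0, +oo[.
Implicit Types f g phi psi : R -> R.

(** The even extension of [g] is integrable with nonnegative Fourier transform. The open half line
    leaves out [0], where [l / sinh (l * t)] has a default value. *)
Definition cospos g := mu.-integrable D (EFin \o g) /\
  forall a, 0 <= \int[mu]_(x in D) (g x * cos (a * x)).

(* The functions acting by multiplication on nonnegative cosine transforms:
   a substitute for positive definiteness that avoids Bochner's theorem. *)
Definition cosmul phi := [/\ measurable_fun D phi,
  exists C, forall x, D x -> `|phi x| <= C &
  forall g, cospos g -> cospos (phi \* g)].

Let mD : measurable D. Proof. exact: measurable_itv. Qed.

Lemma measurable_cosM a : measurable_fun D (fun x : R => cos (a * x)).
Proof.
apply: measurable_funTS; apply: measurableT_comp; last exact: measurable_funM.
by apply: continuous_measurable_fun; exact: continuous_cos.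
Qed.

Lemma cospos_int g a : mu.-integrable D (EFin \o g) ->
  mu.-integrable D (EFin \o (fun x => g x * cos (a * x))).
Proof.
move=> ig; have -> : (fun x => g x * cos (a * x)) = (fun x => cos (a * x)) \* g.
  by apply/funext => x /=; rewrite mulrC.
apply: (@integrable_mulbd _ (measurableTypeR R) _ mu _ mD _ _ 1) => //; first exact: measurable_cosM.
by move=> x _; exact: cos_max.
Qed.

Lemma cosmul_cst (c : R) : 0 <= c -> cosmul (cst c).
Proof.
move=> c0; split=> //; first by exists `|c|.
move=> g [ig g0]; have ic : mu.-integrable D (EFin \o (cst c \* g)).
  by apply: (@integrable_mulbd _ (measurableTypeR R) _ mu _ mD _ _ `|c|).
split=> // a; rewrite (_ : (fun x => _) = (fun x => c * (g x * cos (a * x)))).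
  by rewrite RintegralZl// ?mulr_ge0//; exact: cospos_int.
by apply/funext => x /=; rewrite mulrA.
Qed.

(** By the product-to-sum formula, multiplying [g] by [cos (b * x)] replaces its transform at [a] by
    the average of its values at [b + a] and [b - a]. *)
Lemma cosmul_cos b : cosmul (fun x => cos (b * x)).
Proof.
split; [exact: measurable_cosM|by exists 1 => x _; exact: cos_max|].
move=> g [ig g0]; split.
  by apply: (@integrable_mulbd _ (measurableTypeR R) _ mu _ mD _ _ 1) => // [|x _];
    [exact: measurable_cosM|exact: cos_max].
move=> a; rewrite (_ : (fun x => _ * cos (a * x)) = (fun x => 2^-1 * (g x * cos ((b + a) * x)
  + g x * cos ((b - a) * x)))); last first.
  by apply/funext => x /=; rewrite !mulrDl mulNr cosD cosB; field.
rewrite RintegralZl//; last first.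
  by apply: intgD => //; exact: cospos_int.
rewrite RintegralD//; [|exact: cospos_int..].
by rewrite mulr_ge0// addr_ge0.
Qed.

(** Acting on transforms makes closure under products a mere composition; with nonnegative
    transforms themselves it would take a convolution. *)
Lemma cosmulM phi psi : cosmul phi -> cosmul psi -> cosmul (phi \* psi).
Proof.
move=> [mp [C pC] p] [mq [C' qC] q]; split; first exact: measurable_funM.
  by exists (C * C') => x Dx /=; rewrite normrM ler_pM ?pC ?qC.
move=> g /q/p; congr cospos; apply/funext => x /=; exact: mulrA.
Qed.

Lemma cosmulD phi psi : cosmul phi -> cosmul psi -> cosmul (phi \+ psi).
Proof.
move=> [mp [C pC] p] [mq [C' qC] q]; split; first exact: measurable_funD.
  by exists (C + C') => x Dx /=; rewrite (le_trans (ler_normD _ _))// lerD ?pC ?qC.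
move=> g cg; have [ip p0] := p _ cg; have [iq q0] := q _ cg.
have E : ((phi \+ psi) \* g) = (phi \* g) \+ (psi \* g).
  by apply/funext => x /=; rewrite mulrDl.
split; first by rewrite E; exact: intgD.
move=> a; rewrite E (_ : (fun x => _) = (fun x => (phi \* g) x * cos (a * x) +
    (psi \* g) x * cos (a * x))); last by apply/funext => x; exact: mulrDl.
rewrite RintegralD//; [|exact: cospos_int..].
exact: addr_ge0.
Qed.

Lemma cosmulX phi n : cosmul phi -> cosmul (fun x => phi x ^+ n).
Proof.
move=> p; elim: n => [|n ih].
  rewrite (_ : (fun=> _) = cst 1); last by apply/funext => x; rewrite expr0.
  exact: cosmul_cst.
rewrite (_ : (fun=> _) = phi \* (fun x => phi x ^+ n)); first exact: cosmulM.
by apply/funext => x /=; rewrite exprS.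
Qed.

Lemma cosmul_sum (phi_ : nat -> R -> R) n : (forall k, cosmul (phi_ k)) ->
  cosmul (fun x => \sum_(0 <= k < n) phi_ k x).
Proof.
move=> p; elim: n => [|n ih].
  rewrite (_ : (fun=> _) = cst 0); first exact: cosmul_cst.
  by apply/funext => x; rewrite big_nil.
rewrite (_ : (fun=> _) = (fun x => \sum_(0 <= k < n) phi_ k x) \+ phi_ n).
  exact: cosmulD.
by apply/funext => x; rewrite big_nat_recr.
Qed.

(** The uniform bound [C] provides the dominating function [C * |g|], so nonnegativity of the
    transforms passes to the limit. *)
Lemma cosmul_lim (phi_ : nat -> R -> R) phi C : (forall n, cosmul (phi_ n)) ->
  (forall n x, D x -> `|phi_ n x| <= C) ->
  (forall x, D x -> phi_ n x @[n --> \oo] --> phi x) -> cosmul phi.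
Proof.
move=> p pC cp.
have bd x : D x -> `|phi x| <= C.
  move=> Dx; have <- := cvg_lim _ (cvg_norm (cp x Dx)) => //.
  apply: limr_le; first by apply/cvg_ex; eexists; exact: cvg_norm (cp x Dx).
  by apply: nearW => n; exact: pC.
have mp : measurable_fun D phi.
  by apply: measurable_fun_cvg cp => n; have [] := p n.
split=> //; first by exists C.
move=> g [ig g0]; have mg : measurable_fun D g.
  by apply/measurable_EFinP; exact: measurable_int ig.
split; first exact: (@integrable_mulbd _ (measurableTypeR R) _ mu _ mD _ _ C).
move=> a.
have iC : mu.-integrable D (EFin \o (fun x => C * `|g x|)).
  exact/intgZ/intg_abs.
have [|x Dx|n x Dx|_ cv] := @Rdominated_cvg _ (measurableTypeR R) _ mu _ mD
  (fun n x => (phi_ n \* g) x * cos (a * x)) (fun x => (phi \* g) x * cos (a * x))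
  _ _ _ iC.
- move=> n; apply: measurable_funM; last exact: measurable_cosM.
  by apply: measurable_funM => //; have [] := p n.
- by apply: cvgMr_tmp; apply: cvgMr_tmp; exact: cp.
- rewrite /= !normrM -[leRHS]mulr1 ler_pM ?mulr_ge0 ?cos_max//.
  by rewrite ler_wpM2r// pC.
rewrite -(cvg_lim _ cv)//; apply: limr_ge; first by apply/cvg_ex; eexists; exact: cv.
by apply: nearW => n; have [_ _ /(_ g)[]] := p n.
Qed.

Lemma cosmul_ext phi psi : (forall x, D x -> phi x = psi x) ->
  cosmul phi -> cosmul psi.
Proof.
move=> pq cp; have [_ [C pC] _] := cp.
(* Equality holds on [D] only; a constant sequence, viewed as converging to [psi], transfers
   measurability, bound and positivity at once. *)
apply: (@cosmul_lim (fun=> phi) psi C) => // x Dx.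
by rewrite pq//; exact: cvg_cst.
Qed.

(** The partial sums of the exponential series have nonnegative coefficients, so they are
    multipliers, and [expR (s * C)] bounds them all on [D]. *)
Lemma cosmul_exp phi s : 0 <= s -> cosmul phi -> cosmul (fun x => expR (s * phi x)).
Proof.
move=> s0 cp; have [_ [C pC] _] := cp.
apply: (@cosmul_lim (fun n x => series (exp_coeff (s * phi x)) n) _
    (expR (s * C))).
- move=> n; apply: cosmul_sum => k.
  apply: (@cosmul_ext (cst (s ^+ k / k`!%:R) \* (fun x => phi x ^+ k))).
    by move=> x _ /=; rewrite /exp_coeff/= exprMn mulrAC.
  apply: cosmulM; last exact: cosmulX.
  by apply: cosmul_cst; rewrite divr_ge0// exprn_ge0.
- move=> n x Dx; have C0 : 0 <= C by rewrite (le_trans _ (pC x Dx)).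
  apply: (@le_trans _ _ (series (exp_coeff (s * C)) n)).
    rewrite /series/= (le_trans (ler_norm_sum _ _ _))//.
    apply: ler_sum => k _; rewrite /exp_coeff/= normrM normrX normrM (ger0_norm s0).
    rewrite [`|_^-1|]ger0_norm ?invr_ge0// ler_wpM2r ?invr_ge0//.
    by rewrite lerXn2r ?nnegrE ?mulr_ge0// ler_wpM2l// pC.
  apply: nondecreasing_cvgn_le; last exact: is_cvg_series_exp_coeff.
  apply/nondecreasing_seqP => m; rewrite /series/= big_nat_recr//= lerDl.
  by apply: exp_coeff_ge0; rewrite mulr_ge0.
- by move=> x Dx; exact: is_cvg_series_exp_coeff.
Qed.

End cosine_multipliers.

(** * Negative definite functions and the discrete Riccati flow *)

Section negative_definite.
Context {R : realType}.
Let D : set (measurableTypeR R) := `]0, +oo[.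
Implicit Types (f g phi psi : R -> R) (c s h e t x : R).

(* Schoenberg's characterization of negative definite functions, taken as a
   definition. *)
Definition cosneg psi := (forall x, D x -> 0 <= psi x) /\
  forall s, 0 <= s -> cosmul (fun x => expR (- (s * psi x))).

Lemma D_gt0 (x : R) : D x -> 0 < x.
Proof. by rewrite /D/= in_itv/= andbT. Qed.

Lemma cosneg_ext phi psi : (forall x, D x -> phi x = psi x) ->
  cosneg phi -> cosneg psi.
Proof.
move=> pq [p0 p]; split=> [x Dx|s s0]; first by rewrite -pq// p0.
by apply: cosmul_ext (p s s0) => x Dx; rewrite pq.
Qed.

Lemma cosneg_cst c : 0 <= c -> cosneg (cst c).
Proof.
move=> c0; split=> // s s0.
by apply: (@cosmul_cst _ (expR (- (s * c)))); exact: expR_ge0.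
Qed.

Lemma cosnegD phi psi : cosneg phi -> cosneg psi -> cosneg (phi \+ psi).
Proof.
move=> [p0 p] [q0 q]; split=> [x Dx|s s0]; first by rewrite addr_ge0// ?p0 ?q0.
apply: cosmul_ext (cosmulM (p s s0) (q s s0)) => x _ /=.
by rewrite -expRD mulrDr opprD.
Qed.

Lemma cosnegZ c psi : 0 <= c -> cosneg psi -> cosneg (fun x => c * psi x).
Proof.
move=> c0 [p0 p]; split=> [x Dx|s s0]; first by rewrite mulr_ge0// p0.
by apply: cosmul_ext (p (s * c) (mulr_ge0 s0 c0)) => x _; rewrite mulrA.
Qed.

Lemma cosneg_lim (psi_ : nat -> R -> R) psi : (forall n, cosneg (psi_ n)) ->
  (forall x, D x -> psi_ n x @[n --> \oo] --> psi x) -> cosneg psi.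
Proof.
move=> p cp; split=> [x Dx|s s0].
  rewrite -(cvg_lim _ (cp x Dx))//; apply: limr_ge.
    by apply/cvg_ex; eexists; exact: cp x Dx.
  by apply: nearW => n; have [+ _] := p n; exact.
apply: (@cosmul_lim _ (fun n x => expR (- (s * psi_ n x))) _ 1).
- by move=> n; have [_] := p n; exact.
- move=> n x Dx; rewrite ger0_norm ?expR_ge0// expR_le1 oppr_le0 mulr_ge0//.
  by have [+ _] := p n; exact.
- move=> x Dx; apply: continuous_cvg; first exact: continuous_expR.
  by apply: cvgN; apply: cvgMl_tmp; exact: cp.
Qed.

(** [exp (- s (c - phi))] is the constant [exp (- s c)] times [exp (s phi)], and the exponential of
    a multiplier is a multiplier. *)
Lemma cosnegB c phi : (forall x, D x -> phi x <= c) -> cosmul phi ->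
  cosneg (fun x => c - phi x).
Proof.
move=> pc cp; split=> [x Dx|s s0]; first by rewrite subr_ge0 pc.
apply: cosmul_ext (cosmulM (cosmul_cst (expR_ge0 (- (s * c)))) (cosmul_exp s0 cp)).
by move=> x _ /=; rewrite -expRD; congr expR; ring.
Qed.

Lemma cvg_slope (f : R -> R) (l : R) (u : nat -> R) :
  is_derive (0 : R) (1 : R) f l -> (forall n, u n != 0) ->
  u n @[n --> \oo] --> 0 ->
  (f (u n) - f 0) / u n @[n --> \oo] --> l.
Proof.
move=> df u0 cu; have [df1 df2] := df.
have : h^-1 *: (f (h *: (1:R) + 0) - f 0) @[h --> 0^'] --> l.
  by rewrite -df2; exact: df1.
move=> /cvgr_dnbhsP/(_ u (conj u0 cu)) h.
rewrite (_ : (fun n => _) = (fun n => (u n)^-1 *: (f (u n *: (1:R) + 0) - f 0)))//.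
by apply/funext => n; rewrite addr0 mulrC /GRing.scale/= mulr1.
Qed.

Lemma cvg_divn (x : R) : x / n.+1%:R @[n --> \oo] --> 0.
Proof.
rewrite -[X in _ --> X](mulr0 x); apply: cvgMl_tmp.
exact: cvg_harmonic.
Qed.

Lemma cosneg_sqr : cosneg (fun x => x ^+ 2).
Proof.
(* [x ^ 2] is the limit of [2 N ^ 2 (1 - cos (x / N))], a constant minus a multiplier. With
   [u = x / (2 N)] this is [(x sin u / u) ^ 2]. *)
apply: (@cosneg_lim (fun n x => 2 * n.+1%:R ^+ 2 - 2 * n.+1%:R ^+ 2 *
   cos (n.+1%:R^-1 * x))) => [n|x Dx].
  apply: cosnegB => [x Dx|].
    by rewrite -[leRHS]mulr1 ler_wpM2l ?mulr_ge0 ?sqr_ge0 ?cos_le1.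
  by apply: cosmulM; [apply: cosmul_cst; rewrite mulr_ge0 ?sqr_ge0
                     |exact: cosmul_cos].
have x0 := D_gt0 Dx.
pose u n : R := (x / 2) / n.+1%:R.
have u0 n : u n != 0 by rewrite /u !mulf_neq0 ?invr_eq0 ?gt_eqF// pnatr_eq0.
rewrite (_ : (fun n => _) = (fun n => (x * ((sin (u n) - sin 0) / u n)) ^+ 2)).
  rewrite (_ : x ^+ 2 = (x * 1) * (x * 1)); last by rewrite mulr1 expr2.
  have h : x * ((sin (u n) - sin 0) / u n) @[n --> \oo] --> x * 1.
    apply: cvgMl_tmp; apply: (cvg_slope _ u0); last exact: cvg_divn.
    by have := is_derive_sin (0 : R); rewrite cos0.
  under eq_fun do rewrite expr2.
  exact: cvgM.
apply/funext => n; rewrite sin0 subr0.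
have -> : n.+1%:R^-1 * x = u n *+ 2 by rewrite /u mulr2n; field; rewrite addrC natr1 pnatr_eq0.
rewrite cos_mulr2n cos2sin2 /u.
move: (sin _) => S; field.
by rewrite (gt_eqF x0) addrC natr1 pnatr_eq0.
Qed.

(** Geometric series in [exp (- e (1 + psi))], whose powers are multipliers; the summand [1] in
    [1 + psi] keeps the ratio at most [exp (- e) < 1]. *)
Lemma cosmul_geom (e : R) psi : 0 < e -> cosneg psi ->
  cosmul (fun x => (1 - expR (- (e * (1 + psi x))))^-1).
Proof.
move=> e0 [p0 p].
have q1 x : D x -> 0 <= expR (- (e * (1 + psi x))) <= expR (- e).
  move=> Dx; rewrite expR_ge0 ler_expR lerN2 -[leLHS]mulr1 ler_wpM2l ?(ltW e0)//.
  by rewrite lerDl p0.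
have e1 : expR (- e) < 1 by rewrite expR_lt1 oppr_lt0.
apply: (@cosmul_lim _
  (fun n x => \sum_(0 <= k < n) expR (- (e * (1 + psi x))) ^+ k) _ (1 - expR (-e))^-1).
- move=> n; apply: cosmul_sum => k; apply: cosmulX.
  apply: cosmul_ext (cosmulM (cosmul_cst (expR_ge0 (- e))) (p e (ltW e0))).
  by move=> x Dx /=; rewrite -expRD; congr expR; ring.
- move=> n x Dx; have /andP[qa qb] := q1 _ Dx.
  rewrite ger0_norm; last by apply: sumr_ge0 => k _; rewrite exprn_ge0.
  have -> : \sum_(0 <= k < n) expR (- (e * (1 + psi x))) ^+ k =
     (1 - expR (- (e * (1 + psi x))) ^+ n) / (1 - expR (- (e * (1 + psi x)))).
    have n0 : 1 - expR (- (e * (1 + psi x))) != 0.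
      by rewrite subr_eq0 gt_eqF// (le_lt_trans qb).
    have := subrXX 1 (expR (- (e * (1 + psi x)))) n; rewrite expr1n => ->.
    rewrite mulrAC divff// mul1r big_mkord; apply: eq_bigr => i _.
    by rewrite expr1n mul1r.
  rewrite -[leRHS]mul1r ler_pM ?invr_ge0 ?subr_ge0 ?(le_trans qb (ltW e1))//.
  + by rewrite exprn_ile1// (le_trans qb (ltW e1)).
  + by rewrite lef_pV2 ?posrE ?subr_gt0 ?(le_lt_trans qb)// lerB.
- move=> x Dx; have /andP[qa qb] := q1 _ Dx.
  have := @cvg_geometric_series R 1 (expR (- (e * (1 + psi x)))).
  rewrite ger0_norm// => /(_ (le_lt_trans qb e1)); rewrite mul1r.
  rewrite (_ : series _ = (fun n => \sum_(0 <= k < n) expR (- (e * (1 + psi x))) ^+ k))//.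
  by apply/funext => n; rewrite /series/=; apply: eq_bigr => i _; rewrite /geometric/= mul1r.
Qed.

(** [1 / (1 + psi)] is the integral of [exp (- s (1 + psi))] over [s > 0], and the geometric sums of
    mesh [e] are its Riemann sums. They are at most [1 + e], hence the bound [2]. *)
Lemma cosmul_inv1D psi : cosneg psi -> cosmul (fun x => (1 + psi x)^-1).
Proof.
move=> cp; have [p0 p] := cp.
apply: (@cosmul_lim _ (fun n x => n.+1%:R^-1 *
   (1 - expR (- (n.+1%:R^-1 * (1 + psi x))))^-1) _ 2).
- move=> n; apply: cosmulM; first exact: cosmul_cst.
  by apply: cosmul_geom.
- move=> n x Dx; set e : R := n.+1%:R^-1.
  have e0 : 0 < e by rewrite /e.
  have e1 : e <= 1 by rewrite /e invf_le1// ler1n.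
  have ee : expR (- (e * (1 + psi x))) <= expR (- e).
    by rewrite ler_expR lerN2 -[leLHS]mulr1 ler_wpM2l ?(ltW e0)// lerDl p0.
  have e3 : expR (- e) <= (1 + e)^-1.
    by rewrite expRN lef_pV2 ?posrE ?expR_gt0 ?addr_gt0// expR_ge1Dx.
  have e4 : e / (1 + e) <= 1 - expR (- (e * (1 + psi x))).
    rewrite (le_trans _ (lerB (lexx 1) (le_trans ee e3)))//.
    by rewrite le_eqVlt; apply/orP; left; apply/eqP; field; rewrite gt_eqF// addr_gt0.
  have e5 : 0 < e / (1 + e) by rewrite divr_gt0// addr_gt0.
  rewrite ger0_norm; last first.
    by rewrite mulr_ge0 ?(ltW e0)// invr_ge0 (le_trans (ltW e5)).
  rewrite ler_pdivrMr; last exact: lt_le_trans e4.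
  rewrite (le_trans _ (ler_wpM2l _ e4))// mulrA ler_pdivlMr ?addr_gt0//.
  by clear -e0 e1; nra.
- move=> x Dx; set a := 1 + psi x.
  have a0 : 0 < a by rewrite ltr_wpDr ?p0.
  pose u n : R := - a / n.+1%:R.
  have u0 n : u n != 0 by rewrite /u mulf_neq0 ?invr_eq0 ?oppr_eq0 ?gt_eqF// pnatr_eq0.
  have h : (expR (u n) - expR 0) / u n @[n --> \oo] --> (1:R).
    apply: (cvg_slope _ u0); last exact: cvg_divn.
    by have := is_derive_expR (0 : R); rewrite expR0.
  have {}h : ((expR (u n) - expR 0) / u n)^-1 @[n --> \oo] --> (1:R).
    by rewrite -[X in _ --> X]invr1; apply: cvgV => //; exact: oner_neq0.
  rewrite -[X in _ --> X]mulr1.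
  rewrite (_ : (fun n => _) = (fun n => a^-1 * ((expR (u n) - expR 0) / u n)^-1)).
    exact: cvgMl_tmp.
  apply/funext => n; rewrite expR0 /u invfM invrK -[1 - _]opprB invrN.
  rewrite (_ : - a / n.+1%:R = - (n.+1%:R^-1 * a)); last by ring.
  move: (_ - 1)^-1 => E; move: (n.+1%:R^-1) => d.
  by field; rewrite gt_eqF.
Qed.

(** It is [1 / h] times [1 - 1 / (1 + h psi)], a constant minus a multiplier bounded by it. *)
Lemma cosneg_resolvent h psi : 0 < h -> cosneg psi ->
  cosneg (fun x => psi x / (1 + h * psi x)).
Proof.
move=> h0 cp; have hp := cosnegZ (ltW h0) cp; have [p0 _] := hp.
have a0 x : D x -> 0 < 1 + h * psi x by move=> Dx; rewrite ltr_wpDr ?p0.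
apply: (@cosneg_ext (fun x => h^-1 * (1 - (1 + h * psi x)^-1))).
  by move=> x Dx; field; rewrite !gt_eqF// a0.
apply: cosnegZ; first by rewrite invr_ge0 ltW.
apply: cosnegB; last exact: cosmul_inv1D.
by move=> x Dx; rewrite invf_le1 ?a0// lerDl p0.
Qed.

(* Euler scheme of step [h] for [A' = x ^+ 2 * B], [B' = A]; the quotient [A / B]
   then runs through a discrete Riccati flow, each step of which adds
   [h * x ^+ 2] and takes a resolvent. *)
Fixpoint riccati h x n : R * R :=
  if n is n'.+1 then
    let: (A, B) := riccati h x n' in
    (A + h * x ^+ 2 * B, B + h * (A + h * x ^+ 2 * B))
  else (1, 0).

Lemma riccatiS h x n : riccati h x n.+1 =
  ((riccati h x n).1 + h * x ^+ 2 * (riccati h x n).2,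
   (riccati h x n).2 + h * ((riccati h x n).1 + h * x ^+ 2 * (riccati h x n).2)).
Proof. by rewrite /=; case: (riccati h x n). Qed.

Arguments riccati : simpl never.

(** With [h = t / n] the second bound is [t] after [n] steps, which bounds the reciprocals uniformly
    in [n]. *)
Lemma riccati_ge h x n : 0 < h ->
  1 <= (riccati h x n).1 /\ n%:R * h <= (riccati h x n).2.
Proof.
move=> h0; elim: n => [|n]; first by rewrite /riccati/= mul0r !lexx.
rewrite riccatiS/=; case: (riccati h x n) => A B /= [A1 B0].
have B0' : 0 <= B by rewrite (le_trans _ B0)// mulr_ge0// ltW.
have A1' : 1 <= A + h * x ^+ 2 * B.
  by rewrite (le_trans A1)// lerDl mulr_ge0// mulr_ge0 ?sqr_ge0// ltW.
split=> //; rewrite -natr1 mulrDl mul1r lerD// -[leLHS]mulr1.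
by rewrite ler_wpM2l// ltW.
Qed.

Lemma riccati_gt0 h x n : 0 < h -> 0 < (riccati h x n.+1).2.
Proof.
move=> h0; have [_] := riccati_ge x n.+1 h0; apply: lt_le_trans.
by rewrite mulr_gt0.
Qed.

(** With [q = A / B] and [T = q + h x ^ 2], one step replaces [q] by [T / (1 + h T)] and [1 / B] by
    [(1 / B) / (1 + h T)]: sums, resolvents and products suffice. *)
Lemma cosneg_riccati h n : 0 < h ->
  cosneg (fun x => (riccati h x n.+1).1 / (riccati h x n.+1).2) /\
  cosmul (fun x => ((riccati h x n.+1).2)^-1).
Proof.
move=> h0; elim: n => [|n [ihA ihB]].
  (* The induction starts after one step, where the pair is [(1, h)]; initially [B = 0] and the
     quotient would be infinite. *)
  split.
    apply: (@cosneg_ext (cst h^-1)); last by apply: cosneg_cst; rewrite invr_ge0 ltW.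
    by move=> x _; rewrite (riccatiS h x 0) /riccati/= !(mulr0, addr0, add0r, mulr1, mul1r).
  apply: (@cosmul_ext _ (cst h^-1)); last by apply: cosmul_cst; rewrite invr_ge0 ltW.
  by move=> x _; rewrite (riccatiS h x 0) /riccati/= !(mulr0, addr0, add0r, mulr1, mul1r).
have cth := cosnegD ihA (cosnegZ (ltW h0) cosneg_sqr).
split.
  apply: cosneg_ext (cosneg_resolvent h0 cth) => x Dx.
  have := riccati_gt0 x n h0; have := riccati_gt0 x n.+1 h0.
  rewrite [riccati h x n.+2]riccatiS/=; case: (riccati h x n.+1) => [A B] /= B0' B0.
  by field; rewrite !gt_eqF.
apply: cosmul_ext (cosmulM ihB (cosmul_inv1D (cosnegZ (ltW h0) cth))) => x Dx /=.
have := riccati_gt0 x n h0; have := riccati_gt0 x n.+1 h0.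
rewrite [riccati h x n.+2]riccatiS; case: (riccati h x n.+1) => [A B] /= B0' B0.
by field; rewrite !gt_eqF.
Qed.

(** The scheme is symplectic: it conserves this perturbation of [A ^ 2 - (x B) ^ 2], the discrete
    form of [cosh ^ 2 - sinh ^ 2 = 1]. *)
Lemma riccati_inv h x n :
  let: (A, B) := riccati h x n in
  A ^+ 2 - (x * B) ^+ 2 + h * x * A * (x * B) = 1.
Proof.
elim: n => [|n]; first by rewrite /riccati expr1n !mulr0 expr0n subr0 addr0.
by rewrite riccatiS; case: (riccati h x n) => A B /= <-; ring.
Qed.

(* [A + x B] is multiplied by a factor between [1 + h x] and
   [1 + h x + (h x)^2] at each step. *)
Lemma riccati_sum h x n : 0 < h -> 0 < x ->
  (1 + h * x) ^+ n <= (riccati h x n).1 + x * (riccati h x n).2 <=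
  expR (n%:R * (h * x + (h * x) ^+ 2)).
Proof.
move=> h0 x0; have v0 : 0 < h * x by rewrite mulr_gt0.
elim: n => [|n].
  by rewrite expr0 mul0r expR0 /riccati/= mulr0 addr0 lexx.
have := riccati_ge x n h0; rewrite riccatiS/=; case: (riccati h x n) => A B /= [A1 B0].
have {}B0 : 0 <= B by rewrite (le_trans _ B0)// mulr_ge0// ltW.
have C0 : 0 <= x * B by rewrite mulr_ge0// ltW.
move=> /andP[P1 P2].
have -> : A + h * x ^+ 2 * B + x * (B + h * (A + h * x ^+ 2 * B)) =
  (1 + h * x) * (A + x * B) + (h * x) ^+ 2 * (x * B) by ring.
apply/andP; split.
  rewrite exprS (le_trans (ler_wpM2l _ P1)) ?addr_ge0 ?(ltW v0)//.
  by rewrite lerDl mulr_ge0// sqr_ge0.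
have -> : n.+1%:R * (h * x + (h * x) ^+ 2) =
    (h * x + (h * x) ^+ 2) + n%:R * (h * x + (h * x) ^+ 2) by rewrite -natr1; ring.
rewrite expRD.
apply: (@le_trans _ _ ((1 + (h * x + (h * x) ^+ 2)) * (A + x * B))).
  rewrite addrA [leRHS]mulrDl lerD2l ler_wpM2l ?sqr_ge0// lerDr.
  by rewrite (le_trans _ A1).
rewrite ler_pM ?expR_ge1Dx ?addr_ge0 ?sqr_ge0 ?(ltW v0)//.
by rewrite (le_trans _ A1).
Qed.

(** The sum [A + x B] is squeezed to [exp (t x)]. The conserved quantity, divided by this sum, then
    gives the limit [exp (- t x)] of [A - x B]. *)
Lemma cvg_riccati t x : 0 < t -> 0 < x ->
  ((riccati (t / n.+1%:R) x n.+1).1 @[n --> \oo] --> cosh (t * x)) /\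
  ((riccati (t / n.+1%:R) x n.+1).2 @[n --> \oo] --> sinh (t * x) / x).
Proof.
move=> t0 x0; set T := t * x; have T0 : 0 < T by rewrite mulr_gt0.
pose v n := T / n.+1%:R.
have v0 n : 0 < v n by rewrite divr_gt0.
have h0 n : 0 < t / n.+1%:R by rewrite divr_gt0.
have vE n : t / n.+1%:R * x = v n by rewrite /v /T mulrAC.
have cv : v n @[n --> \oo] --> 0 by exact: cvg_divn.
pose A n := (riccati (t / n.+1%:R) x n.+1).1.
pose B n := (riccati (t / n.+1%:R) x n.+1).2.
have nv n : n.+1%:R * v n = T by rewrite /v mulrC divfK// pnatr_eq0.
have A0 n : 0 <= A n.
  by have [+ _] := riccati_ge x n.+1 (h0 n); apply: le_trans.
have B0 n : 0 <= x * B n.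
  by rewrite mulr_ge0 ?(ltW x0)// ltW// riccati_gt0.
(* [1 + v >= exp (v / (1 + v))], because [exp (- v / (1 + v)) >= 1 - v / (1 + v) = 1 / (1 + v)]. *)
have P1 n : expR (T / (1 + v n)) <= A n + x * B n.
  have /andP[+ _] := riccati_sum n.+1 (h0 n) x0; apply: le_trans.
  rewrite vE -[X in X / _](nv n) -mulrA expRM_natl lerXn2r ?nnegrE ?expR_ge0//.
    by rewrite addr_ge0// ltW.
  rewrite -[leRHS]invrK -[leLHS]invrK -expRN lef_pV2 ?posrE ?expR_gt0 ?invr_gt0 ?addr_gt0//.
  rewrite (le_trans _ (expR_ge1Dx _))// le_eqVlt; apply/orP; left; apply/eqP.
  by field; rewrite gt_eqF// addr_gt0.
have P2 n : A n + x * B n <= expR (T + T * v n).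
  have /andP[_] := riccati_sum n.+1 (h0 n) x0; rewrite vE mulrDr nv.
  by rewrite expr2 mulrA nv.
have cP : A n + x * B n @[n --> \oo] --> expR T.
  apply: (@squeeze_cvgr _ _ _ _ (fun n => expR (T / (1 + v n)))
     (fun n => expR (T + T * v n))).
  - by apply: nearW => n; rewrite P1 P2.
  - apply: continuous_cvg; first exact: continuous_expR.
    rewrite -[X in _ --> X]divr1; apply: cvgMl_tmp; apply: cvgV; first exact: oner_neq0.
    by rewrite -[X in _ --> X]addr0; apply: cvgD => //; exact: cvg_cst.
  - apply: continuous_cvg; first exact: continuous_expR.
    rewrite -[X in _ --> X]addr0; apply: cvgD; first exact: cvg_cst.
    by rewrite -[X in _ --> X](mulr0 T); exact: cvgMl_tmp.
have PQ n : A n - x * B n = (1 - v n * A n * (x * B n)) / (A n + x * B n).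
  have := riccati_inv (t / n.+1%:R) x n.+1.
  have := lt_le_trans (expR_gt0 _) (P1 n).
  rewrite vE /A /B; case: (riccati _ _ _) => a b /= p E.
  by rewrite -E; field; rewrite gt_eqF.
have cAB : v n * A n * (x * B n) @[n --> \oo] --> 0.
  apply: (@squeeze_cvgr _ _ _ _ (cst 0) (fun n => v n * ((A n + x * B n) ^+ 2))).
  - apply: nearW => n /=; rewrite -mulrA (mulr_ge0 (ltW (v0 n)) (mulr_ge0 (A0 n) (B0 n)))/=.
    rewrite ler_wpM2l ?(ltW (v0 n))//.
    by have := A0 n; have := B0 n; move: (A n) (x * B n) => a b b0 a0; nra.
  - exact: cvg_cst.
  - rewrite -[X in _ --> X](mul0r (expR T * expR T)); apply: cvgM => //.
    by under eq_fun do rewrite expr2; exact: cvgM.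
have cQ : A n - x * B n @[n --> \oo] --> expR (- T).
  rewrite (_ : (fun n => _) = (fun n => (1 - v n * A n * (x * B n)) / (A n + x * B n))).
    rewrite expRN -[X in _ --> X]mul1r (_ : 1 * _ = (1 - 0) / expR T); last by rewrite subr0.
    apply: cvgM; last by apply: cvgV => //; rewrite gt_eqF// expR_gt0.
    by apply: cvgB => //; exact: cvg_cst.
  by apply/funext => n; exact: PQ.
split.
  rewrite (_ : (fun n => _) = (fun n => ((A n + x * B n) + (A n - x * B n)) / 2)).
    by apply: cvgMr_tmp; exact: cvgD.
  by apply/funext => n; rewrite -/(A n); field.
rewrite (_ : (fun n => _) = (fun n => ((A n + x * B n) - (A n - x * B n)) / 2 / x)).
  by do 2 apply: cvgMr_tmp; exact: cvgB.
by apply/funext => n; rewrite -/(B n); field; rewrite gt_eqF.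
Qed.

Lemma sinh_gt0 x : 0 < x -> 0 < sinh x.
Proof.
by move=> x0; rewrite /sinh divr_gt0// subr_gt0 ltr_expR gtrN.
Qed.

Lemma cosmul_heat t (w : R) : 0 < t -> 0 <= w ->
  cosmul (fun x => x / sinh (t * x) * expR (- (w * (x * coth (t * x))))).
Proof.
move=> t0 w0; have h0 n : 0 < t / n.+1%:R by rewrite divr_gt0.
have s0 x : D x -> sinh (t * x) / x != 0.
  by move=> /D_gt0 x0; rewrite gt_eqF// divr_gt0// sinh_gt0// mulr_gt0.
apply: cosmulM.
  apply: (@cosmul_lim _ (fun n x => ((riccati (t / n.+1%:R) x n.+1).2)^-1) _ t^-1).
  - by move=> n; have [] := cosneg_riccati n (h0 n).
  - move=> n x Dx; have [_] := riccati_ge x n.+1 (h0 n).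
    rewrite mulrCA divff ?mulr1 ?pnatr_eq0// => B0.
    have B1 := lt_le_trans t0 B0; rewrite ger0_norm ?invr_ge0 ?(ltW B1)//.
    by rewrite ?lef_pV2 ?ltf_pV2 ?posrE// (lt_le_trans _ B0).
  - move=> x Dx; rewrite -[X in _ --> X]invrK invf_div; apply: cvgV; first exact: s0.
    by have [] := cvg_riccati t0 (D_gt0 Dx).
have [_] : cosneg (fun x => x * coth (t * x)); last exact.
apply: (@cosneg_lim (fun n x => (riccati (t / n.+1%:R) x n.+1).1 /
  (riccati (t / n.+1%:R) x n.+1).2)).
  by move=> n; have [] := cosneg_riccati n (h0 n).
move=> x Dx; have [cA cB] := cvg_riccati t0 (D_gt0 Dx).
rewrite (_ : x * coth _ = cosh (t * x) / (sinh (t * x) / x)); last first.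
  by rewrite /coth [(_ / x)^-1]invf_div mulrCA.
by apply: cvgM => //; apply: cvgV => //; exact: s0.
Qed.

End negative_definite.

(** * Hyperbolic functions and Lipschitz bounds *)

Section hyperbolic.
Context {R : realType}.
Implicit Types x y : R.

Lemma is_derive_sinh x : is_derive x 1 (@sinh R) (cosh x).
Proof.
rewrite /sinh /cosh; apply: is_derive_eq; rewrite /GRing.scale/=; ring.
Qed.

Lemma is_derive_cosh x : is_derive x 1 (@cosh R) (sinh x).
Proof.
rewrite /sinh /cosh; apply: is_derive_eq; rewrite /GRing.scale/=; ring.
Qed.

Lemma cosh2Bsinh2 x : cosh x ^+ 2 - sinh x ^+ 2 = 1.
Proof.
rewrite /cosh /sinh expRN; move: (expR_gt0 x); move: (expR x) => e e0.
by field; rewrite gt_eqF.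
Qed.

Lemma cosh_ge1 x : 1 <= cosh x.
Proof.
rewrite /cosh expRN; move: (expR_gt0 x); move: (expR x) => e e0.
rewrite ler_pdivlMr// mul1r -subr_ge0.
rewrite (_ : _ - _ = (e - 1) ^+ 2 / e); last by field; rewrite gt_eqF.
by rewrite divr_ge0 ?sqr_ge0// ltW.
Qed.

Lemma le_cosh x y : 0 <= x -> x <= y -> cosh x <= cosh y.
Proof.
move=> x0 xy; rewrite /cosh ler_pM2r// -subr_ge0.
have e1 := expR_gt0 x; have e2 := expR_gt0 y.
have : 1 <= expR x by rewrite -expR0 ler_expR.
have : expR x <= expR y by rewrite ler_expR.
rewrite !expRN; move: (expR x) (expR y) e1 e2 => a b a0 b0 ab a1.
rewrite (_ : _ - _ = (b - a) * (a * b - 1) / (a * b)); last first.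
  by field; rewrite !gt_eqF.
rewrite divr_ge0 ?mulr_ge0 ?subr_ge0 ?(ltW a0) ?(ltW b0)//.
by rewrite mulr_ege1// (le_trans a1).
Qed.

Lemma sinh_bounds x : 0 < x -> x <= sinh x <= x * cosh x.
Proof.
move=> x0.
have [||c] := @MVT R (@sinh R) (@cosh R) 0 x x0.
- by move=> y _; exact: is_derive_sinh.
- apply: derivable_within_continuous => y _.
  by have [] := is_derive_sinh y.
rewrite in_itv/= => /andP[c0 cx]; rewrite [sinh 0]/sinh oppr0 subrr mul0r !subr0 => ->.
rewrite addr0 [x * _]mulrC ler_wpM2r ?le_cosh ?(ltW x0) ?(ltW c0) ?(ltW cx)//.
by rewrite ler_peMl ?(ltW x0)// cosh_ge1.
Qed.

(** The factor [x] is kept beside the exponential: [l / sinh (l * t)] then decays exponentially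
    while staying bounded near [0]. *)
Lemma sinh_exp x : 0 < x -> x * expR (x / 2) / 2 <= sinh x.
Proof.
move=> x0; have h0 : 0 < x / 2 by rewrite divr_gt0.
have /andP[h _] := sinh_bounds h0.
have : expR (x / 2) / 2 <= cosh (x / 2).
  by rewrite /cosh ler_pM2r// lerDl expR_ge0.
have -> : sinh x = 2 * sinh (x / 2) * cosh (x / 2).
  by rewrite /sinh /cosh {1 2}(splitr x) opprD !expRD; field.
have := expR_gt0 (x / 2); move: (expR _) (sinh (x / 2)) (cosh (x / 2)) h => e s c.
by move=> *; nra.
Qed.

Lemma cos_lipschitz x y : `|cos x - cos y| <= `|x - y|.
Proof.
wlog xy : x y / x < y => [hw|].
  have [xy|xy|->] := ltgtP x y; [exact: hw| |by rewrite !subrr].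
  by rewrite distrC [leRHS]distrC; exact: hw.
have [|c _] := @MVT R (@cos R) (fun x => - sin x) x y xy.
  by apply: continuous_subspaceT; exact: continuous_cos.
rewrite distrC => ->; rewrite normrM normrN [leRHS]distrC.
by rewrite ler_piMl// sin_max.
Qed.

Lemma expRN_lipschitz x y : 0 <= x -> 0 <= y ->
  `|expR (- x) - expR (- y)| <= `|x - y|.
Proof.
wlog xy : x y / x <= y => [hw x0 y0|x0 y0].
  have [xy|xy] := orP (le_total x y); first exact: hw.
  by rewrite distrC [leRHS]distrC; exact: hw.
rewrite ger0_norm ?subr_ge0 ?ler_expR ?lerN2// distrC ger0_norm ?subr_ge0//.
have -> : expR (- y) = expR (- x) * expR (- (y - x)).
  by rewrite -expRD; congr expR; ring.
have := expR_ge1Dx (- (y - x)).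
have : expR (- x) <= 1 by rewrite expR_le1 oppr_le0.
have := expR_gt0 (- x).
have : expR (- (y - x)) <= 1 by rewrite expR_le1 oppr_le0 subr_ge0.
by move: (expR (- x)) (expR (- (y - x))) => a b *; nra.
Qed.

End hyperbolic.

(** * The fundamental theorem of calculus on the open half line *)

Section half_line.
Context {R : realType}.
Let mu : {measure set (measurableTypeR R) -> \bar R} := @lebesgue_measure R.
Let D : set (measurableTypeR R) := `]0, +oo[.
Let mD : measurable D. Proof. exact: measurable_itv. Qed.

Lemma intg_expRN (a : R) : 0 < a ->
  mu.-integrable D (EFin \o (fun x : R => expR (- (a * x)))).
Proof.
move=> a0; have i1 := integrable_exponential_pdf a0.
have i2 : mu.-integrable D (EFin \o (exponential_pdf a)).
  exact: (integrableS measurableT).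
have := intgZ mD a^-1 i2; apply: eq_integrable => // x.
rewrite inE => /D_gt0 x0 /=; rewrite exponential_pdfE ?(ltW x0)//.
by rewrite mulKf ?gt_eqF// mulNr.
Qed.

(** Exhaustion by [[1 / (n + 2), n + 2]], where the shift keeps the endpoints distinct. Limits of
    [F] at the ends are used because [hk] and [hc] take the default value [0] at [0] instead of
    their limit [1 / t]. *)
Lemma FTC_half_line (F f : R -> R) (l0 l1 : R) :
  mu.-integrable D (EFin \o f) ->
  (forall x : R, 0 < x -> is_derive x 1 F (f x)) ->
  (forall x : R, 0 < x -> {for x, continuous f}) ->
  F (n.+2%:R^-1) @[n --> \oo] --> l0 -> F (n.+2%:R) @[n --> \oo] --> l1 ->
  \int[mu]_(x in D) f x = l1 - l0.
Proof.
move=> fi dF cf c0 c1.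
pose I n : set (measurableTypeR R) := [set` `[n.+2%:R^-1 : R, n.+2%:R]].
have mI n : measurable (I n) by exact: measurable_itv.
have u0 n : 0 < (n.+2%:R^-1 : R) by rewrite invr_gt0.
have uv n : (n.+2%:R^-1 : R) < n.+2%:R.
  by rewrite (@lt_trans _ _ 1)// ?invf_lt1// ltr1n.
have ID n : I n `<=` D.
  by move=> x; rewrite /I /D/= !in_itv/= andbT => /andP[+ _]; exact: lt_le_trans.
have E n : \int[mu]_(x in D) (f \_ (I n)) x = F n.+2%:R - F (n.+2%:R^-1).
  rewrite -Rintegral_mkcondr setIidr// /Rintegral (@continuous_FTC2 _ f F)//.
  - apply: continuous_in_subspaceT => x; rewrite inE/= => /ID/D_gt0; exact: cf.
  - split=> [x||].
    + by move/subset_itv_oo_cc => /ID/D_gt0 /dF[].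
    + apply: cvg_at_right_filter; apply: differentiable_continuous.
      by apply/derivable1_diffP; have [] := dF _ (u0 n).
    + apply: cvg_at_left_filter; apply: differentiable_continuous.
      by apply/derivable1_diffP; have [] := dF _ (lt_trans (u0 n) (uv n)).
  - move=> x /subset_itv_oo_cc /ID/D_gt0/dF dx; rewrite derive1E.
    by have [_ ->] := dx.
have [|x Dx|n x Dx|_ cv] := @Rdominated_cvg _ (measurableTypeR R) _ mu _ mD
  (fun n => f \_ (I n)) f _ _ _ (intg_abs fi).
- move=> n; apply/measurable_restrict => //.
  by apply: (measurable_funS mD) (intg_measurable fi) => x [].
- have x0 := D_gt0 Dx.
  apply: cvg_near_cst; near=> n; rewrite patchE ifT// inE /I/= in_itv/=.
  apply/andP; split.
    rewrite invf_ple ?posrE// (@le_trans _ _ n%:R) ?ler_nat//; last by rewrite -addn2 leq_addr.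
    by near: n; exact: nbhs_infty_ger.
  rewrite (@le_trans _ _ n%:R) ?ler_nat//; last by rewrite -addn2 leq_addr.
  by near: n; exact: nbhs_infty_ger.
- by rewrite patchE; case: ifPn => // _; rewrite normr0.
rewrite -(cvg_lim _ cv)//; apply/cvg_lim => //.
by under eq_fun do rewrite E; exact: cvgB.
Unshelve. all: by end_near. Qed.

End half_line.

(** * The heat profile *)

Section profile.
Context {R : realType}.
Let mu : {measure set (measurableTypeR R) -> \bar R} := @lebesgue_measure R.
Let D : set (measurableTypeR R) := `]0, +oo[.
Let mD : measurable D. Proof. exact: measurable_itv. Qed.
Variable t : R.
Hypothesis t0 : 0 < t.
Implicit Types (i j : nat) (w z l : R).

Definition hk l := l / sinh (l * t).
Definition hc l := l * coth (l * t).

Lemma hk_gt0 l : 0 < l -> 0 < hk l.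
Proof. by move=> l0; rewrite /hk divr_gt0// sinh_gt0// mulr_gt0. Qed.

Lemma hk_le l : 0 < l -> hk l <= t^-1.
Proof.
move=> l0; have lt0 := mulr_gt0 l0 t0; have /andP[h _] := sinh_bounds lt0.
by rewrite /hk ler_pdivrMr ?sinh_gt0// mulrC ler_pdivlMr.
Qed.

Lemma hk_exp l : 0 < l -> hk l <= 2 / t * expR (- (t / 2 * l)).
Proof.
move=> l0; have lt0 := mulr_gt0 l0 t0; have h := sinh_exp lt0.
rewrite /hk ler_pdivrMr ?sinh_gt0//.
apply: (le_trans _ (ler_wpM2l _ h)); last by rewrite mulr_ge0 ?expR_ge0 ?divr_ge0 ?ltW.
rewrite (_ : t / 2 * l = l * t / 2); last by ring.
rewrite expRN; have := expR_gt0 (l * t / 2); move: (expR _) => e e0.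
by rewrite le_eqVlt; apply/orP; left; apply/eqP; field; rewrite !gt_eqF.
Qed.

Lemma hc_ge l : 0 < l -> t^-1 <= hc l.
Proof.
move=> l0; have lt0 := mulr_gt0 l0 t0; have /andP[_ h] := sinh_bounds lt0.
rewrite /hc /coth mulrA ler_pdivlMr ?sinh_gt0// mulrC ler_pdivrMr//.
by rewrite mulrAC.
Qed.

Lemma hc_ge0 l : 0 < l -> 0 <= hc l.
Proof. by move=> l0; rewrite (le_trans _ (hc_ge l0))// invr_ge0 ltW. Qed.

Lemma hc_le l : 0 < l -> hc l <= t^-1 + l.
Proof.
move=> l0; have lt0 := mulr_gt0 l0 t0; have /andP[h _] := sinh_bounds lt0.
rewrite /hc /coth mulrA ler_pdivrMr ?sinh_gt0//.
have -> : cosh (l * t) = sinh (l * t) + expR (- (l * t)).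
  by rewrite /cosh /sinh; field.
rewrite mulrDr mulrDl addrC lerD2r.
rewrite ler_pdivlMl// mulrA (mulrC t) (le_trans _ h)//.
by rewrite ler_piMr ?(ltW lt0)// expR_le1 oppr_le0 ltW.
Qed.

(** In the heat equation it trades [hk ^ 2], produced by differentiating [hc], for [hc ^ 2 - l ^ 2],
    that is for second derivatives of the profile. *)
Lemma hc2 l : 0 < l -> hc l ^+ 2 = l ^+ 2 + hk l ^+ 2.
Proof.
move=> l0; have s0 := sinh_gt0 (mulr_gt0 l0 t0).
rewrite /hc /hk /coth; have := cosh2Bsinh2 (l * t).
move: (cosh _) (sinh _) s0 => c s s0 E.
rewrite -[X in X + _]mulr1 -[in X in X + _](@mulfV _ (s ^+ 2)) ?expf_neq0 ?gt_eqF//.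
have -> : (l / s) ^+ 2 = l ^+ 2 * (c ^+ 2 - s ^+ 2) / s ^+ 2.
  by rewrite E; field; rewrite gt_eqF.
by field; rewrite gt_eqF.
Qed.

Lemma is_derive_hk l : 0 < l -> is_derive l 1 hk ((hk l - t * hk l * hc l) / l).
Proof.
move=> l0; have s0 := sinh_gt0 (mulr_gt0 l0 t0).
have dm : is_derive l 1 (fun l => l * t) t.
  by apply: is_derive_eq; rewrite /GRing.scale/=; ring.
have ds : is_derive l 1 (fun l => sinh (l * t)) (cosh (l * t) * t).
  exact: (@is_derive1_comp R (@sinh R) (fun l => l * t) l _ _ (is_derive_sinh _) dm).
have dv := @is_deriveV _ (fun l => sinh (l * t)) l _ _ (lt0r_neq0 s0) ds.
rewrite /hk; apply: is_derive_eq; rewrite /hc /coth /GRing.scale/=.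
by field; rewrite !gt_eqF.
Qed.

Lemma is_derive_hc l : 0 < l -> is_derive l 1 hc ((hc l - t * hk l ^+ 2) / l).
Proof.
move=> l0; have s0 := sinh_gt0 (mulr_gt0 l0 t0).
have dm : is_derive l 1 (fun l => l * t) t.
  by apply: is_derive_eq; rewrite /GRing.scale/=; ring.
have ds : is_derive l 1 (fun l => sinh (l * t)) (cosh (l * t) * t).
  exact: (@is_derive1_comp R (@sinh R) (fun l => l * t) l _ _ (is_derive_sinh _) dm).
have dc : is_derive l 1 (fun l => cosh (l * t)) (sinh (l * t) * t).
  exact: (@is_derive1_comp R (@cosh R) (fun l => l * t) l _ _ (is_derive_cosh _) dm).
have dv := @is_deriveV _ (fun l => sinh (l * t)) l _ _ (lt0r_neq0 s0) ds.
rewrite /hc /coth; apply: is_derive_eq; rewrite /hk /GRing.scale/=.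
have := cosh2Bsinh2 (l * t); move: (cosh _) (sinh _) s0 => c s s0 E.
have -> : (l / s) ^+ 2 = l ^+ 2 * (c ^+ 2 - s ^+ 2) / s ^+ 2.
  by rewrite E; field; rewrite gt_eqF.
by field; rewrite !gt_eqF.
Qed.

Definition hm i j l := hk l * l ^+ i * hc l ^+ j.

Lemma hm_ge0 i j l : 0 < l -> 0 <= hm i j l.
Proof.
move=> l0; rewrite /hm mulr_ge0 ?exprn_ge0 ?hc_ge0//.
by rewrite mulr_ge0 ?exprn_ge0 ?ltW// hk_gt0.
Qed.

Lemma measurable_derivable (f : R -> R) :
  (forall x : R, 0 < x -> derivable f x 1) -> measurable_fun D f.
Proof.
move=> df; apply: open_continuous_measurable_fun; first exact: interval_open.
move=> x; rewrite inE => /D_gt0 x0.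
by apply: differentiable_continuous; apply/derivable1_diffP; exact: df.
Qed.

Lemma measurable_hk : measurable_fun D hk.
Proof. by apply: measurable_derivable => x x0; have [] := is_derive_hk x0. Qed.

Lemma measurable_hc : measurable_fun D hc.
Proof. by apply: measurable_derivable => x x0; have [] := is_derive_hc x0. Qed.

Lemma measurable_hm i j : measurable_fun D (hm i j).
Proof.
apply: measurable_funM; last by apply: measurable_funX; exact: measurable_hc.
apply: measurable_funM; first exact: measurable_hk.
exact: measurable_funX.
Qed.

Lemma intg_hm i j : mu.-integrable D (EFin \o hm i j).
Proof.
pose N : R := (i + j).+1%:R; have N0 : 0 < N by [].
(* For this [K], raising [y <= K exp (y / K)] to the power [i + j] costs at most [exp (t y / 4)];
   with [y = 1 / t + l] this uses up half of the decay [exp (- t l / 2)] of [hk]. *)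
pose K := 4 * N / t; have K0 : 0 < K by rewrite divr_gt0// mulr_gt0.
have t4 : 0 < t / 4 by rewrite divr_gt0.
have := @intgZ _ (measurableTypeR R) _ mu _ mD (2 / t * K ^+ (i + j) * expR (4^-1)) _
  (intg_expRN t4).
move=> ig; apply: (dominated_integrable mD _ ig); first exact: measurable_hm.
move=> l /D_gt0 l0; rewrite ger0_norm ?hm_ge0//.
have y1 : t^-1 + l <= K * expR (K^-1 * (t^-1 + l)).
  rewrite -ler_pdivrMl// (le_trans _ (expR_ge1Dx _))// lerDr ler01//.
have a0 : 0 <= t^-1 + l by rewrite addr_ge0 ?invr_ge0 ?ltW.
have h1 : l ^+ i * hc l ^+ j <= (t^-1 + l) ^+ (i + j).
  rewrite exprD ler_pM ?exprn_ge0 ?hc_ge0 ?(ltW l0)//.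
    by rewrite lerXn2r ?nnegrE ?(ltW l0)// lerDr invr_ge0 ltW.
  by rewrite lerXn2r ?nnegrE ?hc_ge0 ?hc_le.
have h2 : (t^-1 + l) ^+ (i + j) <= K ^+ (i + j) * expR (4^-1 * (1 + t * l)).
  apply: (@le_trans _ _ ((K * expR (K^-1 * (t^-1 + l))) ^+ (i + j))).
    by rewrite lerXn2r ?nnegrE// (le_trans a0).
  rewrite exprMn ler_wpM2l ?exprn_ge0 ?(ltW K0)// -expRM_natl ler_expR.
  rewrite (_ : 4^-1 * _ = N * (K^-1 * (t^-1 + l))); last first.
    by rewrite /K; field; rewrite !gt_eqF.
  rewrite ler_wpM2r ?ler_nat// mulr_ge0// invr_ge0 ltW//.
rewrite /hm -mulrA (le_trans (ler_pM _ _ (hk_exp l0) (le_trans h1 h2)))//.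
- by rewrite ltW// hk_gt0.
- by rewrite mulr_ge0 ?exprn_ge0 ?hc_ge0 ?(ltW l0).
rewrite (_ : 2 / t * expR _ * _ = 2 / t * K ^+ (i + j) *
  (expR (- (t / 2 * l)) * expR (4^-1 * (1 + t * l)))); last by ring.
rewrite -[leRHS]mulrA ler_wpM2l//.
  by apply: mulr_ge0; [rewrite divr_ge0// ltW|exact/exprn_ge0/ltW].
by rewrite -!expRD ler_expR le_eqVlt; apply/orP; left; apply/eqP; field.
Qed.

(* The phase [i%:R * (pi / 2)] encodes the [i]-th derivative in [z], the power of
   [hc] encodes, up to the factor [(- 4) ^+ j], the [j]-th derivative in
   [w = x ^+ 2 + y ^+ 2]. *)
Definition hint i j w z l :=
  hm i j l * (cos (l * z + i%:R * (pi / 2)) * expR (- (w / 4 * hc l))).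

Definition heatH i j w z := \int[mu]_(l in D) hint i j w z l.

Lemma measurable_hint i j w z : measurable_fun D (hint i j w z).
Proof.
apply: measurable_funM; first exact: measurable_hm.
apply: measurable_funM.
  apply: measurable_funTS; apply: (@measurableT_comp _ _ _ _ _ _ (@cos R)).
    by apply: continuous_measurable_fun; exact: continuous_cos.
  by apply: measurable_funD => //; exact: measurable_funM.
apply: measurableT_comp => //; apply: measurableT_comp => //.
by apply: measurable_funM => //; exact: measurable_hc.
Qed.

Lemma hint_le i j w z l : 0 <= w -> 0 < l -> `|hint i j w z l| <= hm i j l.
Proof.
move=> w0 l0; rewrite normrM (ger0_norm (hm_ge0 i j l0)) ler_piMr ?hm_ge0//.
rewrite normrM mulr_ile1 ?cos_max// ger0_norm ?expR_ge0// expR_le1 oppr_le0.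
by rewrite mulr_ge0 ?hc_ge0// divr_ge0.
Qed.

Lemma intg_hint i j w z : 0 <= w -> mu.-integrable D (EFin \o hint i j w z).
Proof.
move=> w0; apply: (dominated_integrable mD _ (intg_hm i j)).
  exact: measurable_hint.
by move=> l /D_gt0; exact: hint_le.
Qed.

Definition heatM i j := \int[mu]_(l in D) hm i j l.

Lemma heatM_ge0 i j : 0 <= heatM i j.
Proof. by apply: Rintegral_ge0 => l /D_gt0; exact: hm_ge0. Qed.

Lemma heatH_le i j w z : 0 <= w -> `|heatH i j w z| <= heatM i j.
Proof.
move=> w0; rewrite (le_trans (le_normr_Rintegral mD (intg_hint i j z w0)))//.
apply: le_Rintegral => //; first exact/intg_abs/intg_hint.
  exact: intg_hm.
by move=> l /D_gt0; exact: hint_le.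
Qed.

(** The Lipschitz constants of the phase and of the exponential bring one factor [l] or [hc / 4],
    hence the next moments. The bound holds up to [w = 0], so it gives continuity of the kernel on
    the axis too. *)
Lemma heatH_lipschitz i j w z w' z' : 0 <= w -> 0 <= w' ->
  `|heatH i j w z - heatH i j w' z'| <=
  heatM i.+1 j * `|z - z'| + heatM i j.+1 / 4 * `|w - w'|.
Proof.
move=> w0 w0'; rewrite /heatH -RintegralB//; [|exact: intg_hint..].
rewrite (le_trans (le_normr_Rintegral mD _))//.
  by apply: intgB => //; exact: intg_hint.
rewrite mulrAC -mulrA /heatM -!RintegralZr//; [|exact: intg_hm..].
have i1 c k m : mu.-integrable D (EFin \o (fun l => hm k m l * c)).
  have -> : (fun l => hm k m l * c) = (fun l => c * hm k m l).
    by apply/funext => l; rewrite mulrC.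
  by apply: intgZ => //; exact: intg_hm.
rewrite -RintegralD//.
apply: le_Rintegral => //; first by apply/intg_abs/intgB => //; exact: intg_hint.
  exact: intgD.
move=> l /D_gt0 l0; rewrite /hint -mulrBr normrM (ger0_norm (hm_ge0 i j l0)).
have -> : hm i.+1 j l = hm i j l * l by rewrite /hm exprSr; ring.
have -> : hm i j.+1 l = hm i j l * hc l by rewrite /hm exprSr; ring.
rewrite (_ : hm i j l * l * _ + _ =
  hm i j l * (l * `|z - z'| + hc l * (`|w - w'| / 4))); last by ring.
rewrite ler_wpM2l ?hm_ge0//.
set a := l * z + _; set b := l * z' + _.
rewrite (_ : _ - _ = (cos a - cos b) * expR (- (w / 4 * hc l)) +
   cos b * (expR (- (w / 4 * hc l)) - expR (- (w' / 4 * hc l)))); last by ring.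
rewrite (le_trans (ler_normD _ _))// lerD//.
  rewrite normrM (ger0_norm (expR_ge0 _)) -[leRHS]mulr1 ler_pM ?expR_ge0//.
    rewrite (le_trans (cos_lipschitz _ _))// /a /b.
    by rewrite opprD addrACA subrr addr0 -mulrBr normrM (gtr0_norm l0).
  by rewrite expR_le1 oppr_le0 mulr_ge0 ?hc_ge0// divr_ge0.
rewrite normrM -[leRHS]mul1r ler_pM// ?cos_max//.
have hw v : 0 <= v -> 0 <= v / 4 * hc l.
  by move=> v0; apply: mulr_ge0; [rewrite divr_ge0|exact: hc_ge0].
rewrite (le_trans (expRN_lipschitz (hw _ w0) (hw _ w0')))//.
rewrite (_ : _ - _ = (hc l / 4) * (w - w')); last by ring.
have h4 : 0 <= hc l / 4 by rewrite divr_ge0// hc_ge0.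
by rewrite normrM (ger0_norm h4) mulrAC mulrA.
Qed.

Lemma is_derive_hint i j (W Z : R -> R) (W' Z' a l : R) :
  is_derive a 1 W W' -> is_derive a 1 Z Z' ->
  is_derive a 1 (fun s => hint i j (W s) (Z s) l)
    (Z' * hint i.+1 j (W a) (Z a) l - W' / 4 * hint i j.+1 (W a) (Z a) l).
Proof.
move=> dW dZ.
have dz : is_derive a 1 (fun s => l * Z s + i%:R * (pi / 2)) (l * Z').
  by apply: is_derive_eq; rewrite /GRing.scale/=; ring.
have dw : is_derive a 1 (fun s => - (W s / 4 * hc l)) (- (W' / 4 * hc l)).
  by apply: is_derive_eq; rewrite /GRing.scale/=; ring.
have dc := @is_derive1_comp R (@cos R) _ a _ _ (is_derive_cos _) dz.
have de := @is_derive1_comp R (@expR R) _ a _ _ (is_derive_expR _) dw.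
have := is_deriveZ (hm i j l) (is_deriveM dc de).
rewrite /hint /= => h; apply: is_derive_eq (h) _.
have cE : cos (l * Z a + i.+1%:R * (pi / 2)) = - sin (l * Z a + i%:R * (pi / 2)).
  by rewrite -[i.+1]addn1 natrD mulrDl mul1r addrA cosDpihalf.
rewrite cE /GRing.scale/= /hm !exprSr; ring.
Qed.

(** Stated along a curve [(W, Z)] with [0 <= W] because the integrand is dominated by [hm] only for
    [w >= 0]: on the axis [x = y = 0] a partial derivative in [w] would leave this domain. *)
Lemma is_derive_heatH i j (W Z W' Z' : R -> R) (a : R) :
  (forall s, 0 <= W s) ->
  (forall s : R, is_derive s 1 W (W' s)) -> (forall s : R, is_derive s 1 Z (Z' s)) ->
  {for a, continuous W'} -> {for a, continuous Z'} ->
  is_derive a 1 (fun s => heatH i j (W s) (Z s))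
    (Z' a * heatH i.+1 j (W a) (Z a) - W' a / 4 * heatH i j.+1 (W a) (Z a)).
Proof.
move=> W0 dW dZ cW cZ.
(* Continuity of [W'] and [Z'] at [a] bounds them near [a], hence a single dominating function for
   the derivatives of the integrand. *)
have [e e0 ew] : exists2 e : R, 0 < e & forall s, s \in `]a - e, a + e[ ->
    `|W' s| <= `|W' a| + 1 /\ `|Z' s| <= `|Z' a| + 1.
  have bw : \forall s \near a, `|W' s| <= `|W' a| + 1.
    by apply: (cvgr_norm_le (W' a) (cW : W' x @[x --> a] --> W' a)); rewrite ltrDl.
  have bz : \forall s \near a, `|Z' s| <= `|Z' a| + 1.
    by apply: (cvgr_norm_le (Z' a) (cZ : Z' x @[x --> a] --> Z' a)); rewrite ltrDl.
  have [e /= e0 he] : \forall s \near a, `|W' s| <= `|W' a| + 1 /\ `|Z' s| <= `|Z' a| + 1.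
    by near=> s; split; near: s.
  exists e => // s; rewrite in_itv/= => /andP[s1 s2]; apply: he => /=.
  by rewrite ltr_norml; apply/andP; split; lra.
have Ia : [set` `]a - e, a + e[] a.
  by rewrite /= in_itv/=; apply/andP; split; lra.
pose f s l := hint i j (W s) (Z s) l.
pose G l := (`|Z' a| + 1) * `|hm i.+1 j l| + (`|W' a| + 1) / 4 * `|hm i j.+1 l|.
have G0 l : 0 <= G l by rewrite addr_ge0// mulr_ge0// ?divr_ge0// addr_ge0.
have df (s l : R) : is_derive s 1 (f ^~ l) (Z' s * hint i.+1 j (W s) (Z s) l -
    W' s / 4 * hint i j.+1 (W s) (Z s) l) by exact: is_derive_hint.
have intf s : [set` `]a - e, a + e[] s -> mu.-integrable D (EFin \o f s).
  by move=> _; exact: intg_hint.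
have derf s l : [set` `]a - e, a + e[] s -> D l -> derivable (f ^~ l) s 1.
  by move=> _ _; have [] := df s l.
have iG : mu.-integrable D (EFin \o G).
  by apply: intgD => //; apply: intgZ => //; apply: intg_abs; exact: intg_hm.
have Gub s l : [set` `]a - e, a + e[] s -> D l -> `|partial1of2 f s l| <= G l.
  move=> /ew[w1 z1] /D_gt0 l0; rewrite partial1of2E; have [_ ->] := df s l.
  have hh k m : `|hint k m (W s) (Z s) l| <= `|hm k m l|.
    by rewrite (ger0_norm (hm_ge0 _ _ l0)) hint_le.
  rewrite (le_trans (ler_normB _ _))// lerD//.
    by rewrite (normrM (Z' s)) ler_pM.
  rewrite (normrM (W' s / 4)) ler_pM// (normrM (W' s)) [`|4^-1|]ger0_norm ?invr_ge0//.
  by rewrite ler_wpM2r ?invr_ge0.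
have dE := differentiation_under_integral mD Ia intf derf G0 iG Gub.
have dd := derivable_under_integral mD Ia intf derf G0 iG Gub.
apply: DeriveDef; first exact: dd.
rewrite -derive1E dE.
rewrite -RintegralZl//; last exact: intg_hint.
rewrite -RintegralZl//; last exact: intg_hint.
rewrite -RintegralB//; [|by apply: intgZ => //; exact: intg_hint..].
apply: eq_Rintegral => l _; rewrite partial1of2E.
by have [_ ->] := df a l.
Unshelve. all: by end_near. Qed.

Lemma expR_ge_id (x : R) : x <= expR x.
Proof. by rewrite (le_trans _ (expR_ge1Dx x))// lerDr. Qed.

Lemma cvg_inv_succ2 : (n.+2%:R^-1 : R) @[n --> \oo] --> 0.
Proof. by have := @cvg_harmonic R; rewrite -cvg_shiftS. Qed.

Lemma cvg_bnd_at0 (F : R -> R) (C : R) :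
  (forall l, 0 < l -> `|F l| <= C * l) -> F (n.+2%:R^-1) @[n --> \oo] --> 0.
Proof.
move=> FC; apply: norm_cvg0.
apply: (@squeeze_cvgr _ _ _ _ (cst 0) (fun n => C * n.+2%:R^-1)).
- by apply: nearW => n /=; rewrite normr_ge0 FC// invr_gt0.
- exact: cvg_cst.
- rewrite -[X in _ --> X](mulr0 C); apply: cvgMl_tmp.
  exact: cvg_inv_succ2.
Qed.

Lemma cvg_bnd_aty (F : R -> R) (C a : R) : 0 < a ->
  (forall l, 0 < l -> `|F l| <= C * expR (- (a * l))) ->
  F (n.+2%:R) @[n --> \oo] --> 0.
Proof.
move=> a0 FC; have C0 : 0 <= C.
  have := le_trans (normr_ge0 _) (FC 1 ltr01).
  by rewrite pmulr_lge0 ?expR_gt0.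
apply: norm_cvg0.
apply: (@squeeze_cvgr _ _ _ _ (cst 0) (fun n => C / a * n.+2%:R^-1)).
- apply: nearW => n /=; rewrite normr_ge0 (le_trans (FC _ _))//= -mulrA -invfM.
  rewrite ler_wpM2l// expRN lef_pV2 ?posrE ?expR_gt0 ?mulr_gt0//.
  exact: expR_ge_id.
- exact: cvg_cst.
- rewrite -[X in _ --> X](mulr0 (C / a)); apply: cvgMl_tmp.
  exact: cvg_inv_succ2.
Qed.

(** Under the integral sign the heat equation is an exact derivative in [l], that of [l] times the
    undifferentiated integrand. The factor [l] makes the boundary term at [0] vanish. *)
Lemma is_derive_pde_primitive w z l : 0 < l ->
  is_derive l 1 (fun l => l * hk l * (cos (l * z) * expR (- (w / 4 * hc l))))
  (t * (w / 4 * (hint 0 2 w z l + hint 2 0 w z l) - hint 0 1 w z l) +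
   2 * hint 0 0 w z l - w / 4 * hint 0 1 w z l + z * hint 1 0 w z l).
Proof.
move=> l0.
have dk := is_derive_hk l0; have dh := is_derive_hc l0.
have dz : is_derive l 1 (fun l => l * z) z.
  by apply: is_derive_eq; rewrite /GRing.scale/=; ring.
have dw : is_derive l 1 (fun l => - (w / 4 * hc l))
    (- (w / 4 * ((hc l - t * hk l ^+ 2) / l))).
  by apply: is_derive_eq; rewrite /GRing.scale/=; ring.
have dc := @is_derive1_comp R (@cos R) _ l _ _ (is_derive_cos _) dz.
have de := @is_derive1_comp R (@expR R) _ l _ _ (is_derive_expR _) dw.
have := is_deriveM (is_deriveM (is_derive_id l 1) dk) (is_deriveM dc de).
move=> h; apply: is_derive_eq (h) _.
rewrite /hint /hm /GRing.scale/=.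
rewrite !mul0r !addr0 mul1r cosDpihalf (_ : 2 * (pi / 2) = pi); last by field.
rewrite cosDpi hc2// !expr0 !expr1 !fctE /=.
by field; rewrite gt_eqF.
Qed.

(* The profile is self-similar, so that the heat equation loses its time
   derivative. *)
Lemma heatH_pde w z : 0 <= w ->
  t * (w / 4 * (heatH 0 2 w z + heatH 2 0 w z) - heatH 0 1 w z) +
   2 * heatH 0 0 w z - w / 4 * heatH 0 1 w z + z * heatH 1 0 w z = 0.
Proof.
move=> w0.
pose f l := t * (w / 4 * (hint 0 2 w z l + hint 2 0 w z l) - hint 0 1 w z l) +
   2 * hint 0 0 w z l - w / 4 * hint 0 1 w z l + z * hint 1 0 w z l.
pose F l := l * hk l * (cos (l * z) * expR (- (w / 4 * hc l))).
have ih i j : mu.-integrable D (EFin \o hint i j w z) by exact: intg_hint.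
have i1 : mu.-integrable D (EFin \o (fun l => hint 0 2 w z l + hint 2 0 w z l)).
  exact: intgD.
have i2 := intgZ mD (w / 4) i1.
have i3 := intgB mD i2 (ih 0 1).
have i4 := intgZ mD t i3.
have i5 := intgZ mD 2 (ih 0 0).
have i6 := intgD mD i4 i5.
have i7 := intgZ mD (w / 4) (ih 0 1).
have i8 := intgB mD i6 i7.
have i9 := intgZ mD z (ih 1 0).
have fi : mu.-integrable D (EFin \o f) by exact: (intgD mD i8 i9).
rewrite /heatH -RintegralD// -RintegralZl// -RintegralB// -RintegralZl//.
rewrite -(RintegralZl _ _ (ih 0 0))// -RintegralD// -RintegralZl// -RintegralB//.
rewrite -(RintegralZl _ _ (ih 1 0))// -RintegralD//.
have dh i j l : 0 < l -> {for l, continuous (hint i j w z)}.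
  move=> l0.
  have ck : hk x @[x --> l] --> hk l.
    apply: differentiable_continuous; apply/derivable1_diffP.
    by have [] := is_derive_hk l0.
  have ch : hc x @[x --> l] --> hc l.
    apply: differentiable_continuous; apply/derivable1_diffP.
    by have [] := is_derive_hc l0.
  have clin : (x * z + i%:R * (pi / 2)) @[x --> l] --> l * z + i%:R * (pi / 2).
    by apply: cvgD; [apply: cvgMr_tmp; exact: cvg_id|exact: cvg_cst].
  have ch4 : - (w / 4 * hc x) @[x --> l] --> - (w / 4 * hc l).
    by apply: cvgN; exact: cvgMl_tmp.
  apply: cvgM; first (apply: cvgM; first apply: cvgM => //).
  - exact: exprn_continuous.
  - exact: (continuous_cvg _ (@exprn_continuous R j _) ch).
  - apply: cvgM.
      exact: (continuous_cvg _ (@continuous_cos R _) clin).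
    exact: (continuous_cvg _ (@continuous_expR R _) ch4).
have bF l : 0 < l -> `|F l| <= l * hk l.
  move=> l0; have h0 : 0 <= l * hk l by rewrite mulr_ge0 ?ltW// hk_gt0.
  rewrite /F normrM (ger0_norm h0) ler_piMr// normrM mulr_ile1 ?cos_max//.
  rewrite ger0_norm ?expR_ge0// expR_le1 oppr_le0.
  by apply: mulr_ge0; [rewrite divr_ge0|exact: hc_ge0].
rewrite -[RHS](subrr (0 : R)); apply: (@FTC_half_line _ F f 0 0 fi).
- by move=> l l0; exact: is_derive_pde_primitive.
- move=> l l0; rewrite /f.
  apply: cvgD; last by apply: cvgMl_tmp; exact: dh.
  apply: cvgB; last by apply: cvgMl_tmp; exact: dh.
  apply: cvgD; last by apply: cvgMl_tmp; exact: dh.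
  apply: cvgMl_tmp; apply: cvgB; last exact: dh.
  by apply: cvgMl_tmp; apply: cvgD; exact: dh.
- apply: (@cvg_bnd_at0 _ t^-1) => l l0; rewrite (le_trans (bF l l0))//.
  by rewrite mulrC ler_wpM2r ?hk_le// ltW.
(* [l hk l <= (2 / t) l exp (- t l / 2)], and [l <= (4 / t) exp (t l / 4)] absorbs the factor [l]:
   hence [8 / t ^ 2] and the rate [t / 4]. *)
- apply: (@cvg_bnd_aty _ (8 / t ^+ 2) (t / 4)); first by rewrite divr_gt0.
  move=> l l0; rewrite (le_trans (bF l l0))//.
  rewrite (le_trans (ler_wpM2l (ltW l0) (hk_exp l0)))//.
  have -> : expR (- (t / 2 * l)) = expR (- (t / 4 * l)) / expR (t / 4 * l).
    by rewrite -expRN -expRD; congr expR; field.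
  have h := expR_ge_id (t / 4 * l).
  rewrite (_ : l * _ = 2 / t * expR (- (t / 4 * l)) * (l / expR (t / 4 * l))); last by ring.
  rewrite (_ : 8 / t ^+ 2 * _ = 2 / t * expR (- (t / 4 * l)) * (4 / t)); last first.
    by field; rewrite gt_eqF.
  have tv : 0 <= 2 / t * expR (- (t / 4 * l)).
    by apply: mulr_ge0; [rewrite divr_ge0// ltW|exact: expR_ge0].
  rewrite ler_wpM2l//.
  rewrite ler_pdivrMr ?expR_gt0// mulrC -ler_pdivrMr ?divr_gt0//.
  by rewrite invf_div mulrC.
Qed.

End profile.

(** * Cosine transform of the exponential and the Cauchy kernel *)

Section cosine_transform.
Context {R : realType}.
Let mu : {measure set (measurableTypeR R) -> \bar R} := @lebesgue_measure R.
Let D : set (measurableTypeR R) := `]0, +oo[.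
Let mD : measurable D. Proof. exact: measurable_itv. Qed.

Lemma exp_cos_integral (e a : R) : 0 < e ->
  \int[mu]_(x in D) (expR (- (e * x)) * cos (a * x)) = e / (e ^+ 2 + a ^+ 2).
Proof.
move=> e0; set s := e ^+ 2 + a ^+ 2.
have s0 : 0 < s by rewrite ltr_wpDr ?sqr_ge0// exprn_gt0.
pose F x := expR (- (e * x)) * (s^-1 * (a * sin (a * x) - e * cos (a * x))).
have dF (x : R) : is_derive x 1 F (expR (- (e * x)) * cos (a * x)).
  have dl : is_derive x 1 (fun x => a * x) a.
    by apply: is_derive_eq; rewrite /GRing.scale/=; ring.
  have dm : is_derive x 1 (fun x => - (e * x)) (- e).
    by apply: is_derive_eq; rewrite /GRing.scale/=; ring.
  have dc := @is_derive1_comp R (@cos R) _ x _ _ (is_derive_cos _) dl.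
  have ds := @is_derive1_comp R (@sin R) _ x _ _ (is_derive_sin _) dl.
  have de := @is_derive1_comp R (@expR R) _ x _ _ (is_derive_expR _) dm.
  have h := is_deriveM de (is_deriveZ s^-1 (is_deriveB (is_deriveZ a ds) (is_deriveZ e dc))).
  apply: is_derive_eq (h) _.
  rewrite !fctE /= -![_ *: _]/(_ * _) /s.
  by field; rewrite gt_eqF.
rewrite (@FTC_half_line _ F _ (- e / s) 0).
- by rewrite sub0r mulNr opprK.
- apply: (@cospos_int R (fun x => expR (- (e * x)))); exact: intg_expRN.
- move=> x _; apply: cvgM.
    apply: (continuous_cvg _ (@continuous_expR R _)); apply: cvgN.
    by apply: cvgMl_tmp; exact: cvg_id.
  apply: (continuous_cvg _ (@continuous_cos R _)).
  by apply: cvgMl_tmp; exact: cvg_id.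
- have -> : - e / s = F 0.
    by rewrite /F !mulr0 oppr0 expR0 sin0 cos0; ring.
  apply: (continuous_cvg _ _ (@cvg_inv_succ2 R)).
  by apply: differentiable_continuous; apply/derivable1_diffP; have [] := dF 0.
- apply: (@cvg_bnd_aty _ _ (s^-1 * (`|a| + e)) e) => // l l0.
  rewrite /F normrM (ger0_norm (expR_ge0 _)) mulrC ler_wpM2r ?expR_ge0//.
  rewrite normrM ger0_norm ?invr_ge0 ?(ltW s0)// ler_wpM2l ?invr_ge0 ?(ltW s0)//.
  rewrite (le_trans (ler_normB _ _))// lerD//.
    by rewrite (normrM a) ler_piMr// sin_max.
  by rewrite (normrM e) gtr0_norm// ler_piMr ?cos_max// ltW.
Qed.

Lemma cospos_expRN (e : R) : 0 < e -> cospos (fun x => expR (- (e * x))).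
Proof.
move=> e0; split; first exact: intg_expRN.
move=> a; rewrite exp_cos_integral// divr_ge0 ?(ltW e0)//.
by rewrite addr_ge0 ?sqr_ge0.
Qed.

Lemma cauchy_integral (e : R) : 0 < e ->
  (\int[mu]_(x in D) (e / (e ^+ 2 + x ^+ 2))%:E = (pi / 2)%:E)%E.
Proof.
move=> e0.
have s0 (x : R) : 0 < e ^+ 2 + x ^+ 2 by rewrite ltr_wpDr ?sqr_ge0// exprn_gt0.
have dF (x : R) : is_derive x 1 (fun x => atan (e^-1 * x)) (e / (e ^+ 2 + x ^+ 2)).
  have dl : is_derive x 1 (fun x => e^-1 * x) e^-1.
    by apply: is_derive_eq; rewrite /GRing.scale/=; ring.
  have := @is_derive1_comp R (@atan R) _ x _ _ (is_derive1_atan _) dl.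
  move=> h; apply: is_derive_eq (h) _.
  by field; rewrite !gt_eqF//= ?addr_gt0 ?exprn_gt0.
have cf : continuous (fun x : R => e / (e ^+ 2 + x ^+ 2)).
  move=> x; apply: cvgM; first exact: cvg_cst.
  apply: cvgV; first by rewrite gt_eqF.
  by apply: cvgD; [exact: cvg_cst|exact: exprn_continuous].
have ca : continuous (fun x => atan (e^-1 * x)).
  move=> x; apply: differentiable_continuous; apply/derivable1_diffP.
  by have [] := dF x.
rewrite /D integral_itv_obnd_cbnd; last first.
  by apply/measurable_EFinP; apply: measurable_funTS; exact: continuous_measurable_fun.
rewrite (@ge0_continuous_FTC2y _ _ (fun x => atan (e^-1 * x)) _ (pi / 2)).
- by rewrite mulr0 atan0 sube0.
- by move=> x _; rewrite divr_ge0 ?ltW.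
- by apply: continuous_subspaceT; exact: cf.
- apply: (@cvg_comp _ _ _ (fun x => e^-1 * x) (@atan R) _ +oo); last exact: cvgy_atan.
  by apply: gt0_cvgMry => //; rewrite invr_gt0.
- by move=> x _; have [] := dF x.
- by apply: cvg_at_right_filter; exact: ca.
- by move=> x _; rewrite derive1E; have [_ ->] := dF x.
Qed.

End cosine_transform.

(** * Positivity of the profile and its integral in [z] *)

Section profile_integral.
Context {R : realType}.
Let mu : {measure set (measurableTypeR R) -> \bar R} := @lebesgue_measure R.
Let D : set (measurableTypeR R) := `]0, +oo[.
Let mD : measurable D. Proof. exact: measurable_itv. Qed.
Variable t : R.
Hypothesis t0 : 0 < t.
Implicit Types (w z l : R).
Local Notation heatH := (heatH t).
Local Notation hc := (hc t).
Local Notation hk := (hk t).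

Definition hphi w l := hk l * expR (- (w / 4 * hc l)).

Lemma heatH00E w z : heatH 0 0 w z = \int[mu]_(l in D) (hphi w l * cos (z * l)).
Proof.
apply: eq_Rintegral => l _; rewrite /hint /hm /hphi !expr0 !mulr1 mul0r addr0.
by rewrite (mulrC l); ring.
Qed.

(** A multiplier has to act on an integrable function of nonnegative transform; [exp (- e l)] is
    one, its transform being a Cauchy kernel, and [e] tends to [0]. *)
Lemma heatH00_ge0 w z : 0 <= w -> 0 <= heatH 0 0 w z.
Proof.
move=> w0; have w4 : 0 <= w / 4 by rewrite divr_ge0.
have [_ _ cm] := cosmul_heat t0 w4.
pose e n : R := n.+1%:R^-1.
have e0 n : 0 < e n by rewrite /e.
have [|l Dl|n l Dl|_ cv] := @Rdominated_cvg _ (measurableTypeR R) _ mu _ mD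
  (fun n l => expR (- (e n * l)) * hint t 0 0 w z l) (hint t 0 0 w z) _ _ _
  (intg_hm t0 0 0).
- move=> n; apply: measurable_funM; last exact: measurable_hint.
  by apply: measurableT_comp => //; apply: measurableT_comp => //; exact: measurable_funM.
- rewrite -[X in _ --> X]mul1r -expR0; apply: cvgMr_tmp.
  apply: (continuous_cvg _ (@continuous_expR R _)).
  rewrite -[X in _ --> X]oppr0 -[X in - X](mul0r l); apply: cvgN; apply: cvgMr_tmp.
  exact: cvg_harmonic.
- have l0 := D_gt0 Dl; rewrite normrM ger0_norm ?expR_ge0//.
  rewrite -[leRHS]mul1r ler_pM ?expR_ge0 ?hint_le// expR_le1 oppr_le0.
  by rewrite mulr_ge0 ?ltW.
rewrite /heatH -(cvg_lim _ cv)//; apply: limr_ge; first by apply/cvg_ex; eexists; exact: cv.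
apply: nearW => n; have [_ /(_ z)] := cm _ (cospos_expRN (e0 n)).
congr (0 <= _); apply: eq_Rintegral => l _.
rewrite /hint /hm /Defs.hmul /=.
by rewrite /hk /hc !expr0 !mulr1 mul0r addr0 (mulrC l t) (mulrC l z); ring.
Qed.

Lemma hphi_ge0 w l : 0 < l -> 0 <= hphi w l.
Proof. by move=> l0; rewrite /hphi mulr_ge0 ?expR_ge0// ltW// hk_gt0. Qed.

(** The bound is the limit of [hphi w] at [0], the value that Fourier inversion assigns, up to the
    factor [pi], to the integral over [z]; the estimate of the mass built on it therefore loses
    nothing. *)
Lemma hphi_le w l : 0 <= w -> 0 < l -> hphi w l <= t^-1 * expR (- (w / (4 * t))).
Proof.
move=> w0 l0; rewrite /hphi ler_pM ?expR_ge0 ?hk_le ?(ltW (hk_gt0 t0 l0))//.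
rewrite ler_expR lerN2 invfM mulrA ler_wpM2l ?divr_ge0//.
exact: hc_ge.
Qed.

Lemma intg_hphi w : 0 <= w -> mu.-integrable D (EFin \o hphi w).
Proof.
move=> w0; have := @intg_hint _ _ t0 0 0 w 0 w0.
congr (mu.-integrable D (EFin \o _)); apply/funext => l.
by rewrite /hint /hm /hphi !expr0 !mulr1 mulr0 mul0r addr0 cos0 mul1r.
Qed.

Lemma heatH00_continuous w : 0 <= w -> continuous (heatH 0 0 w).
Proof.
move=> w0 z; apply/cvgrPdist_le => e e0.
pose M := heatM t 1 0 + 1.
have M0 : 0 < M by rewrite ltr_wpDl// heatM_ge0.
near=> z'.
rewrite (le_trans (heatH_lipschitz t0 0 0 z z' w0 w0))//.
rewrite subrr normr0 mulr0 addr0 (@le_trans _ _ (M * `|z - z'|))//.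
  by rewrite ler_wpM2r// lerDl.
rewrite -ler_pdivlMl// mulrC; near: z'.
by apply: cvgr_dist_le => //; rewrite divr_gt0.
Unshelve. all: by end_near. Qed.

Lemma heatH00_even w z : heatH 0 0 w (- z) = heatH 0 0 w z.
Proof.
by rewrite !heatH00E; apply: eq_Rintegral => l _; rewrite mulNr cosN.
Qed.

Lemma fubini_cos (E P : measurableTypeR R -> R) :
  mu.-integrable setT (EFin \o E) -> mu.-integrable setT (EFin \o P) ->
  (\int[mu]_x (E x * \int[mu]_y (P y * cos (x * y)))%:E =
   \int[mu]_y (P y * \int[mu]_x (E x * cos (y * x)))%:E)%E.
Proof.
move=> iE iP; have mE := intg_measurable iE; have mP := intg_measurable iP.
pose f (p : measurableTypeR R * measurableTypeR R) : \bar R :=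
  (E p.1 * (P p.2 * cos (p.1 * p.2)))%:E.
have mcos : measurable_fun setT (@cos R).
  by apply: continuous_measurable_fun; exact: continuous_cos.
have icos (h : measurableTypeR R -> R) a : mu.-integrable setT (EFin \o h) ->
    mu.-integrable setT (EFin \o (fun y => h y * cos (a * y))).
  move=> ih; apply: (dominated_integrable measurableT _ (intg_abs ih)).
    apply: measurable_funM; first exact: intg_measurable ih.
    by apply: (measurableT_comp mcos); exact: measurable_funM.
  by move=> y _; rewrite normrM ler_piMr// cos_max.
have mf : measurable_fun setT f.
  apply/measurable_EFinP; apply: measurable_funM.
    by apply: measurableT_comp => //; exact: measurable_fst.
  apply: measurable_funM; first by apply: measurableT_comp => //; exact: measurable_snd.
  apply: (measurableT_comp mcos).
  by apply: measurable_funM; [exact: measurable_fst|exact: measurable_snd].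
have mnE : measurable_fun setT (fun x => `|E x|%:E).
  by apply/measurable_EFinP; exact: measurableT_comp.
have mnP : measurable_fun setT (fun x => `|P x|%:E).
  by apply/measurable_EFinP; exact: measurableT_comp.
have P0 : (0 <= \int[mu]_y `|P y|%:E)%E by apply: integral_ge0 => y _; rewrite lee_fin.
have fi : (lebesgue_measure \x lebesgue_measure)%E.-integrable setT f.
  apply/integrable12ltyP; first exact: mf.
  apply: (@le_lt_trans _ _ (\int[mu]_x (`|E x|%:E * \int[mu]_y `|P y|%:E))%E).
    apply: ge0_le_integral => [//|x _|||x _].
    - by apply: integral_ge0 => y _; rewrite abse_ge0.
    - apply: (@measurable_fun_fubini_tonelli_F _ _ _ _ _ _ (fun p => `|f p|%E)) => //.
      exact: measurableT_comp.
    - by apply: emeasurable_funM => //; exact: measurable_cst.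
    - rewrite -ge0_integralZl//.
      apply: ge0_le_integral => // [||y _].
      + by apply: measurableT_comp => //; exact: (measurableT_comp mf (pair1_measurable x)).
      + by apply: emeasurable_funM => //; exact: measurable_cst.
      + rewrite /f /= -EFinM lee_fin !normrM ler_wpM2l//.
        by rewrite ler_piMr// cos_max.
  rewrite ge0_integralZr//.
  rewrite lte_mul_pinfty//.
  - by apply: integral_ge0 => y _; rewrite lee_fin.
  - rewrite ge0_fin_numE; last by apply: integral_ge0 => y _; rewrite lee_fin.
    by have /integrableP[] := iE.
  - by have /integrableP[] := iP.
have F := @Fubini _ _ _ _ _ lebesgue_measure lebesgue_measure f fi.
transitivity (\int[lebesgue_measure]_x \int[lebesgue_measure]_y f (x, y))%E.
  apply: eq_integral => x _; rewrite EFinM /Rintegral fineK; last first.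
    by apply: integrable_fin_num => //; exact: icos.
  by rewrite -integralZl//; exact: icos.
rewrite F; apply: eq_integral => y _; rewrite EFinM /Rintegral fineK; last first.
  by apply: integrable_fin_num => //; exact: icos.
rewrite -integralZl//; last exact: icos.
by apply: eq_integral => x _; rewrite -EFinM /f /= mulrCA (mulrC y).
Qed.

(* Fubini turns the exponentially damped integral in [z] into the integral of
   [hphi w] against the Cauchy kernel. *)
Lemma damped_heatH00 w (e : R) : 0 <= w -> 0 < e ->
  (\int[mu]_(z in D) (heatH 0 0 w z * expR (- (e * z)))%:E <=
   (pi / 2 * (t^-1 * expR (- (w / (4 * t)))))%:E)%E.
Proof.
move=> w0 e0.
have iE : mu.-integrable setT (EFin \o ((fun z => expR (- (e * z))) \_ D)).
  rewrite -restrict_EFin; apply/integrable_restrict => //.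
  by rewrite setTI; exact: intg_expRN.
have iP : mu.-integrable setT (EFin \o ((hphi w) \_ D)).
  rewrite -restrict_EFin; apply/integrable_restrict => //.
  by rewrite setTI; exact: intg_hphi.
have patchM (f g : R -> R) : (fun y => (f \_ D) y * g y) = (fun y => f y * g y) \_ D.
  by apply/funext => y; rewrite !patchE; case: ifPn => // _; rewrite mul0r.
have := fubini_cos iE iP.
under eq_integral do rewrite patchM -Rintegral_mkcond -heatH00E.
under [RHS]eq_integral do rewrite patchM -Rintegral_mkcond exp_cos_integral//.
have patchE2 (f g : R -> R) : (fun y => ((f \_ D) y * g y)%:E) =
    (EFin \o (fun y => f y * g y)) \_ D.
  by rewrite restrict_EFin -patchM.
rewrite !patchE2.
rewrite -!integral_mkcond => F.
under eq_integral do rewrite mulrC.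
have {}F : (\int[mu]_(z in D) (expR (- (e * z)) * heatH 0 0 w z)%:E =
  \int[mu]_(l in D) (hphi w l * (e / (e ^+ 2 + l ^+ 2)))%:E)%E by exact: F.
rewrite F.
have mC : measurable_fun D (fun l : measurableTypeR R => (e / (e ^+ 2 + l ^+ 2))%:E).
  apply/measurable_EFinP; apply: measurable_funTS; apply: measurable_funM => //.
  apply: measurable_funV; apply: measurable_funD => //; exact: measurable_funX.
have C0 l : 0 <= e / (e ^+ 2 + l ^+ 2).
  by rewrite divr_ge0 ?(ltW e0)// addr_ge0 ?sqr_ge0.
rewrite mulrC EFinM -(cauchy_integral e0).
rewrite -ge0_integralZl//; last 2 first.
  by move=> l _; rewrite lee_fin.
  by rewrite lee_fin mulr_ge0 ?expR_ge0// invr_ge0 ltW.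
apply: ge0_le_integral => //.
- by move=> l /D_gt0 l0; rewrite lee_fin mulr_ge0// hphi_ge0.
- apply/measurable_EFinP; apply: measurable_funM; last exact/measurable_EFinP.
  exact: intg_measurable (intg_hphi w0).
- exact: emeasurable_funM.
- by move=> l /D_gt0 l0; rewrite lee_fin ler_wpM2r// hphi_le.
Qed.

(** Nonnegativity of the profile makes the damped integrals increase as the damping is removed;
    monotone convergence then yields integrability in [z] and the bound together. *)
Lemma integral_heatH00 w : 0 <= w ->
  (\int[mu]_z (heatH 0 0 w z)%:E <= (pi / t * expR (- (w / (4 * t))))%:E)%E.
Proof.
move=> w0.
have cH := heatH00_continuous w0.
have mH : measurable_fun setT (heatH 0 0 w) by exact: continuous_measurable_fun.
have H0 z := @heatH00_ge0 w z w0.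
rewrite (@ge0_symfun_integralT _ (heatH 0 0 w)) => //; last first.
  by move=> z /=; rewrite heatH00_even.
have -> : [set x : R | 0 <= x] = [set` `[0, +oo[].
  by apply/seteqP; split => x /=; rewrite in_itv/= andbT.
rewrite -integral_itv_obnd_cbnd; last exact/measurable_EFinP/measurable_funTS.
have -> : pi / t * expR (- (w / (4 * t))) =
    2 * (pi / 2 * (t^-1 * expR (- (w / (4 * t))))) by field; rewrite gt_eqF.
rewrite EFinM lee_pmul2l//.
pose g n z := (heatH 0 0 w z * expR (- (n.+1%:R^-1 * z)))%:E.
have cg z : D z -> g n z @[n --> \oo] --> (heatH 0 0 w z)%:E.
  move=> _; apply: cvg_EFin; first exact: nearW.
  rewrite /= -[X in _ --> X]mulr1 -[X in _ * X]expR0; apply: cvgMl_tmp.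
  apply: (continuous_cvg _ (@continuous_expR R _)).
  rewrite -[X in _ --> X]oppr0 -[X in - X](mul0r z); apply: cvgN; apply: cvgMr_tmp.
  exact: cvg_harmonic.
have mg n : measurable_fun D (g n).
  apply/measurable_EFinP; apply: measurable_funM; first exact: measurable_funTS.
  by apply: measurableT_comp => //; apply: measurableT_comp => //; exact: measurable_funM.
have -> : (\int[mu]_(z in D) (heatH 0 0 w z)%:E =
    \int[mu]_(z in D) limn (g^~ z))%E.
  by apply: eq_integral => z; rewrite inE => zD; apply/esym/cvg_lim => //; exact: cg.
rewrite monotone_convergence//; last 2 first.
- by move=> n z _; rewrite lee_fin mulr_ge0 ?expR_ge0.
- move=> z /D_gt0 z0 m n mn; rewrite lee_fin ler_wpM2l// ler_expR lerN2.
  by rewrite ler_wpM2r ?(ltW z0)// lef_pV2 ?posrE// ler_nat ltnS.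
apply: lime_le; last first.
  by apply: nearW => n; apply: damped_heatH00.
apply: ereal_nondecreasing_is_cvgn => m n mn; apply: ge0_le_integral => //.
- by move=> z _; rewrite lee_fin mulr_ge0 ?expR_ge0.
- move=> z /D_gt0 z0; rewrite lee_fin ler_wpM2l// ler_expR lerN2.
  by rewrite ler_wpM2r ?(ltW z0)// lef_pV2 ?posrE// ler_nat ltnS.
Qed.

End profile_integral.

(** * Measure-preserving maps and sigma-finite products *)

Section invariance.
Context d (T : measurableType d) (R : realType).
Variables (mu : {measure set T -> \bar R}) (phi : T -> T).
Hypothesis mu_phi : forall h : T -> \bar R, measurable_fun setT h ->
  (forall x, 0 <= h x)%E -> (\int[mu]_x h (phi x) = \int[mu]_x h x)%E.

Lemma Rintegral_invariant (g : T -> R) : measurable_fun setT g ->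
  \int[mu]_x g (phi x) = \int[mu]_x g x.
Proof.
move=> mg; rewrite /Rintegral; congr fine.
have mE : measurable_fun setT (EFin \o g) by exact/measurable_EFinP.
rewrite integralE [RHS]integralE; congr (_ - _)%E.
  rewrite -(mu_phi (measurable_funepos mE))//.
  by apply: eq_integral => x _; rewrite !funeposE.
rewrite -(mu_phi (measurable_funeneg mE))//.
by apply: eq_integral => x _; rewrite !funenegE.
Qed.

End invariance.

Section product_sigma_finite.
Context d1 d2 (T1 : measurableType d1) (T2 : measurableType d2) (R : realType).
Variables (m1 : {sigma_finite_measure set T1 -> \bar R})
  (m2 : {sigma_finite_measure set T2 -> \bar R}).

Lemma product_measure1_sigma_finite : sigma_finite setT (m1 \x m2)%E.
Proof.
have /sigma_finiteP[F [FT ndF Foo]] := sigma_finiteT m1.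
have /sigma_finiteP[G [GT ndG Goo]] := sigma_finiteT m2.
exists (fun n => F n `*` G n) => [|n].
  apply/seteqP; split=> // -[x y] _.
  have [i _ Fi] : (\bigcup_n F n) x by rewrite -FT.
  have [j _ Gj] : (\bigcup_n G n) y by rewrite -GT.
  exists (i + j)%N => //; split => /=.
    exact: (subsetPset _ _ (ndF _ _ (leq_addr j i))).
  exact: (subsetPset _ _ (ndG _ _ (leq_addl i j))).
have [mF Fn] := Foo n; have [mG Gn] := Goo n; split; first exact: measurableX.
rewrite [ltLHS]product_measure1E// lte_mul_pinfty//.
by rewrite ge0_fin_numE.
Qed.

End product_sigma_finite.

(* A named copy of the planar Lebesgue measure: the sigma-finite instance that
   inference finds on [m1 \x m2] is restricted to finite factors. *)
Definition lebesgue2 {R : realType} :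
    set (measurableTypeR R * measurableTypeR R) -> \bar R :=
  (lebesgue_measure \x lebesgue_measure)%E.

HB.instance Definition _ (R : realType) :=
  Measure.copy (@lebesgue2 R) (lebesgue_measure \x lebesgue_measure)%E.

HB.instance Definition _ (R : realType) :=
  Measure_isSigmaFinite.Build _ _ _ (@lebesgue2 R)
    (product_measure1_sigma_finite lebesgue_measure lebesgue_measure).

(** * Lebesgue measure on the Heisenberg group *)

Section lebesgue3.
Context {R : realType}.
Notation mR := (measurableTypeR R).
Notation mu := (@lebesgue_measure R).
Notation mu3 := (lebesgue3 : {measure set (mR * mR * mR) -> \bar R}).

Lemma countable_union_measurable d (T : measurableType d) (I : countType)
    (F : I -> set T) : (forall i, measurable (F i)) -> measurable (\bigcup_i F i).
Proof. by move=> mF; apply: countable_bigcupT_measurable => //; exact: countableP. Qed.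

Lemma measurable_ball3 (p : R * R * R) (e : R) :
  measurable (ball p e : set (mR * mR * mR)).
Proof.
have mb (x : R) : measurable (ball x e : set mR) by exact: measurable_ball.
rewrite (_ : ball p e = (ball p.1.1 e `*` ball p.1.2 e) `*` ball p.2 e).
  by apply: measurableX => //; exact: measurableX.
by apply/seteqP; split => -[[x y] z].
Qed.

(** The sigma-algebra is the product one, so an open set is reached as a countable union of balls
    with rational centre and radius, which are products of intervals. *)
Lemma open_measurable3 (U : set (R * R * R)) : open U ->
  measurable (U : set (mR * mR * mR)).
Proof.
move=> oU.
pose F (i : rat * rat * rat * rat) : set (mR * mR * mR) :=
  let B := ball (ratr i.1.1.1 : R, ratr i.1.1.2 : R, ratr i.1.2 : R) (ratr i.2 : R) in
  if pselect (B `<=` U) then B else set0.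
have -> : U = \bigcup_i F i.
  apply/seteqP; split => [[[x y] z] Up|p [i _]]; last first.
    by rewrite /F; case: pselect => // BU; exact: BU.
  have /nbhs_ballP[e /= e0 eU] : nbhs (x, y, z) U by exact: open_nbhs_nbhs.
  have e20 : 0 < e / 2 by rewrite divr_gt0.
  have /rat_in_itvoo[q] := e20; rewrite in_itv/= => /andP[q0 q1].
  have app (a : R) : exists r : rat, `|ratr r - a| < ratr q.
    have /rat_in_itvoo[r] : a - ratr q < a + ratr q by lra.
    rewrite in_itv/= => /andP[r1 r2]; exists r.
    by rewrite ltr_norml; apply/andP; split; lra.
  have [r1 h1] := app x; have [r2 h2] := app y; have [r3 h3] := app z.
  exists (r1, r2, r3, q) => //; rewrite /F/=.
  have bin : ball (ratr r1 : R, ratr r2 : R, ratr r3 : R) (ratr q : R) (x, y, z).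
    by split; [split|].
  case: pselect => // -[]; apply: subset_trans eU => p' bp'.
  apply: (@le_ball _ _ _ (ratr q + ratr q)); first by lra.
  by apply: ball_triangle bp'; exact: ball_sym.
apply: countable_union_measurable => i; rewrite /F.
case: (pselect _) => [_|_] /=; last exact: measurable0.
exact: measurable_ball3.
Qed.

Lemma continuous_measurable3 (f : R * R * R -> R) : continuous f ->
  measurable_fun setT (f : mR * mR * mR -> R).
Proof.
move=> cf; apply: (measurability _ (RGenOpens.measurableE R)) => _ [_ [a [b ->] <-]].
rewrite setTI; apply: open_measurable3; apply: open_comp => // *; exact: cf.
Qed.

Lemma ge0_integral_shift (h : mR -> \bar R) (c : R) : measurable_fun setT h ->
  (forall x, 0 <= h x)%E -> (\int[mu]_x h (x + c)%R = \int[mu]_x h x)%E.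
Proof.
move=> mh h0.
have mc : measurable_fun setT (fun x : mR => (x + c : mR)) by exact: measurable_funD.
rewrite -[LHS](@ge0_integral_pushforward _ _ _ _ _ _ mc mu setT h)//.
apply: eq_measure_integral => A mA _; apply/esym.
apply: (@lebesgue_measure_unique R (pushforward mu (fun x : mR => (x + c : mR)))) => //.
move=> _ [[a b] _ <-] /=; rewrite /pushforward.
have -> : (fun x => x + c) @^-1` [set` `]a, b]] = [set` `](a - c), (b - c)]].
  by apply/seteqP; split => x /=; rewrite !in_itv/= ltrBlDr lerBrDr.
rewrite !lebesgue_measure_itv/= !lte_fin ltrD2r; case: ifP => // _.
by rewrite -!EFinB; congr EFin; ring.
Qed.

Lemma ge0_integral_opp (h : mR -> \bar R) : measurable_fun setT h ->
  (forall x, 0 <= h x)%E -> (\int[mu]_x h (- x)%R = \int[mu]_x h x)%E.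
Proof.
move=> mh h0.
have mc : measurable_fun setT (-%R : mR -> mR) by exact: measurable_funN.
rewrite -[LHS](@ge0_integral_pushforward _ _ _ _ _ _ mc mu setT h)//.
by apply: eq_measure_integral => A mA _; exact: lebesgue_measureN.
Qed.

Definition rot90 (p : R * R * R) : R * R * R := (p.1.2, - p.1.1, p.2).

Lemma measurable_rot90 : measurable_fun setT (rot90 : mR * mR * mR -> mR * mR * mR).
Proof.
have mx : measurable_fun setT (fun p : mR * mR * mR => p.1.1).
  by apply: measurableT_comp; [exact: measurable_fst|exact: measurable_fst].
have my : measurable_fun setT (fun p : mR * mR * mR => p.1.2).
  by apply: measurableT_comp; [exact: measurable_snd|exact: measurable_fst].
apply: measurable_fun_pair; last exact: measurable_snd.
by apply: measurable_fun_pair => //; exact: measurable_funN.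
Qed.

Lemma measurable_hmul (p : R * R * R) :
  measurable_fun setT (hmul p : mR * mR * mR -> mR * mR * mR).
Proof.
have mx : measurable_fun setT (fun p : mR * mR * mR => p.1.1).
  by apply: measurableT_comp; [exact: measurable_fst|exact: measurable_fst].
have my : measurable_fun setT (fun p : mR * mR * mR => p.1.2).
  by apply: measurableT_comp; [exact: measurable_snd|exact: measurable_fst].
have mz : measurable_fun setT (fun p : mR * mR * mR => p.2) by exact: measurable_snd.
apply: measurable_fun_pair.
  by apply: measurable_fun_pair; exact: measurable_funD.
apply: measurable_funD; first exact: measurable_funD.
by apply: measurable_funM => //; apply: measurable_funB; exact: measurable_funM.
Qed.

Lemma tonelli3 (h : mR * mR * mR -> \bar R) :
  measurable_fun setT h -> (forall q, 0 <= h q)%E ->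
  (\int[mu3]_q h q = \int[(mu \x mu)%E]_a \int[mu]_z h (a, z))%E.
Proof.
move=> mh h0.
exact: (@fubini_tonelli1 _ _ (mR * mR)%type mR R lebesgue2 mu h mh h0).
Qed.

Lemma tonelli2 (h : mR * mR -> \bar R) :
  measurable_fun setT h -> (forall q, 0 <= h q)%E ->
  (\int[(mu \x mu)%E]_q h q = \int[mu]_x \int[mu]_y h (x, y))%E.
Proof. by move=> mh h0; exact: (@fubini_tonelli1 _ _ mR mR R mu mu h mh h0). Qed.

Lemma tonelli2_swap (h : mR * mR -> \bar R) :
  measurable_fun setT h -> (forall q, 0 <= h q)%E ->
  (\int[(mu \x mu)%E]_q h q = \int[mu]_y \int[mu]_x h (x, y))%E.
Proof. by move=> mh h0; exact: (@fubini_tonelli2 _ _ mR mR R mu mu h mh h0). Qed.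

(** When [z] is integrated first, the twist of the product is a translation for fixed horizontal
    coordinates; only translations in [x] and [y] remain. *)
Lemma ge0_integral_hmul (p : R * R * R) (h : mR * mR * mR -> \bar R) :
  measurable_fun setT h -> (forall q, 0 <= h q)%E ->
  (\int[mu3]_q h (hmul p q) = \int[mu3]_q h q)%E.
Proof.
move=> mh h0; have mhp := measurableT_comp mh (measurable_hmul p).
rewrite (tonelli3 mh)// (tonelli3 mhp); last by move=> q; exact: h0.
pose k (a : mR * mR) := (\int[mu]_z h (a, z))%E.
have mk : measurable_fun setT k.
  exact: (@measurable_fun_fubini_tonelli_F _ _ (mR * mR)%type mR R mu h mh h0).
have k0 a : (0 <= k a)%E by apply: integral_ge0 => z _; exact: h0.
pose s (a : mR * mR) : mR * mR := (p.1.1 + a.1, p.1.2 + a.2).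
transitivity (\int[(mu \x mu)%E]_a k (s a))%E.
  apply: eq_integral => a _; rewrite /k.
  rewrite -(@ge0_integral_shift (fun z => h (s a, z))
    (p.2 + 2^-1 * (p.1.1 * a.2 - p.1.2 * a.1)))//; last exact: measurable_fun_pair2.
  by apply: eq_integral => z _ /=; rewrite /hmul/=; congr (h (_, _)); ring.
have mT : measurable_fun setT s.
  by apply: measurable_fun_pair; exact: measurable_funD.
have mkT := measurableT_comp mk mT.
rewrite (tonelli2 mk)// (tonelli2 mkT); last by move=> q; exact: k0.
rewrite -(@ge0_integral_shift (fun x => \int[mu]_y k (x, y))%E p.1.1).
- apply: eq_integral => x _.
  rewrite -(@ge0_integral_shift (fun y => k (x + p.1.1, y)) p.1.2)//;
    last exact: measurable_fun_pair2.
  by apply: eq_integral => y _; rewrite /s/= (addrC x) (addrC y).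
- exact: (@measurable_fun_fubini_tonelli_F _ _ mR mR R mu k mk k0).
- by move=> x; apply: integral_ge0 => y _; exact: k0.
Qed.

Lemma ge0_integral_rot90 (h : mR * mR * mR -> \bar R) :
  measurable_fun setT h -> (forall q, 0 <= h q)%E ->
  (\int[mu3]_q h (rot90 q) = \int[mu3]_q h q)%E.
Proof.
move=> mh h0; have mhp := measurableT_comp mh measurable_rot90.
rewrite (tonelli3 mh)// (tonelli3 mhp); last by move=> q; exact: h0.
pose k (a : mR * mR) := (\int[mu]_z h (a, z))%E.
have mk : measurable_fun setT k.
  exact: (@measurable_fun_fubini_tonelli_F _ _ (mR * mR)%type mR R mu h mh h0).
have k0 a : (0 <= k a)%E by apply: integral_ge0 => z _; exact: h0.
pose s (a : mR * mR) : mR * mR := (a.2, - a.1).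
rewrite -[LHS]/(\int[(mu \x mu)%E]_a k (s a))%E.
have mT : measurable_fun setT s.
  apply: measurable_fun_pair; first exact: measurable_snd.
  by apply: measurable_funN; exact: measurable_fst.
have mkT := measurableT_comp mk mT.
rewrite (tonelli2 mk)// (tonelli2_swap mkT); last by move=> q; exact: k0.
apply: eq_integral => x _.
rewrite -(@ge0_integral_opp (fun y => k (x, y)))//.
exact: measurable_fun_pair2.
Qed.

End lebesgue3.

(** * Integrals that vanish slice by slice *)

Section fubini_zero.
Context d1 d2 (T1 : measurableType d1) (T2 : measurableType d2) (R : realType).
Variables (m1 : {sigma_finite_measure set T1 -> \bar R})
  (m2 : {sigma_finite_measure set T2 -> \bar R}) (A : set T1) (B : set T2)
  (g : T1 * T2 -> R).
Hypotheses (mA : measurable A) (mB : measurable B)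
  (ig : (m1 \x m2)%E.-integrable (A `*` B) (EFin \o g)).

Let igT : (m1 \x m2)%E.-integrable setT (EFin \o g \_ (A `*` B)).
Proof.
by rewrite -restrict_EFin; apply/integrable_restrict; rewrite ?setTI//; exact: measurableX.
Qed.

Lemma integral_slice1_eq0 :
  (forall x, A x -> \int[m2]_(y in B) (g (x, y))%:E = 0)%E ->
  (\int[(m1 \x m2)%E]_(p in A `*` B) (g p)%:E = 0)%E.
Proof.
move=> h; rewrite integral_mkcond restrict_EFin -(integral12_prod_meas1 igT).
rewrite (eq_integral (cst 0)%E) ?integral0// => x _ /=.
rewrite /fubini_F; have [xA|xA] := boolP (x \in A).
  rewrite -[RHS](h x); last by rewrite inE in xA.
  rewrite [RHS]integral_mkcond; apply: eq_integral => y _.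
  by rewrite /= !patchE in_setX xA /=; case: ifPn.
rewrite (eq_integral (cst 0)%E) ?integral0// => y _ /=.
by rewrite patchE in_setX (negbTE xA).
Qed.

Lemma integral_slice2_eq0 :
  (forall y, B y -> \int[m1]_(x in A) (g (x, y))%:E = 0)%E ->
  (\int[(m1 \x m2)%E]_(p in A `*` B) (g p)%:E = 0)%E.
Proof.
move=> h; rewrite integral_mkcond restrict_EFin -(integral21_prod_meas1 igT).
rewrite (eq_integral (cst 0)%E) ?integral0// => y _ /=.
rewrite /fubini_G; have [yB|yB] := boolP (y \in B).
  rewrite -[RHS](h y); last by rewrite inE in yB.
  rewrite [RHS]integral_mkcond; apply: eq_integral => x _.
  by rewrite /= !patchE in_setX yB andbT /=; case: ifPn.
rewrite (eq_integral (cst 0)%E) ?integral0// => x _ /=.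
by rewrite patchE in_setX (negbTE yB) andbF.
Qed.

End fubini_zero.

(** * Boxes, continuously differentiable functions and the divergence theorem *)

Section box.
Context {R : realType}.
Notation mR := (measurableTypeR R).
Notation mu := (@lebesgue_measure R).
Notation mu3 := (lebesgue3 : {measure set (mR * mR * mR) -> \bar R}).
Implicit Types r : R.

Definition seg r : set mR := [set` `[- r, r]].
Definition box r : set (mR * mR * mR) := (seg r `*` seg r) `*` seg r.

Lemma segP r (x : R) : seg r x <-> `|x| <= r.
Proof. by rewrite /seg /= in_itv/= ler_norml. Qed.

Lemma boxP r (p : R * R * R) :
  box r p <-> [/\ `|p.1.1| <= r, `|p.1.2| <= r & `|p.2| <= r].
Proof.
split=> [[[/segP ? /segP ?] /segP ?]|[? ? ?]] //.
by split; [split|]; apply/segP.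
Qed.

Lemma measurable_seg r : measurable (seg r).
Proof. exact: measurable_itv. Qed.

Lemma measurable_box r : measurable (box r).
Proof. by do 2 (apply: measurableX; last exact: measurable_seg); exact: measurable_seg. Qed.

Lemma seg_fin r : (mu (seg r) < +oo)%E.
Proof. by rewrite /seg lebesgue_measure_itv/=; case: ifP => _; rewrite ltry. Qed.

Lemma seg2_fin r : ((lebesgue2 : {measure set (mR * mR) -> \bar R}) (seg r `*` seg r) < +oo)%E.
Proof.
rewrite [ltLHS](@product_measure1E _ _ mR mR R mu mu); try exact: measurable_seg.
by rewrite lte_mul_pinfty ?seg_fin// ge0_fin_numE ?seg_fin.
Qed.

Lemma box_fin r : (mu3 (box r) < +oo)%E.
Proof.
rewrite [ltLHS](@product_measure1E _ _ (mR * mR)%type mR R lebesgue2 mu).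
- rewrite lte_mul_pinfty ?seg_fin//.
  by rewrite ge0_fin_numE ?seg2_fin.
- by apply: measurableX; exact: measurable_seg.
- exact: measurable_seg.
Qed.

Lemma box_bounded r (g : R * R * R -> R) : continuous g ->
  exists C, forall p, box r p -> `|g p| <= C.
Proof.
move=> cg; have cI : compact ([set` `[- r, r]] : set R) by exact: segment_compact.
have cB := compact_setX (compact_setX cI cI) cI.
have cgB : compact (g @` ((([set` `[- r, r]] : set R) `*` [set` `[- r, r]]) `*` [set` `[- r, r]])).
  by apply: continuous_compact => //; exact: continuous_subspaceT.
have [M [Mr hM]] := compact_bounded cgB.
exists (M + 1) => p Bp; apply: (hM (M + 1)); first by rewrite ltrDl.
by exists p.
Qed.

Lemma intg_box r (g : R * R * R -> R) : continuous g ->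
  mu3.-integrable (box r) (EFin \o g).
Proof.
move=> cg; have [C hC] := box_bounded r cg.
apply: measurable_bounded_integrable.
- exact: measurable_box.
- exact: box_fin.
- by apply: measurable_funTS; exact: continuous_measurable3.
- exists `|C|; split; first exact: normr_real.
  by move=> M CM p Bp /=; rewrite (le_trans (hC p Bp))// (le_trans (ler_norm C))// ltW.
Qed.

Lemma integral_derive_eq0 r (F f : R -> R) : 0 < r -> continuous f ->
  (forall x : R, is_derive x 1 F (f x)) -> F r = F (- r) ->
  (\int[mu]_(x in seg r) (f x)%:E = 0)%E.
Proof.
move=> r0 cf dF FE.
have cF : continuous F.
  by move=> x; apply: differentiable_continuous; apply/derivable1_diffP; have [] := dF x.
rewrite /seg (@continuous_FTC2 _ f F).
- by rewrite FE -EFinB subrr.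
- by lra.
- exact: continuous_subspaceT.
- split=> [x _||]; first by have [] := dF x.
  + by apply: cvg_at_right_filter; exact: cF.
  + by apply: cvg_at_left_filter; exact: cF.
- by move=> x _; rewrite derive1E; have [_ ->] := dF x.
Qed.

#[local] Obligation Tactic := idtac.

(* The partial derivatives are carried as data, so that those of a compound
   expression reduce by computation to explicit formulas. *)
Record c1 := C1 { c1v :> R * R * R -> R;
  c1x : R * R * R -> R; c1y : R * R * R -> R; c1z : R * R * R -> R;
  c1v_cont : continuous c1v; c1x_cont : continuous c1x;
  c1y_cont : continuous c1y; c1z_cont : continuous c1z;
  c1x_der : forall x y z : R, is_derive x 1 (fun s => c1v (s, y, z)) (c1x (x, y, z));
  c1y_der : forall x y z : R, is_derive y 1 (fun s => c1v (x, s, z)) (c1y (x, y, z));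
  c1z_der : forall x y z : R, is_derive z 1 (fun s => c1v (x, y, s)) (c1z (x, y, z)) }.

Lemma cont_x (f : R * R * R -> R) y z : continuous f -> continuous (fun x => f (x, y, z)).
Proof.
move=> cf x; have h : (fun s : R => (s, y, z)) @ x --> (x, y, z).
  apply: (@cvg_pair _ _ _ (nbhs x) (nbhs (x, y)) (nbhs z)); last exact: cvg_cst.
  by apply: (@cvg_pair _ _ _ (nbhs x) (nbhs x) (nbhs y)); [exact: cvg_id|exact: cvg_cst].
by apply: continuous_cvg h; exact: cf.
Qed.

Lemma cont_y (f : R * R * R -> R) x z : continuous f -> continuous (fun y => f (x, y, z)).
Proof.
move=> cf y; have h : (fun s : R => (x, s, z)) @ y --> (x, y, z).
  apply: (@cvg_pair _ _ _ (nbhs y) (nbhs (x, y)) (nbhs z)); last exact: cvg_cst.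
  by apply: (@cvg_pair _ _ _ (nbhs y) (nbhs x) (nbhs y)); [exact: cvg_cst|exact: cvg_id].
by apply: continuous_cvg h; exact: cf.
Qed.

Lemma cont_z (f : R * R * R -> R) x y : continuous f -> continuous (fun z => f (x, y, z)).
Proof.
move=> cf z; have h : (fun s : R => (x, y, s)) @ z --> (x, y, z).
  by apply: (@cvg_pair _ _ _ (nbhs z) (nbhs (x, y)) (nbhs z)); [exact: cvg_cst|exact: cvg_id].
by apply: continuous_cvg h; exact: cf.
Qed.

Lemma intg_seg2 r (g : R * R * R -> R) z : continuous g -> seg r z ->
  (lebesgue2 : {measure set (mR * mR) -> \bar R}).-integrable (seg r `*` seg r)
    (EFin \o (fun a => g (a, z))).
Proof.
move=> cg rz; have [C hC] := box_bounded r cg.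
apply: measurable_bounded_integrable.
- by apply: measurableX; exact: measurable_seg.
- exact: seg2_fin.
- apply: measurable_funTS.
  exact: (@measurable_fun_pair1 _ _ _ (mR * mR)%type mR R g z (continuous_measurable3 cg)).
- exists `|C|; split; first exact: normr_real.
  move=> M CM a Ba /=; apply: (le_trans (hC (a, z) (conj Ba rz))).
  by rewrite (le_trans (ler_norm C))// ltW.
Qed.

(** Divergence theorem in one coordinate. Every flux below carries a cutoff that vanishes on the
    faces of the box, so the two opposite faces agree. *)
Lemma integral_c1x r (u : c1) : 0 < r -> (forall y z, u (r, y, z) = u (- r, y, z)) ->
  \int[mu3]_(p in box r) c1x u p = 0.
Proof.
move=> r0 ur; rewrite /Rintegral.
rewrite (@integral_slice2_eq0 _ _ (mR * mR)%type mR R lebesgue2 mu (seg r `*` seg r) (seg r))//.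
- by apply: measurableX; exact: measurable_seg.
- exact: measurable_seg.
- by apply: intg_box; exact: c1x_cont.
move=> z rz.
apply: (@integral_slice2_eq0 _ _ mR mR R mu mu (seg r) (seg r) (fun a => c1x u (a, z))).
- exact: measurable_seg.
- exact: measurable_seg.
- by apply: (intg_seg2 _ rz); exact: c1x_cont.
move=> y _; apply: (@integral_derive_eq0 r (fun s => u (s, y, z))) => //.
  by apply: cont_x; exact: c1x_cont.
by move=> x; exact: c1x_der.
Qed.

Lemma integral_c1y r (u : c1) : 0 < r -> (forall x z, u (x, r, z) = u (x, - r, z)) ->
  \int[mu3]_(p in box r) c1y u p = 0.
Proof.
move=> r0 ur; rewrite /Rintegral.
rewrite (@integral_slice2_eq0 _ _ (mR * mR)%type mR R lebesgue2 mu (seg r `*` seg r) (seg r))//.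
- by apply: measurableX; exact: measurable_seg.
- exact: measurable_seg.
- by apply: intg_box; exact: c1y_cont.
move=> z rz.
apply: (@integral_slice1_eq0 _ _ mR mR R mu mu (seg r) (seg r) (fun a => c1y u (a, z))).
- exact: measurable_seg.
- exact: measurable_seg.
- by apply: (intg_seg2 _ rz); exact: c1y_cont.
move=> x _; apply: (@integral_derive_eq0 r (fun s => u (x, s, z))) => //.
  by apply: cont_y; exact: c1y_cont.
by move=> y; exact: c1y_der.
Qed.

Lemma integral_c1z r (u : c1) : 0 < r -> (forall x y, u (x, y, r) = u (x, y, - r)) ->
  \int[mu3]_(p in box r) c1z u p = 0.
Proof.
move=> r0 ur; rewrite /Rintegral.
rewrite (@integral_slice1_eq0 _ _ (mR * mR)%type mR R lebesgue2 mu (seg r `*` seg r) (seg r))//.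
- by apply: measurableX; exact: measurable_seg.
- exact: measurable_seg.
- by apply: intg_box; exact: c1z_cont.
move=> [x y] _; apply: (@integral_derive_eq0 r (fun s => u (x, y, s))) => //.
  by apply: cont_z; exact: c1z_cont.
by move=> z; exact: c1z_der.
Qed.

Program Definition c1_cst (a : R) : c1 :=
  @C1 (cst a) (cst 0) (cst 0) (cst 0) _ _ _ _ _ _ _.
Next Obligation. by move=> a p; exact: cvg_cst. Qed.
Next Obligation. by move=> a p; exact: cvg_cst. Qed.
Next Obligation. by move=> a p; exact: cvg_cst. Qed.
Next Obligation. by move=> a p; exact: cvg_cst. Qed.
Next Obligation. by move=> a x y z; exact: is_derive_cst. Qed.
Next Obligation. by move=> a x y z; exact: is_derive_cst. Qed.
Next Obligation. by move=> a x y z; exact: is_derive_cst. Qed.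

Program Definition c1_X : c1 :=
  @C1 (fun p => p.1.1) (cst 1) (cst 0) (cst 0) _ _ _ _ _ _ _.
Next Obligation. by move=> p; apply: cvg_comp; [exact: cvg_fst|exact: cvg_fst]. Qed.
Next Obligation. by move=> p; exact: cvg_cst. Qed.
Next Obligation. by move=> p; exact: cvg_cst. Qed.
Next Obligation. by move=> p; exact: cvg_cst. Qed.
Next Obligation. by move=> x y z; exact: is_derive_cst. Qed.
Next Obligation. by move=> x y z; exact: is_derive_cst. Qed.

Program Definition c1_Y : c1 :=
  @C1 (fun p => p.1.2) (cst 0) (cst 1) (cst 0) _ _ _ _ _ _ _.
Next Obligation. by move=> p; apply: cvg_comp; [exact: cvg_fst|exact: cvg_snd]. Qed.
Next Obligation. by move=> p; exact: cvg_cst. Qed.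
Next Obligation. by move=> p; exact: cvg_cst. Qed.
Next Obligation. by move=> p; exact: cvg_cst. Qed.
Next Obligation. by move=> x y z; exact: is_derive_cst. Qed.
Next Obligation. by move=> x y z; exact: is_derive_cst. Qed.

Program Definition c1_Z : c1 :=
  @C1 (fun p => p.2) (cst 0) (cst 0) (cst 1) _ _ _ _ _ _ _.
Next Obligation. by move=> p; exact: cvg_snd. Qed.
Next Obligation. by move=> p; exact: cvg_cst. Qed.
Next Obligation. by move=> p; exact: cvg_cst. Qed.
Next Obligation. by move=> p; exact: cvg_cst. Qed.
Next Obligation. by move=> x y z; exact: is_derive_cst. Qed.
Next Obligation. by move=> x y z; exact: is_derive_cst. Qed.

Program Definition c1_add (u v : c1) : c1 :=
  @C1 (fun p => u p + v p) (fun p => c1x u p + c1x v p)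
    (fun p => c1y u p + c1y v p) (fun p => c1z u p + c1z v p) _ _ _ _ _ _ _.
Next Obligation. by move=> u v p; apply: cvgD; exact: c1v_cont. Qed.
Next Obligation. by move=> u v p; apply: cvgD; exact: c1x_cont. Qed.
Next Obligation. by move=> u v p; apply: cvgD; exact: c1y_cont. Qed.
Next Obligation. by move=> u v p; apply: cvgD; exact: c1z_cont. Qed.
Next Obligation. by move=> u v x y z; exact: (is_deriveD (c1x_der u x y z) (c1x_der v x y z)). Qed.
Next Obligation. by move=> u v x y z; exact: (is_deriveD (c1y_der u x y z) (c1y_der v x y z)). Qed.
Next Obligation. by move=> u v x y z; exact: (is_deriveD (c1z_der u x y z) (c1z_der v x y z)). Qed.

Program Definition c1_mul (u v : c1) : c1 :=
  @C1 (fun p => u p * v p) (fun p => u p * c1x v p + v p * c1x u p)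
    (fun p => u p * c1y v p + v p * c1y u p)
    (fun p => u p * c1z v p + v p * c1z u p) _ _ _ _ _ _ _.
Next Obligation. by move=> u v p; apply: cvgM; exact: c1v_cont. Qed.
Next Obligation.
by move=> u v p; apply: cvgD; apply: cvgM; try exact: c1v_cont; exact: c1x_cont.
Qed.
Next Obligation.
by move=> u v p; apply: cvgD; apply: cvgM; try exact: c1v_cont; exact: c1y_cont.
Qed.
Next Obligation.
by move=> u v p; apply: cvgD; apply: cvgM; try exact: c1v_cont; exact: c1z_cont.
Qed.
Next Obligation. by move=> u v x y z; exact: (is_deriveM (c1x_der u x y z) (c1x_der v x y z)). Qed.
Next Obligation. by move=> u v x y z; exact: (is_deriveM (c1y_der u x y z) (c1y_der v x y z)). Qed.
Next Obligation. by move=> u v x y z; exact: (is_deriveM (c1z_der u x y z) (c1z_der v x y z)). Qed.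

(** The hypotheses on [phi] bear on the values of [u] only, so that a logarithm of a positive
    function qualifies. *)
Program Definition c1_comp (phi dphi : R -> R) (u : c1)
    (dp : forall p, is_derive (u p) 1 phi (dphi (u p)))
    (cp : forall p, {for (u p), continuous dphi}) : c1 :=
  @C1 (fun p => phi (u p)) (fun p => dphi (u p) * c1x u p)
    (fun p => dphi (u p) * c1y u p) (fun p => dphi (u p) * c1z u p) _ _ _ _ _ _ _.
Next Obligation.
move=> phi dphi u dp cp p.
apply: (@continuous_cvg _ _ _ _ _ u phi); last exact: c1v_cont.
by apply: differentiable_continuous; apply/derivable1_diffP; have [] := dp p.
Qed.
Next Obligation.
move=> phi dphi u dp cp p; apply: cvgM; last exact: c1x_cont.
by apply: (@continuous_cvg _ _ _ _ _ u dphi); [exact: cp|exact: c1v_cont].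
Qed.
Next Obligation.
move=> phi dphi u dp cp p; apply: cvgM; last exact: c1y_cont.
by apply: (@continuous_cvg _ _ _ _ _ u dphi); [exact: cp|exact: c1v_cont].
Qed.
Next Obligation.
move=> phi dphi u dp cp p; apply: cvgM; last exact: c1z_cont.
by apply: (@continuous_cvg _ _ _ _ _ u dphi); [exact: cp|exact: c1v_cont].
Qed.
Next Obligation.
move=> phi dphi u dp cp x y z.
exact: (@is_derive1_comp R phi _ x _ _ (dp (x, y, z)) (c1x_der u x y z)).
Qed.
Next Obligation.
move=> phi dphi u dp cp x y z.
exact: (@is_derive1_comp R phi _ y _ _ (dp (x, y, z)) (c1y_der u x y z)).
Qed.
Next Obligation.
move=> phi dphi u dp cp x y z.
exact: (@is_derive1_comp R phi _ z _ _ (dp (x, y, z)) (c1z_der u x y z)).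
Qed.

End box.

(** * Integrals of even functions *)

Section even_integral.
Context {R : realType}.
Let mu : {measure set (measurableTypeR R) -> \bar R} := @lebesgue_measure R.
Let D : set (measurableTypeR R) := `]0, +oo[.
Let mD : measurable D. Proof. exact: measurable_itv. Qed.

Lemma ge0_integral_even (h : measurableTypeR R -> \bar R) :
  measurable_fun setT h -> (forall x, 0 <= h x)%E -> (forall x, h (- x) = h x) ->
  (\int[mu]_x h x = \int[mu]_(x in D) h x + \int[mu]_(x in D) h x)%E.
Proof.
move=> mh h0 hN.
pose N : set (measurableTypeR R) := [set` `]-oo, 0[].
have mN : measurable N by exact: measurable_itv.
have -> : [set: measurableTypeR R] = N `|` [set` `[0, +oo[].
  apply/seteqP; split=> // x _; have [x0|x0] := ltP x 0; [left|right].
    by rewrite /N /= in_itv.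
  by rewrite /= in_itv/= x0.
rewrite ge0_integral_setU//=; last 2 first.
- exact: measurable_funTS.
- apply/disj_setPS => x [] /=; rewrite /N /= !in_itv/= andbT => x0.
  by rewrite leNgt x0.
congr (_ + _)%E; last first.
  by rewrite -integral_itv_obnd_cbnd//; exact: measurable_funTS.
rewrite [LHS]integral_mkcond [RHS]integral_mkcond.
rewrite -[LHS]ge0_integral_opp.
- apply: eq_integral => x _; rewrite !patchE hN; congr (if _ then _ else _).
  by apply/idP/idP; rewrite !inE /N /D /= !in_itv/= andbT oppr_lt0.
- exact/(measurable_restrictT _ mN)/measurable_funTS.
- by move=> x; rewrite patchE; case: ifP.
Qed.

Lemma Rintegral_even (g : measurableTypeR R -> R) : measurable_fun setT g ->
  (forall x, g (- x) = g x) -> mu.-integrable D (EFin \o g) ->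
  \int[mu]_x g x = 2 * \int[mu]_(x in D) g x.
Proof.
move=> mg gN ig; have mE : measurable_fun setT (EFin \o g) by exact/measurable_EFinP.
rewrite /Rintegral integralE [in RHS]integralE.
rewrite (ge0_integral_even (measurable_funepos mE))//; last first.
  by move=> x; rewrite !funeposE /= gN.
rewrite (ge0_integral_even (measurable_funeneg mE))//; last first.
  by move=> x; rewrite !funenegE /= gN.
have /fineK <- : (\int[mu]_(x in D) (EFin \o g)^\+ x)%E \is a fin_num.
  by apply: integrable_pos_fin_num.
have /fineK <- : (\int[mu]_(x in D) (EFin \o g)^\- x)%E \is a fin_num.
  by apply: integrable_neg_fin_num.
set a := fine (\int[mu]_(x in D) _ x)%E; set b := fine (\int[mu]_(x in D) (EFin \o g)^\- x)%E.
by change (a + a - (b + b) = 2 * (a - b)); ring.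
Qed.

End even_integral.

(** * The heat kernel *)

Section kernel.
Context {R : realType} (t : R).
Hypothesis t0 : 0 < t.
Notation mR := (measurableTypeR R).
Notation mu := (@lebesgue_measure R).
Notation mu3 := (lebesgue3 : {measure set (mR * mR * mR) -> \bar R}).
Implicit Types p q : R * R * R.

(** The constant is twice [1 / (8 pi ^ 2)] because the profile is an integral over half the line. *)
Definition hK i j q : R :=
  (4 * pi ^+ 2)^-1 * heatH t i j (q.1.1 ^+ 2 + q.1.2 ^+ 2) q.2.

Let pi2 : 0 < pi ^+ 2 :> R. Proof. by rewrite exprn_gt0// pi_gt0. Qed.
Let C0 : 0 < (4 * pi ^+ 2)^-1 :> R. Proof. by rewrite invr_gt0 mulr_gt0. Qed.
Let w_ge0 (x y : R) : 0 <= x ^+ 2 + y ^+ 2. Proof. by rewrite addr_ge0 ?sqr_ge0. Qed.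

Lemma hK00_ge0 q : 0 <= hK 0 0 q.
Proof. by rewrite /hK mulr_ge0 ?heatH00_ge0// ltW. Qed.

Lemma hK_le i j q : `|hK i j q| <= (4 * pi ^+ 2)^-1 * heatM t i j.
Proof. by rewrite /hK normrM (gtr0_norm C0) ler_wpM2l ?heatH_le// ltW. Qed.

Lemma hK_continuous i j : continuous (hK i j).
Proof.
move=> q; apply: cvgMl_tmp.
have cx : (fun q : R * R * R => q.1.1) @ q --> q.1.1 by apply: cvg_comp; [exact: cvg_fst|exact: cvg_fst].
have cy : (fun q : R * R * R => q.1.2) @ q --> q.1.2 by apply: cvg_comp; [exact: cvg_fst|exact: cvg_snd].
have cz : (fun q : R * R * R => q.2) @ q --> q.2 by exact: cvg_snd.
pose W (p : R * R * R) := p.1.1 ^+ 2 + p.1.2 ^+ 2.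
have cW : W @ q --> W q.
  by rewrite /W; apply: cvgD; rewrite !expr2; under eq_fun do rewrite expr2; exact: cvgM.
apply: (@cvg_sub0 _ _ _ _ _ _ (fun=> heatH t i j (W q) q.2)); last exact: cvg_cst.
apply: norm_cvg0.
apply: (@squeeze_cvgr _ _ _ _ (fun=> 0) (fun p => heatM t i.+1 j * `|p.2 - q.2| +
   heatM t i j.+1 / 4 * `|W p - W q|)).
- apply: nearW => p; rewrite normr_ge0/= !fctE.
  exact: (heatH_lipschitz t0 i j p.2 q.2 (w_ge0 p.1.1 p.1.2) (w_ge0 q.1.1 q.1.2)).
- exact: cvg_cst.
- rewrite [X in _ --> X](_ : _ = heatM t i.+1 j * 0 + heatM t i j.+1 / 4 * 0); last by ring.
  have cn (g : R * R * R -> R) : g p @[p --> q] --> g q -> `|g p - g q| @[p --> q] --> 0.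
    move=> cg; rewrite -(normr0 R) -(subrr (g q)); apply: cvg_norm.
    by apply: cvgB => //; exact: cvg_cst.
  by apply: cvgD; apply: cvgMl_tmp; exact: cn.
Qed.

Lemma is_derive_hK i j (X Y Z X' Y' Z' : R -> R) (a : R) :
  (forall s : R, is_derive s 1 X (X' s)) -> (forall s : R, is_derive s 1 Y (Y' s)) ->
  (forall s : R, is_derive s 1 Z (Z' s)) ->
  {for a, continuous X'} -> {for a, continuous Y'} -> {for a, continuous Z'} ->
  is_derive a 1 (fun s => hK i j (X s, Y s, Z s))
    (Z' a * hK i.+1 j (X a, Y a, Z a) -
     (X a * X' a + Y a * Y' a) / 2 * hK i j.+1 (X a, Y a, Z a)).
Proof.
move=> dX dY dZ cX' cY' cZ'.
have cX : {for a, continuous X}.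
  by apply: differentiable_continuous; apply/derivable1_diffP; have [] := dX a.
have cY : {for a, continuous Y}.
  by apply: differentiable_continuous; apply/derivable1_diffP; have [] := dY a.
pose W s := X s ^+ 2 + Y s ^+ 2.
pose W' s := 2 * X s * X' s + 2 * Y s * Y' s.
have W0 s : 0 <= W s by exact: w_ge0.
have dW (s : R) : is_derive s 1 W (W' s).
  have dX2 : is_derive s 1 (X * X) (X s *: X' s + X s *: X' s) by exact: is_deriveM.
  have dY2 : is_derive s 1 (Y * Y) (Y s *: Y' s + Y s *: Y' s) by exact: is_deriveM.
  have -> : W = X * X + Y * Y by apply/funext => u; rewrite /W !fctE !expr2.
  by apply: is_derive_eq (is_deriveD dX2 dY2) _; rewrite /W' /GRing.scale/=; ring.
have cW' : {for a, continuous W'}.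
  apply: cvgD; apply: cvgM => //; apply: cvgM => //; exact: cvg_cst.
have dH := @is_derive_heatH _ _ t0 i j W Z W' Z' a W0 dW dZ cW' cZ'.
apply: is_derive_eq (is_deriveZ (4 * pi ^+ 2)^-1 dH) _.
rewrite /hK /W' /W -[_ *: _]/(_ * _) /=.
by have := lt0r_neq0 (pi_gt0 R); move: pi => P P0; field.
Qed.

Program Definition c1_hK i j : c1 (R := R) :=
  @C1 R (hK i j) (fun q => - (q.1.1 / 2) * hK i j.+1 q)
    (fun q => - (q.1.2 / 2) * hK i j.+1 q) (hK i.+1 j) _ _ _ _ _ _ _.
Next Obligation. by move=> i j; exact: hK_continuous. Qed.
Next Obligation.
move=> i j q; apply: cvgM; last exact: hK_continuous.
by apply: cvgN; apply: cvgMr_tmp; apply: cvg_comp; [exact: cvg_fst|exact: cvg_fst].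
Qed.
Next Obligation.
move=> i j q; apply: cvgM; last exact: hK_continuous.
by apply: cvgN; apply: cvgMr_tmp; apply: cvg_comp; [exact: cvg_fst|exact: cvg_snd].
Qed.
Next Obligation. by move=> i j; exact: hK_continuous. Qed.
Next Obligation.
move=> i j x y z; have := @is_derive_hK i j id (cst y) (cst z) (cst 1) (cst 0) (cst 0) x.
move=> /(_ _ _ _ _ _ _)/is_derive_eq; apply; rewrite /cst/=; last by ring.
all: exact: cvg_cst.
Qed.
Next Obligation.
move=> i j x y z; have := @is_derive_hK i j (cst x) id (cst z) (cst 0) (cst 1) (cst 0) y.
move=> /(_ _ _ _ _ _ _)/is_derive_eq; apply; rewrite /cst/=; last by ring.
all: exact: cvg_cst.
Qed.
Next Obligation.
move=> i j x y z; have := @is_derive_hK i j (cst x) (cst y) id (cst 0) (cst 0) (cst 1) z.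
move=> /(_ _ _ _ _ _ _)/is_derive_eq; apply; rewrite /cst/=; last by ring.
all: exact: cvg_cst.
Qed.

Lemma hK_pde q :
  t * ((q.1.1 ^+ 2 + q.1.2 ^+ 2) / 4 * (hK 0 2 q + hK 2 0 q) - hK 0 1 q) +
   2 * hK 0 0 q - (q.1.1 ^+ 2 + q.1.2 ^+ 2) / 4 * hK 0 1 q + q.2 * hK 1 0 q = 0.
Proof.
have := heatH_pde t0 q.2 (w_ge0 q.1.1 q.1.2).
move=> /(congr1 (fun u => (4 * pi ^+ 2)^-1 * u)); rewrite mulr0 => <-.
by rewrite /hK; ring.
Qed.

Lemma heat_kernelE q : heat_kernel t q = hK 0 0 q.
Proof.
have mD : measurable (`]0, +oo[%classic : set mR) by exact: measurable_itv.
have -> : heat_kernel t q =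
    (8 * pi ^+ 2)^-1 * \int[mu]_l complex.Re (heat_integrand t q l).
  by rewrite /heat_kernel /heat_kernelC /= mul0r subr0.
set J := Rintegral _ _ _.
have Re l : complex.Re (heat_integrand t q l) =
    cos (l * q.2) * (l / sinh (l * t)) *
    expR (- ((q.1.1 ^+ 2 + q.1.2 ^+ 2) / 4) * l * coth (l * t)).
  by rewrite /heat_integrand /expi/= !mulr0 !subr0.
have JE : J = 2 * heatH t 0 0 (q.1.1 ^+ 2 + q.1.2 ^+ 2) q.2.
  have ReE : (fun l => complex.Re (heat_integrand t q l)) =
     hint t 0 0 (q.1.1 ^+ 2 + q.1.2 ^+ 2) q.2.
    apply/funext => l; rewrite Re /hint /hm /hk /hc !expr0 mul0r addr0 !mulr1.
    have -> : - ((q.1.1 ^+ 2 + q.1.2 ^+ 2) / 4) * l * coth (l * t) =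
      - ((q.1.1 ^+ 2 + q.1.2 ^+ 2) / 4 * (l * coth (l * t))) by ring.
    by ring.
  rewrite /J Rintegral_even.
  - by rewrite ReE.
  - have mt c : measurable_fun setT (fun l : R => l * c) by exact: measurable_funM.
    have me : measurable_fun setT (fun l : R => expR (l * t)).
      exact: measurableT_comp (mt t).
    have meN : measurable_fun setT (fun l : R => expR (- (l * t))).
      by apply: measurableT_comp => //; exact: measurableT_comp (mt t).
    have msinh : measurable_fun setT (fun l : R => (sinh (l * t))^-1).
      by apply: measurable_funV; apply: measurable_funM => //; exact: measurable_funB.
    have mcoth : measurable_fun setT (fun l : R => coth (l * t)).
      apply: measurable_funM => //; apply: measurable_funM => //.
      exact: measurable_funD.
    under eq_fun do rewrite Re.
    apply: measurable_funM.
      apply: measurable_funM; last exact: measurable_funM.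
      apply: (@measurableT_comp _ _ _ _ _ _ (@cos R)); last exact: mt.
      by apply: continuous_measurable_fun; exact: continuous_cos.
    apply: measurableT_comp => //.
    by apply: measurable_funM => //; exact: measurable_funM.
  - move=> l; rewrite !Re !mulNr cosN sinhN cothN invrN.
    by rewrite !(mulrN, mulNr) !opprK.
  - by rewrite ReE; exact: intg_hint.
rewrite JE /hK.
by have := lt0r_neq0 (pi_gt0 R); move: pi => P P0; field.
Qed.

Lemma integral_gauss :
  (\int[mu]_x (expR (- (x ^+ 2 / (4 * t))))%:E = (Num.sqrt (4 * pi * t))%:E)%E.
Proof.
pose s := Num.sqrt (2 * t).
have s0 : s != 0 by rewrite gt_eqF// sqrtr_gt0 mulr_gt0.
have s2 : s ^+ 2 = 2 * t by rewrite sqr_sqrtr// mulr_ge0// ltW.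
have P0 : 0 < 4 * pi * t :> R by rewrite !mulr_gt0// pi_gt0.
have E x : expR (- (x ^+ 2 / (4 * t))) = Num.sqrt (4 * pi * t) * normal_pdf 0 s x.
  rewrite normal_pdfE// /normal_peak s2 (_ : 2 * t * pi *+ 2 = 4 * pi * t); last first.
    by rewrite -mulr_natr; ring.
  rewrite mulrA mulfV ?mul1r ?gt_eqF ?sqrtr_gt0//.
  rewrite /normal_fun subr0 s2; congr expR.
  by rewrite -mulr_natr; field; rewrite gt_eqF.
under eq_integral do rewrite E EFinM.
rewrite ge0_integralZl//.
- by rewrite integral_normal_pdf// mule1.
- by apply/measurable_EFinP; exact: measurable_normal_pdf.
- by move=> x _; rewrite lee_fin normal_pdf_ge0.
Qed.

Lemma integral_gauss2 :
  (\int[(mu \x mu)%E]_a (expR (- (a.1 ^+ 2 / (4 * t))) *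
    expR (- (a.2 ^+ 2 / (4 * t))))%:E = (4 * pi * t)%:E)%E.
Proof.
pose G (x : mR) : R := expR (- (x ^+ 2 / (4 * t))).
have mG : measurable_fun setT (EFin \o G).
  apply/measurable_EFinP; apply: measurableT_comp => //; apply: measurableT_comp => //.
  by apply: measurable_funM => //; exact: measurable_funX.
have mG2 : measurable_fun setT (fun a : mR * mR => (G a.1 * G a.2)%:E).
  apply/measurable_EFinP; apply: measurable_funM.
    by apply: (@measurableT_comp _ _ _ _ _ _ G); [exact/measurable_EFinP|exact: measurable_fst].
  by apply: (@measurableT_comp _ _ _ _ _ _ G); [exact/measurable_EFinP|exact: measurable_snd].
have G0 x : (0 <= (G x)%:E)%E by rewrite lee_fin expR_ge0.
have GE : (\int[mu]_x (EFin \o G) x = (Num.sqrt (4 * pi * t))%:E)%E by exact: integral_gauss.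
rewrite (tonelli2 mG2); last by move=> a; rewrite lee_fin mulr_ge0 ?expR_ge0.
have S0 : (0 <= (Num.sqrt (4 * pi * t))%:E :> \bar R)%E by rewrite lee_fin sqrtr_ge0.
transitivity (\int[mu]_x ((Num.sqrt (4 * pi * t))%:E * (EFin \o G) x))%E.
  apply: eq_integral => x _ /=.
  transitivity (\int[mu]_y ((G x)%:E * (EFin \o G) y))%E.
    by apply: eq_integral => y _ /=; rewrite EFinM.
  rewrite muleC -GE; apply: ge0_integralZl => //.
  by move=> y _; exact: G0.
transitivity ((Num.sqrt (4 * pi * t))%:E * (Num.sqrt (4 * pi * t))%:E)%E.
  rewrite -[X in _ = (_ * X)%E]GE; apply: ge0_integralZl => //.
  by move=> y _; exact: G0.
by rewrite -EFinM -expr2 sqr_sqrtr// !mulr_ge0// ?pi_ge0// ltW.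
Qed.

(** Integrating in [z] first leaves at most the planar Gaussian [exp (- (x ^ 2 + y ^ 2) / (4 t)) /
    (4 pi t)], whose mass is exactly [1]. *)
Lemma integral_hK00_le1 : (\int[mu3]_q (hK 0 0 q)%:E <= 1)%E.
Proof.
have cK := @hK_continuous 0 0; have mK := continuous_measurable3 cK.
have mE : measurable_fun setT (EFin \o (hK 0 0 : mR * mR * mR -> R)) by exact/measurable_EFinP.
have K0 q : (0 <= (EFin \o (hK 0 0 : mR * mR * mR -> R)) q)%E by rewrite lee_fin hK00_ge0.
rewrite (tonelli3 mE)//.
pose G (x : R) := expR (- (x ^+ 2 / (4 * t))).
have mG : measurable_fun setT (G : mR -> R).
  apply: measurableT_comp => //; apply: measurableT_comp => //.
  by apply: measurable_funM => //; exact: measurable_funX.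
have mG2 : measurable_fun setT (fun a : mR * mR => G a.1 * G a.2).
  apply: measurable_funM.
    by apply: (@measurableT_comp _ _ _ _ _ _ (G : mR -> R)); [exact: mG|exact: measurable_fst].
  by apply: (@measurableT_comp _ _ _ _ _ _ (G : mR -> R)); [exact: mG|exact: measurable_snd].
have c0 : 0 <= (4 * pi * t)^-1 :> R.
  by rewrite invr_ge0 !mulr_ge0// ?pi_ge0// ltW.
apply: (@le_trans _ _ (\int[(mu \x mu)%E]_a ((4 * pi * t)^-1 * (G a.1 * G a.2))%:E)%E).
  apply: ge0_le_integral => //.
  - by move=> a _; apply: integral_ge0 => z _; rewrite lee_fin hK00_ge0.
  - exact: (@measurable_fun_fubini_tonelli_F _ _ (mR * mR)%type mR R mu _ mE K0).
  - by apply/measurable_EFinP; exact: measurable_funM.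
  - move=> [x y] _; rewrite /= /hK/=.
    under eq_integral do rewrite EFinM.
    rewrite ge0_integralZl//; last 3 first.
    + apply/measurable_EFinP; apply: continuous_measurable_fun.
      exact: heatH00_continuous.
    + by move=> z _; rewrite lee_fin heatH00_ge0.
    + by rewrite lee_fin ltW.
    apply: (@le_trans _ _ ((4 * pi ^+ 2)^-1%:E * (pi / t * expR (- ((x ^+ 2 + y ^+ 2) / (4 * t))))%:E)%E).
      by rewrite lee_pmul2l// integral_heatH00.
    rewrite (_ : expR _ = G x * G y); last by rewrite /G -expRD -opprD -mulrDl.
    rewrite -EFinM lee_fin.
    rewrite le_eqVlt; apply/orP; left; apply/eqP.
    by have := lt0r_neq0 (pi_gt0 R); have := lt0r_neq0 t0; move: pi => P T0 P0; field; rewrite T0 P0.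
under eq_integral do rewrite EFinM.
rewrite ge0_integralZl//; last 2 first.
- by apply/measurable_EFinP.
- by move=> a _; rewrite lee_fin mulr_ge0 ?expR_ge0.
rewrite integral_gauss2 -EFinM lee_fin mulVf//.
by rewrite lt0r_neq0// !mulr_gt0// pi_gt0.
Qed.

End kernel.

(** * Fisher information of the heat kernel *)

Section cutoff.
Context {R : realType}.
Implicit Types (k s : R) (q : R * R * R).

Definition c1_para k (S : c1 (R := R)) :=
  c1_add (c1_cst 1) (c1_mul (c1_cst (- k)) (c1_mul S S)).
Definition c1_bump k (S : c1 (R := R)) := c1_mul (c1_para k S) (c1_para k S).
Definition c1_dbump k (S : c1 (R := R)) :=
  c1_mul (c1_cst (- 4 * k)) (c1_mul S (c1_para k S)).

(* With [k = r ^- 2], it vanishes to second order at [r] and [- r], which kills all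
   the boundary terms on [box r]. *)
Definition bump k s : R := (1 - k * s ^+ 2) ^+ 2.
Definition dbump k s : R := - 4 * k * s * (1 - k * s ^+ 2).
Definition ddbump k s : R := - 4 * k + 12 * k ^+ 2 * s ^+ 2.

Lemma bump_bounds k s : 0 <= k -> k * s ^+ 2 <= 1 ->
  [/\ 0 <= bump k s <= 1, `|dbump k s| <= 4 * k * `|s| & `|ddbump k s| <= 8 * k].
Proof.
move=> k0 ks1; have ks0 : 0 <= k * s ^+ 2 by rewrite mulr_ge0 ?sqr_ge0.
split.
- by rewrite /bump; apply/andP; split; [exact: sqr_ge0|rewrite exprn_ile1//; lra].
- rewrite /dbump normrM -[leRHS]mulr1; apply: ler_pM => //; last by rewrite ger0_norm; lra.
  have -> : - 4 * k * s = - (4 * k * s) by ring.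
  by rewrite normrN normrM (ger0_norm (mulr_ge0 _ k0)).
- rewrite /ddbump (_ : _ + _ = k * (12 * (k * s ^+ 2) - 4)); last by ring.
  rewrite normrM ger0_norm// mulrC ler_wpM2r// ler_norml; apply/andP; split; lra.
Qed.

(** A [c1] function carries first derivatives only, so the partial derivatives of [cutoff] are built
    again as [c1] functions in order to be differentiated once more. *)
Definition cutoff k := c1_mul (c1_mul (c1_bump k c1_X) (c1_bump k c1_Y)) (c1_bump k c1_Z).
Definition cutoff_x k := c1_mul (c1_mul (c1_dbump k c1_X) (c1_bump k c1_Y)) (c1_bump k c1_Z).
Definition cutoff_y k := c1_mul (c1_mul (c1_bump k c1_X) (c1_dbump k c1_Y)) (c1_bump k c1_Z).
Definition cutoff_z k := c1_mul (c1_mul (c1_bump k c1_X) (c1_bump k c1_Y)) (c1_dbump k c1_Z).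

Lemma cutoffE k q : cutoff k q = bump k q.1.1 * bump k q.1.2 * bump k q.2.
Proof. by rewrite /= /bump; ring. Qed.

Lemma cutoff_dx k q : c1x (cutoff k) q = cutoff_x k q.
Proof. by rewrite /=; ring. Qed.

Lemma cutoff_dy k q : c1y (cutoff k) q = cutoff_y k q.
Proof. by rewrite /=; ring. Qed.

Lemma cutoff_dz k q : c1z (cutoff k) q = cutoff_z k q.
Proof. by rewrite /=; ring. Qed.

Lemma para_box r s : 0 < r -> `|s| <= r -> r ^- 2 * s ^+ 2 <= 1.
Proof.
move=> r0 sr; rewrite mulrC ler_pdivrMr ?exprn_gt0// mul1r.
by rewrite -[s ^+ 2]real_normK ?num_real// lerXn2r ?nnegrE// ltW.
Qed.

Lemma cutoff_face r q : 0 < r ->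
  [\/ `|q.1.1| = r, `|q.1.2| = r | `|q.2| = r] ->
  [/\ cutoff (r ^- 2) q = 0, cutoff_x (r ^- 2) q = 0,
      cutoff_y (r ^- 2) q = 0 & cutoff_z (r ^- 2) q = 0].
Proof.
move=> r0 h; rewrite /cutoff /cutoff_x /cutoff_y /cutoff_z /=.
have z s : `|s| = r -> 1 + - r ^- 2 * (s * s) = 0.
  move=> sr; rewrite -expr2 -[s ^+ 2]real_normK ?num_real// sr mulNr mulVf ?subrr//.
  by rewrite expf_neq0// gt_eqF.
by case: h => /z ->; rewrite !(mul0r, mulr0).
Qed.

End cutoff.

(** * The Fisher information density as a divergence *)

Section divergence.
Context {R : realType} (t e k : R).
Hypotheses (t0 : 0 < t) (e0 : 0 < e).
Implicit Types q : R * R * R.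

Notation p := (c1_hK t0 0 0).

Lemma is_derive_ln_hK q : is_derive (p q : R) 1 (fun s : R => ln (s + e) - ln e) (p q + e)^-1.
Proof.
have pe : 0 < p q + e by rewrite ltr_wpDl// hK00_ge0.
have d1 : is_derive (p q : R) 1 (fun s : R => s + e) 1.
  by apply: is_derive_eq (is_deriveD (is_derive_id _ _) (is_derive_cst _ _ _)) _; rewrite addr0.
have d2 := @is_derive1_comp R (@ln R) (fun s => s + e) _ _ _ (is_derive1_ln pe) d1.
apply: is_derive_eq (is_deriveB d2 (is_derive_cst _ _ _)) _.
by rewrite mulr1 subr0.
Qed.

Lemma continuous_inv_hK q : {for (p q : R), continuous (fun s => (s + e)^-1)}.
Proof.
have pe : p q + e != 0 by rewrite gt_eqF// ltr_wpDl// hK00_ge0.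
by apply: cvgV => //; apply: cvgD; [exact: cvg_id|exact: cvg_cst].
Qed.

(** The regularised logarithm [ln (1 + p / e)]; the constant [ln e] makes it vanish where [p]
    does. *)
Definition c1_psi := @c1_comp R (fun s : R => ln (s + e) - ln e) (fun s => (s + e)^-1) p
  is_derive_ln_hK continuous_inv_hK.

(* As a function of [p], [c1_U] is the primitive of [c1_psi] vanishing at [0]. *)
Definition c1_U := c1_add (c1_mul (c1_add p (c1_cst e)) c1_psi) (c1_mul (c1_cst (- 1)) p).

(** The fields [X] and [Y] on a function given by its partial derivatives: [f] is the one in [x] or
    [y], [g] the one in [z]. *)
Definition lX (f g : c1 (R := R)) := c1_add f (c1_mul (c1_cst (- 2^-1)) (c1_mul c1_Y g)).
Definition lY (f g : c1 (R := R)) := c1_add f (c1_mul (c1_cst 2^-1) (c1_mul c1_X g)).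

Definition XC := lX (cutoff_x k) (cutoff_z k).
Definition YC := lY (cutoff_y k) (cutoff_z k).

(** [XK] and [YK] are [X p] and [Y p]. *)
Definition XK : c1 (R := R) :=
  c1_mul (c1_cst (- 2^-1)) (c1_add (c1_mul c1_X (c1_hK t0 0 1)) (c1_mul c1_Y (c1_hK t0 1 0))).
Definition YK : c1 (R := R) :=
  c1_mul (c1_cst 2^-1) (c1_add (c1_mul c1_X (c1_hK t0 1 0)) (c1_mul (c1_cst (- 1)) (c1_mul c1_Y (c1_hK t0 0 1)))).

(** As [c1_psi] is the derivative of [c1_U] in [p], the second term cancels the products of first
    derivatives of [p] and of the cutoff [C]; the horizontal divergence is [C Gamma(p, p) / (p + e)
    + C psi L p - U L C]. The coordinates of this flux plus [C U / (2 t)] times the dilation field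
    [(x, y, 2 z)] are [W1], [W2] and [W3]. *)
Definition flux1 := c1_add (c1_mul (c1_mul (cutoff k) c1_psi) XK) (c1_mul (c1_cst (- 1)) (c1_mul c1_U XC)).
Definition flux2 := c1_add (c1_mul (c1_mul (cutoff k) c1_psi) YK) (c1_mul (c1_cst (- 1)) (c1_mul c1_U YC)).
Definition W1 := c1_add flux1 (c1_mul (c1_cst (2 * t)^-1) (c1_mul c1_X (c1_mul (cutoff k) c1_U))).
Definition W2 := c1_add flux2 (c1_mul (c1_cst (2 * t)^-1) (c1_mul c1_Y (c1_mul (cutoff k) c1_U))).
Definition W3 := c1_add (c1_add (c1_mul (c1_cst (- 2^-1)) (c1_mul c1_Y flux1))
    (c1_mul (c1_cst 2^-1) (c1_mul c1_X flux2)))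
  (c1_mul (c1_cst t^-1) (c1_mul c1_Z (c1_mul (cutoff k) c1_U))).

Definition Lcut q : R := c1x XC q - q.1.2 / 2 * c1z XC q + c1y YC q + q.1.1 / 2 * c1z YC q.
Definition Dcut q : R := q.1.1 * cutoff_x k q + q.1.2 * cutoff_y k q + 2 * q.2 * cutoff_z k q.

(* Combines the heat equation, in the form [L p + D p / (2 * t) = - 2 / t * p] with
   [D] the generator of the dilations, with the entropy function of [p]. *)
Lemma flux_identity q :
  cutoff k q * (XK q ^+ 2 + YK q ^+ 2) / (p q + e) =
  c1x W1 q + c1y W2 q + c1z W3 q + c1_U q * (Lcut q - Dcut q / (2 * t)) +
  2 / t * (cutoff k q * (c1_psi q * p q - c1_U q)).
Proof.
have pe : hK t 0 0 q + e != 0 by rewrite gt_eqF// ltr_wpDl// hK00_ge0.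
have pde := hK_pde t0 q.
have hx := cutoff_dx k q; have hy := cutoff_dy k q; have hz := cutoff_dz k q.
rewrite /W1 /W2 /W3 /flux1 /flux2 /Lcut /Dcut.
move: hx hy hz; rewrite /XC /YC /lX /lY.
move: (cutoff k) (cutoff_x k) (cutoff_y k) (cutoff_z k) => C Cx Cy Cz hx hy hz.
have tn := lt0r_neq0 t0.
apply/eqP; rewrite -subr_eq0; apply/eqP.
(* [hK_pde] is the heat equation times [t], hence the weight [- (C psi) / t]; what remains is an
   identity of rational functions. *)
rewrite -[RHS](mulr0 (- (C q * c1_psi q) / t)) -[in RHS]pde.
rewrite /= hx hy hz.
move: (hK t 0 0 q) (hK t 0 1 q) (hK t 1 0 q) (hK t 1 1 q) (hK t 0 2 q) (hK t 2 0 q) pe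
  => K00 K01 K10 K11 K02 K20 pe.
move: (ln (K00 + e) - ln e) => L.
move: (C q) (Cx q) (Cy q) (Cz q) => A Ax Ay Az.
move: (c1x Cx q) (c1x Cz q) (c1y Cy q) (c1y Cz q) (c1z Cx q) (c1z Cy q) (c1z Cz q) => a1 a2 a3 a4 a5 a6 a7.
move: (q.1.1) (q.1.2) (q.2) => x y z.
by field; rewrite tn pe.
Qed.

Lemma c1_psi_bounds q : 0 <= c1_psi q <= p q / e.
Proof.
have p0 := hK00_ge0 t0 q; have pe : 0 < hK t 0 0 q + e by rewrite ltr_wpDl.
apply/andP; split; first by rewrite /= subr_ge0 ler_ln ?posrE// lerDr.
rewrite /= -ln_div ?posrE//.
rewrite (_ : _ / e = 1 + hK t 0 0 q / e); last by field; rewrite gt_eqF.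
by apply: le_ln1Dx; rewrite (lt_le_trans (ltrN10 _))// divr_ge0// ltW.
Qed.

(** Both bounds come from [ln (1 + x) <= x], at [x = p / e] for the upper one and at
    [x = - p / (p + e)] for the lower one. The upper one is quadratic in [p], hence integrable since
    [p] is bounded and integrable. *)
Lemma c1_U_bounds q : 0 <= c1_U q <= p q ^+ 2 / e.
Proof.
have p0 := hK00_ge0 t0 q; have pe : 0 < hK t 0 0 q + e by rewrite ltr_wpDl.
have /andP[s0 s1] := c1_psi_bounds q.
have -> : c1_U q = (p q + e) * c1_psi q - p q by rewrite /=; ring.
apply/andP; split; last first.
  have -> : p q ^+ 2 / e = (p q + e) * (p q / e) - p q by rewrite /=; field; rewrite gt_eqF.
  by rewrite lerB// ler_wpM2l// ltW.
have : - ln (e / (hK t 0 0 q + e)) >= hK t 0 0 q / (hK t 0 0 q + e).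
  rewrite lerNr (_ : e / _ = 1 + - (hK t 0 0 q / (hK t 0 0 q + e))); last first.
    by field; rewrite gt_eqF.
  apply: le_ln1Dx; rewrite ltrN2 ltr_pdivrMr// mul1r ltrDl//.
rewrite ln_div ?posrE// opprB => h.
by rewrite subr_ge0 /= -ler_pdivrMl// mulrC.
Qed.

(** [psi p - U = p - e psi] is what is left when the dilation term and the heat equation are
    combined; bounding it by [p] brings the mass into the bound [2 / t]. *)
Lemma psi_U_le q : 0 <= c1_psi q * p q - c1_U q <= p q.
Proof.
have p0 := hK00_ge0 t0 q.
have /andP[s0 s1] := c1_psi_bounds q.
have -> : c1_psi q * p q - c1_U q = p q - e * c1_psi q by rewrite /=; ring.
rewrite gerBl mulr_ge0 ?(ltW e0)// andbT subr_ge0.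
by rewrite -ler_pdivlMl// mulrC.
Qed.

Definition cut_error q : R := Lcut q - Dcut q / (2 * t).

Lemma cut_errorE q : cut_error q =
  let x := q.1.1 in let y := q.1.2 in let z := q.2 in
  ddbump k x * bump k y * bump k z + bump k x * ddbump k y * bump k z +
  (x ^+ 2 + y ^+ 2) / 4 * (bump k x * bump k y * ddbump k z) +
  (- y * (dbump k x * bump k y * dbump k z) + x * (bump k x * dbump k y * dbump k z)) -
  (x * (dbump k x * bump k y * bump k z) + y * (bump k x * dbump k y * bump k z) +
    2 * z * (bump k x * bump k y * dbump k z)) / (2 * t).
Proof.
rewrite /cut_error /Lcut /Dcut /= /bump /dbump /ddbump.
by field; rewrite gt_eqF.
Qed.

Let norm_prod3 (a b c A B C : R) : `|a| <= A -> `|b| <= B -> `|c| <= C ->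
  `|a * b * c| <= A * B * C.
Proof. by move=> aA bB cC; rewrite !normrM ler_pM// ?mulr_ge0// ler_pM. Qed.

(** At a fixed point every term tends to [0] with [k], and on the box all of them stay bounded: the
    two halves of a dominated convergence argument. *)
Lemma cut_error_le q : 0 <= k ->
  [/\ k * q.1.1 ^+ 2 <= 1, k * q.1.2 ^+ 2 <= 1 & k * q.2 ^+ 2 <= 1] ->
  `|cut_error q| <= 16 * k + 2 * (k * q.1.1 ^+ 2 + k * q.1.2 ^+ 2) +
    32 * (k ^+ 2 * `|q.1.1 * q.1.2 * q.2|) +
    (4 * (k * q.1.1 ^+ 2) + 4 * (k * q.1.2 ^+ 2) + 8 * (k * q.2 ^+ 2)) / (2 * t).
Proof.
move: q => [[x y] z] k0 /= [kx ky kz].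
have [/andP[ax0 ax1] dx ddx] := bump_bounds k0 kx.
have [/andP[ay0 ay1] dy ddy] := bump_bounds k0 ky.
have [/andP[az0 az1] dz ddz] := bump_bounds k0 kz.
have ax : `|bump k x| <= 1 by rewrite ger0_norm.
have ay : `|bump k y| <= 1 by rewrite ger0_norm.
have az : `|bump k z| <= 1 by rewrite ger0_norm.
rewrite cut_errorE /=.
have n2 (s : R) : s ^+ 2 = `|s| * `|s| by rewrite -expr2 real_normK ?num_real.
have xy0 : 0 <= (x ^+ 2 + y ^+ 2) / 4 by rewrite divr_ge0// addr_ge0 ?sqr_ge0.
have t2 : 0 <= (2 * t)^-1 by rewrite invr_ge0 mulr_ge0// ltW.
have b1 := norm_prod3 ddx ay az; have b2 := norm_prod3 ax ddy az.
have b3 := norm_prod3 ax ay ddz; have b4 := norm_prod3 dx ay dz.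
have b5 := norm_prod3 ax dy dz; have b6 := norm_prod3 dx ay az.
have b7 := norm_prod3 ax dy az; have b8 := norm_prod3 ax ay dz.
rewrite (le_trans (ler_normB _ _))//; apply: lerD; last first.
  rewrite normrM (ger0_norm t2) ler_wpM2r//.
  rewrite (le_trans (ler_normD _ _))//; apply: lerD.
    rewrite (le_trans (ler_normD _ _))//; apply: lerD.
      rewrite normrM (le_trans (ler_wpM2l (normr_ge0 _) b6))// (n2 x).
      by rewrite le_eqVlt; apply/orP; left; apply/eqP; ring.
    rewrite normrM (le_trans (ler_wpM2l (normr_ge0 _) b7))// (n2 y).
    by rewrite le_eqVlt; apply/orP; left; apply/eqP; ring.
  rewrite 2!normrM (ger0_norm (_ : 0 <= 2 :> R))//.
  rewrite (le_trans (ler_wpM2l _ b8))// ?mulr_ge0// (n2 z).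
  by rewrite le_eqVlt; apply/orP; left; apply/eqP; ring.
rewrite (le_trans (ler_normD _ _))//; apply: lerD; last first.
  rewrite (le_trans (ler_normD _ _))// (normrM (- y)) (normrM x) normrN.
  apply: (le_trans (lerD (ler_wpM2l (normr_ge0 y) b4) (ler_wpM2l (normr_ge0 x) b5))).
  by rewrite !normrM le_eqVlt; apply/orP; left; apply/eqP; ring.
rewrite (le_trans (ler_normD _ _))//; apply: lerD; last first.
  rewrite normrM (ger0_norm xy0) (le_trans (ler_wpM2l xy0 b3))//.
  by rewrite le_eqVlt; apply/orP; left; apply/eqP; field.
rewrite (le_trans (ler_normD _ _))// (le_trans (lerD b1 b2))//.
by rewrite le_eqVlt; apply/orP; left; apply/eqP; ring.
Qed.

(** With each [k s ^ 2] at most [1], the constants add up to [16 + 4 + 32] and to [16 / (2 t)]. *)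
Lemma cut_error_bounded q : 0 <= k <= 1 ->
  [/\ k * q.1.1 ^+ 2 <= 1, k * q.1.2 ^+ 2 <= 1 & k * q.2 ^+ 2 <= 1] ->
  `|cut_error q| <= 52 + 8 / t.
Proof.
move=> /andP[k0 k1] h; rewrite (le_trans (cut_error_le k0 h))//.
case: h => kx ky kz.
have k3 : k ^+ 2 * `|q.1.1 * q.1.2 * q.2| <= 1.
  rewrite normrM; set A := `|q.1.1 * q.1.2|; set B := `|q.2|.
  have A1 : (k * A) ^+ 2 <= 1.
    rewrite exprMn real_normK ?num_real// exprMn (_ : _ * _ = (k * q.1.1 ^+ 2) * (k * q.1.2 ^+ 2)); last by ring.
    by rewrite -[leRHS]mulr1 ler_pM// mulr_ge0// sqr_ge0.
  have B1 : k * B ^+ 2 <= 1 by rewrite real_normK ?num_real.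
  (* Expanding this square gives [2 k ^ 2 A B <= k (k A) ^ 2 + k B ^ 2], which controls the mixed
     term. *)
  have : 0 <= k * (k * A - B) ^+ 2 by rewrite mulr_ge0// sqr_ge0.
  have : k * (k * A) ^+ 2 <= 1 by rewrite -[leRHS]mulr1 ler_pM// sqr_ge0.
  nra.
have T0 : 0 < t^-1 by rewrite invr_gt0.
apply: lerD; first by lra.
rewrite [leRHS](_ : _ = 16 / (2 * t)); last by field; rewrite gt_eqF.
by rewrite ler_wpM2r//; [rewrite invr_ge0 mulr_ge0// ltW|lra].
Qed.

End divergence.

(** * Fatou's lemma and exhaustion by boxes *)

Lemma le_limn_einf {R : realType} (u v : (\bar R)^nat) :
  (forall n, u n <= v n)%E -> (limn_einf u <= limn_einf v)%E.
Proof.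
move=> uv; rewrite !limn_einf_lim; apply: lee_lim; [exact: is_cvg_einfs|exact: is_cvg_einfs|].
apply: nearW => n; apply: le_ereal_inf_tmp => _ [k /= nk <-].
by apply: le_trans (uv k); apply: ereal_inf_lbound; exists k.
Qed.

Section fatou.
Context d (T : measurableType d) (R : realType) (mu : {measure set T -> \bar R}).

Lemma integral_le_of_cvg (f_ : nat -> T -> R) (f : T -> R) (u : nat -> R) (l : R) :
  (forall n, measurable_fun setT (f_ n)) -> (forall n x, 0 <= f_ n x) ->
  (forall x, f_ n x @[n --> \oo] --> f x) ->
  (forall n, \int[mu]_x (f_ n x)%:E <= (u n)%:E)%E -> u n @[n --> \oo] --> l ->
  (\int[mu]_x (f x)%:E <= l%:E)%E.
Proof.
move=> mf f0 ff fu ul.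
have fE x : (f x)%:E = limn_einf (fun n => (f_ n x)%:E).
  have c : (f_ n x)%:E @[n --> \oo] --> (f x)%:E by apply: cvg_EFin; [exact: nearW|exact: ff].
  rewrite is_cvg_limn_einfE; first by apply/esym/cvg_lim.
  by apply/cvg_ex; eexists; exact: c.
under eq_integral do rewrite fE.
apply: (le_trans (fatou _ _ _ _)) => //.
- by move=> n; exact/measurable_EFinP.
- by move=> n x _; rewrite lee_fin.
have c : (u n)%:E @[n --> \oo] --> l%:E by apply: cvg_EFin; [exact: nearW|exact: ul].
have <- : limn_einf (fun n => (u n)%:E) = l%:E.
  rewrite is_cvg_limn_einfE; first exact/cvg_lim.
  by apply/cvg_ex; eexists; exact: c.
exact: le_limn_einf.
Qed.

End fatou.

Lemma continuous_sqr {R : realType} (g : R * R * R -> R) :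
  continuous g -> continuous (fun q => g q ^+ 2).
Proof.
move=> cg; have -> : (fun x => g x ^+ 2) = (fun x => g x * g x).
  by apply/funext => x; rewrite expr2.
by move=> q; apply: cvgM; exact: cg.
Qed.

Section exhaustion.
Context {R : realType}.
Notation mR := (measurableTypeR R).
Notation mu3 := (lebesgue3 : {measure set (mR * mR * mR) -> \bar R}).
Implicit Types q : R * R * R.

Lemma cutoff_ge0 k q : 0 <= cutoff k q.
Proof.
rewrite cutoffE /bump; do 2 (apply: mulr_ge0; last exact: sqr_ge0).
exact: sqr_ge0.
Qed.

Lemma cutoff_le1 r q : 0 < r -> box r q -> cutoff (r ^- 2) q <= 1.
Proof.
move=> r0 /boxP[x1 x2 x3]; rewrite cutoffE.
have k0 : 0 <= r ^- 2 by rewrite invr_ge0 exprn_ge0// ltW.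
have [/andP[a0 a1] _ _] := bump_bounds k0 (para_box r0 x1).
have [/andP[b0 b1] _ _] := bump_bounds k0 (para_box r0 x2).
have [/andP[c0 c1] _ _] := bump_bounds k0 (para_box r0 x3).
by apply: mulr_ile1 => //; [exact: mulr_ge0|exact: mulr_ile1].
Qed.

Lemma cvg_inv_sqr_succ : n.+1%:R ^- 2 @[n --> \oo] --> (0 : R).
Proof.
have -> : (fun n => n.+1%:R ^- 2 : R) = (fun n => n.+1%:R^-1 * n.+1%:R^-1) by apply/funext => n; rewrite expr2 invfM.
by rewrite -[X in _ --> X](mulr0 0); apply: cvgM; exact: cvg_harmonic.
Qed.

Let k_ n : R := n.+1%:R ^- 2.

Lemma cutoff_cvg q : cutoff (k_ n) q @[n --> \oo] --> (1 : R).
Proof.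
have cb s : bump (k_ n) s @[n --> \oo] --> (1 : R).
  have h : 1 - k_ n * s ^+ 2 @[n --> \oo] --> (1 - 0 * s ^+ 2 : R).
    by apply: cvgB; [exact: cvg_cst|apply: cvgMr_tmp; exact: cvg_inv_sqr_succ].
  have -> : 1 = (1 - 0 * s ^+ 2) * (1 - 0 * s ^+ 2) :> R by ring.
  have -> : (fun n => bump (k_ n) s) = (fun n => (1 - k_ n * s ^+ 2) * (1 - k_ n * s ^+ 2)).
    by apply/funext => n; rewrite /bump expr2.
  exact: cvgM.
have -> : (fun n => cutoff (k_ n) q) =
    (fun n => bump (k_ n) q.1.1 * bump (k_ n) q.1.2 * bump (k_ n) q.2).
  by apply/funext => n; rewrite cutoffE.
have -> : 1 = 1 * 1 * 1 :> R by rewrite !mulr1.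
by apply: cvgM; [apply: cvgM|].
Qed.

Lemma box_near q : \forall n \near \oo, box (n.+1%:R : R) q.
Proof.
have h (s : R) : \forall n \near \oo, `|s| <= (n.+1%:R : R).
  near=> n; rewrite (le_trans (y := n%:R))// ?ler_nat//.
  near: n; exact: nbhs_infty_ger.
near=> n; apply/boxP; split; near: n; exact: h.
Unshelve. all: by end_near. Qed.

Lemma cvg_box_integral (f_ : nat -> R * R * R -> R) (f G : R * R * R -> R) :
  (forall n, continuous (f_ n)) -> (forall q, f_ n q @[n --> \oo] --> f q) ->
  mu3.-integrable setT (EFin \o G) ->
  (forall n q, box (n.+1%:R : R) q -> `|f_ n q| <= G q) ->
  \int[mu3]_(q in box (n.+1%:R : R)) f_ n q @[n --> \oo] --> \int[mu3]_q f q.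
Proof.
move=> cf ff iG fG.
have G0 q : 0 <= G q.
  have [n _ /(_ n (leqnn n)) Bq] := box_near q.
  by apply: le_trans (fG n q Bq).
pose F n := (f_ n : mR * mR * mR -> R) \_ (box (n.+1%:R : R)).
have [||||_] := @Rdominated_cvg _ _ _ mu3 setT measurableT F f G.
- move=> n; apply/(measurable_restrictT _ (measurable_box _))/measurable_funTS.
  exact: continuous_measurable3.
- move=> q _; apply: cvg_trans (ff q).
  apply: near_eq_cvg; near=> n; rewrite /F patchE mem_set//.
  by near: n; exact: box_near.
- exact: iG.
- move=> n q _; rewrite /F patchE; case: ifPn => [|_]; last by rewrite normr0.
  by rewrite inE; exact: fG.
have -> // : (fun n => \int[mu3]_x F n x) = (fun n => \int[mu3]_(q in box (n.+1%:R : R)) f_ n q).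
by apply/funext => n; rewrite [RHS]Rintegral_mkcond.
Unshelve. all: by end_near. Qed.

End exhaustion.

(** * The bound on the trace *)

Section fisher.
Context {R : realType} (t e : R).
Hypotheses (t0 : 0 < t) (e0 : 0 < e).
Notation mR := (measurableTypeR R).
Notation mu3 := (lebesgue3 : {measure set (mR * mR * mR) -> \bar R}).
Notation p := (c1_hK t0 0 0).
Implicit Types q : R * R * R.

Lemma intg_hK00 : mu3.-integrable setT (EFin \o (p : _ -> R)).
Proof.
apply/integrableP; split.
  by apply/measurable_EFinP; exact: (continuous_measurable3 (@hK_continuous R t t0 0 0)).
rewrite (eq_integral (fun q : mR * mR * mR => (hK t 0 0 q)%:E)).
  by rewrite (le_lt_trans (integral_hK00_le1 t0))// ltry.
by move=> q _; rewrite /= ger0_norm// hK00_ge0.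
Qed.

Lemma Rintegral_hK00_le1 (D : set (mR * mR * mR)) : measurable D ->
  \int[mu3]_(q in D) p q <= 1.
Proof.
move=> mD; apply: (le_trans (le_Rintegral_subset mD intg_hK00 (hK00_ge0 t0))).
rewrite -[leRHS]/(fine 1%E) /Rintegral fine_le//; last exact: integral_hK00_le1.
by apply: integrable_fin_num => //; exact: intg_hK00.
Qed.

Definition fisher_density q : R := (XK t0 q ^+ 2 + YK t0 q ^+ 2) / (p q + e).

Lemma fisher_density_ge0 q : 0 <= fisher_density q.
Proof. by rewrite /fisher_density divr_ge0 ?addr_ge0 ?sqr_ge0 ?hK00_ge0 ?ltW. Qed.

Lemma div_hK00_continuous (g : R * R * R -> R) : continuous g ->
  continuous (fun q => g q / (p q + e)).
Proof.
move=> cg q; apply: cvgM; first exact: cg.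
apply: cvgV; first by rewrite gt_eqF// ltr_wpDl// hK00_ge0.
by apply: cvgD; [exact: c1v_cont|exact: cvg_cst].
Qed.

Lemma fisher_density_continuous : continuous fisher_density.
Proof.
apply: div_hK00_continuous => q.
by apply: cvgD; apply: continuous_sqr; exact: c1v_cont.
Qed.

Lemma cut_error_continuous k : continuous (cut_error t k).
Proof.
have -> : cut_error t k = fun q =>
    c1x (XC k) q + c1_mul (c1_cst (- 2^-1)) c1_Y q * c1z (XC k) q + c1y (YC k) q +
    c1_mul (c1_cst 2^-1) c1_X q * c1z (YC k) q + - (2 * t)^-1 *
    (c1_mul c1_X (cutoff_x k) q + c1_mul c1_Y (cutoff_y k) q +
     c1_mul (c1_cst 2) (c1_mul c1_Z (cutoff_z k)) q).
  apply/funext => q; rewrite /cut_error /Lcut /Dcut.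
  move: (XC k) (YC k) (cutoff_x k) (cutoff_y k) (cutoff_z k) => *.
  by rewrite /=; field; rewrite gt_eqF.
move=> q; apply: cvgD; [apply: cvgD; [apply: cvgD; [apply: cvgD|]|]|].
- exact: c1x_cont.
- by apply: cvgM; [exact: c1v_cont|exact: c1z_cont].
- exact: c1y_cont.
- by apply: cvgM; [exact: c1v_cont|exact: c1z_cont].
- by apply: cvgMl_tmp; do 2 (apply: cvgD; last exact: c1v_cont); exact: c1v_cont.
Qed.

Lemma flux_face r q : 0 < r ->
  [\/ `|q.1.1| = r, `|q.1.2| = r | `|q.2| = r] ->
  [/\ W1 (r ^- 2) t0 e0 q = 0, W2 (r ^- 2) t0 e0 q = 0 & W3 (r ^- 2) t0 e0 q = 0].
Proof.
move=> r0 h; have [] := cutoff_face r0 h.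
rewrite /W1 /W2 /W3 /flux1 /flux2 /XC /YC /lX /lY.
move: (cutoff _) (cutoff_x _) (cutoff_y _) (cutoff_z _) => C Cx Cy Cz.
by rewrite /= => -> -> -> ->; rewrite !(mul0r, mulr0, addr0).
Qed.

(** The three derivatives in the flux identity integrate to [0], the fluxes vanishing on the faces;
    the excess [psi p - U] contributes at most [2 / t] times the mass. *)
Lemma integral_fisher_box r : 1 <= r ->
  \int[mu3]_(q in box r) (cutoff (r ^- 2) q * fisher_density q) <=
  \int[mu3]_(q in box r) (c1_U t0 e0 q * `|cut_error t (r ^- 2) q|) + 2 / t.
Proof.
move=> r1; have r0 : 0 < r by rewrite (lt_le_trans ltr01).
have mB := measurable_box r.
set k := r ^- 2.
have Nr : `|- r| = r by rewrite normrN gtr0_norm.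
have rr : `|r| = r by rewrite gtr0_norm.
have w1 : \int[mu3]_(q in box r) c1x (W1 k t0 e0) q = 0.
  apply: integral_c1x => [|y z]; first exact: r0.
  have [-> _ _] := @flux_face r (r, y, z) r0 (Or31 _ _ rr).
  by have [-> _ _] := @flux_face r (- r, y, z) r0 (Or31 _ _ Nr).
have w2 : \int[mu3]_(q in box r) c1y (W2 k t0 e0) q = 0.
  apply: integral_c1y => [|x z]; first exact: r0.
  have [_ -> _] := @flux_face r (x, r, z) r0 (Or32 _ _ rr).
  by have [_ -> _] := @flux_face r (x, - r, z) r0 (Or32 _ _ Nr).
have w3 : \int[mu3]_(q in box r) c1z (W3 k t0 e0) q = 0.
  apply: integral_c1z => [|x y]; first exact: r0.
  have [_ _ ->] := @flux_face r (x, y, r) r0 (Or33 _ _ rr).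
  by have [_ _ ->] := @flux_face r (x, y, - r) r0 (Or33 _ _ Nr).
have i1 : mu3.-integrable (box r) (EFin \o c1x (W1 k t0 e0)).
  by apply: intg_box; exact: c1x_cont.
have i2 : mu3.-integrable (box r) (EFin \o c1y (W2 k t0 e0)).
  by apply: intg_box; exact: c1y_cont.
have i3 : mu3.-integrable (box r) (EFin \o c1z (W3 k t0 e0)).
  by apply: intg_box; exact: c1z_cont.
have iU : mu3.-integrable (box r) (EFin \o (fun q => c1_U t0 e0 q * `|cut_error t k q|)).
  apply: intg_box => q; apply: cvgM; first exact: c1v_cont.
  by apply: cvg_norm; exact: cut_error_continuous.
have ip : mu3.-integrable (box r) (EFin \o (p : _ -> R)).
  by apply: integrableS intg_hK00.
have ip2 := intgZ mB (2 / t) ip.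
have iC : mu3.-integrable (box r) (EFin \o (fun q => cutoff k q * fisher_density q)).
  apply: intg_box => q; apply: cvgM; first exact: c1v_cont.
  exact: fisher_density_continuous.
have i4 := intgD mB iU ip2; have i5 := intgD mB i3 i4.
have i6 := intgD mB i2 i5; have i7 := intgD mB i1 i6.
apply: (le_trans (le_Rintegral mB iC i7 _)).
  move=> q Bq; rewrite /fisher_density mulrA (flux_identity k t0 e0 q).
  rewrite [leRHS](_ : _ = c1x (W1 k t0 e0) q + c1y (W2 k t0 e0) q + c1z (W3 k t0 e0) q +
    c1_U t0 e0 q * `|cut_error t k q| + 2 / t * p q); last by ring.
  apply: lerD; first apply: lerD; first exact: lexx.
    have /andP[U0 _] := c1_U_bounds t0 e0 q.
    exact: (ler_wpM2l U0 (ler_norm (cut_error t k q))).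
  apply: ler_wpM2l; first by rewrite divr_ge0// ltW.
  have /andP[h0 h1] := psi_U_le t0 e0 q.
  exact: (le_trans (ler_piMl h0 (cutoff_le1 r0 Bq)) h1).
rewrite (RintegralD mB i1 i6) (RintegralD mB i2 i5) (RintegralD mB i3 i4).
rewrite w1 w2 w3 !add0r (RintegralD mB iU ip2) lerD2l.
rewrite (RintegralZl _ mB ip) -[leRHS]mulr1.
apply: ler_wpM2l; first by rewrite divr_ge0// ltW.
exact: Rintegral_hK00_le1 mB.
Qed.

Let k_ n : R := n.+1%:R ^- 2.

Lemma cut_error_cvg q : cut_error t (k_ n) q @[n --> \oo] --> (0 : R).
Proof.
pose B := 16 + 2 * (q.1.1 ^+ 2 + q.1.2 ^+ 2) + 32 * `|q.1.1 * q.1.2 * q.2| +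
    (4 * q.1.1 ^+ 2 + 4 * q.1.2 ^+ 2 + 8 * q.2 ^+ 2) / (2 * t).
apply: norm_cvg0; apply: (@squeeze_cvgr _ _ _ _ (fun=> 0) (fun n => k_ n * B)).
- near=> n; rewrite normr_ge0/=.
  have r0 : 0 < n.+1%:R :> R by [].
  have k0 : 0 <= k_ n by rewrite /k_ invr_ge0 exprn_ge0.
  have k1 : k_ n <= 1 by rewrite /k_ invf_le1 ?exprn_gt0// exprn_ege1// ler1n.
  have /boxP[x1 x2 x3] : box (n.+1%:R : R) q by near: n; exact: box_near.
  apply: (le_trans (cut_error_le t0 k0 _)).
    by split; exact: para_box.
  rewrite (_ : k_ n * B = 16 * k_ n + 2 * (k_ n * q.1.1 ^+ 2 + k_ n * q.1.2 ^+ 2) +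
    32 * (k_ n * `|q.1.1 * q.1.2 * q.2|) +
    (4 * (k_ n * q.1.1 ^+ 2) + 4 * (k_ n * q.1.2 ^+ 2) + 8 * (k_ n * q.2 ^+ 2)) / (2 * t)).
    by rewrite lerD2r lerD2l ler_wpM2l// ler_wpM2r// expr2 ler_piMl.
  by rewrite /B; field; rewrite gt_eqF.
- exact: cvg_cst.
- by rewrite -(mul0r B); apply: cvgMr_tmp; exact: cvg_inv_sqr_succ.
Unshelve. all: by end_near. Qed.

Lemma cvg_error_integral :
  \int[mu3]_(q in box (n.+1%:R)) (c1_U t0 e0 q * `|cut_error t (k_ n) q|)
    @[n --> \oo] --> (0 : R).
Proof.
(* [U <= p ^ 2 / e] is at most [p] times a uniform bound of [p] divided by [e]; the uniform bound of
   the cutoff error gives the last factor. *)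
pose M := (4 * pi ^+ 2)^-1 * heatM t 0 0 / e * (52 + 8 / t).
have iM : mu3.-integrable setT (EFin \o (fun q => M * p q)) by exact: intgZ intg_hK00.
have -> : (0 : R) = \int[mu3]_q (fun=> 0 : R) q by rewrite /Rintegral integral0.
apply: (cvg_box_integral _ _ iM).
- move=> n q; apply: cvgM; first exact: c1v_cont.
  by apply: cvg_norm; exact: cut_error_continuous.
- move=> q; rewrite -(mulr0 (c1_U t0 e0 q)); apply: cvgMl_tmp; rewrite -(normr0 R).
  by apply: cvg_norm; exact: cut_error_cvg.
- move=> n q /boxP[x1 x2 x3]; have p0 := hK00_ge0 t0 q.
  have /andP[U0 U1] := c1_U_bounds t0 e0 q.
  have r0 : 0 < n.+1%:R :> R by [].
  have k01 : 0 <= k_ n <= 1.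
    by rewrite /k_ invr_ge0 exprn_ge0//= invf_le1 ?exprn_gt0// exprn_ege1// ler1n.
  have E : `|cut_error t (k_ n) q| <= 52 + 8 / t.
    by apply: cut_error_bounded => //; split; exact: para_box.
  rewrite normrM normr_id ger0_norm//.
  rewrite (_ : M * p q = ((4 * pi ^+ 2)^-1 * heatM t 0 0 / e * p q) * (52 + 8 / t)); last by rewrite /M; ring.
  rewrite ler_pM//; apply: (le_trans U1).
  have pM : p q <= (4 * pi ^+ 2)^-1 * heatM t 0 0.
    by apply: le_trans (hK_le t0 0 0 q); exact: ler_norm.
  rewrite (_ : p q ^+ 2 / e = p q / e * p q); last by rewrite expr2 mulrAC.
  by rewrite ler_wpM2r// ler_wpM2r// invr_ge0 ltW.
Qed.

Theorem integral_fisher_le : (\int[mu3]_q (fisher_density q)%:E <= (2 / t)%:E)%E.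
Proof.
have cf := fisher_density_continuous.
have cC n : continuous (fun q => cutoff (k_ n) q * fisher_density q).
  by move=> q; apply: cvgM; [exact: c1v_cont|exact: cf].
pose f_ n := (fun q : mR * mR * mR => cutoff (k_ n) q * fisher_density q) \_ (box n.+1%:R).
pose u n := \int[mu3]_(q in box (n.+1%:R)) (c1_U t0 e0 q * `|cut_error t (k_ n) q|) + 2 / t.
apply: (@integral_le_of_cvg _ _ _ mu3 f_ _ u).
- move=> n; apply/(measurable_restrictT _ (measurable_box _))/measurable_funTS.
  exact: continuous_measurable3.
- move=> n q; rewrite /f_ patchE; case: ifP => // _.
  by rewrite mulr_ge0 ?cutoff_ge0 ?fisher_density_ge0.
- move=> q; apply: (@cvg_trans _ (cutoff (k_ n) q * fisher_density q @[n --> \oo])).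
    apply: near_eq_cvg; near=> n; rewrite /f_ patchE mem_set//.
    by near: n; exact: box_near.
  have : cutoff (k_ n) q * fisher_density q @[n --> \oo] --> 1 * fisher_density q.
    by apply: cvgMr_tmp; exact: cutoff_cvg.
  by rewrite mul1r.
- move=> n.
  have iC : mu3.-integrable (box n.+1%:R) (EFin \o (fun q => cutoff (k_ n) q * fisher_density q)).
    by apply: intg_box; exact: cC.
  have -> : (\int[mu3]_q (f_ n q)%:E =
    (\int[mu3]_(q in box n.+1%:R) (cutoff (k_ n) q * fisher_density q))%:E)%E.
    rewrite /Rintegral fineK; last by apply: integrable_fin_num => //; exact: measurable_box.
    by rewrite [RHS]integral_mkcond restrict_EFin.
  by rewrite lee_fin /u; apply: integral_fisher_box; rewrite ler1n.
- by rewrite -[X in _ --> X]add0r; apply: cvgD; [exact: cvg_error_integral|exact: cvg_cst].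
Unshelve. all: by end_near. Qed.

End fisher.

Lemma c1_lin_continuous {R : realType} (a b : R) (u v : c1 (R := R)) :
  continuous (fun q => a * u q + b * v q).
Proof. by move=> q; apply: cvgD; apply: cvgMl_tmp; exact: c1v_cont. Qed.

(** * Right-invariant derivatives and the directional Fisher information *)

Section rotation.
Context {R : realType} (t e : R).
Hypotheses (t0 : 0 < t) (e0 : 0 < e).
Notation mR := (measurableTypeR R).
Notation mu3 := (lebesgue3 : {measure set (mR * mR * mR) -> \bar R}).
Notation p := (c1_hK t0 0 0).
Implicit Types q : R * R * R.

(* The right-invariant fields applied to the kernel: they are what differentiating
   [P_t f] along the left-invariant ones produces. *)
Definition XhK : c1 (R := R) :=
  c1_mul (c1_cst 2^-1) (c1_add (c1_mul (c1_cst (- 1)) (c1_mul c1_X (c1_hK t0 0 1)))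
    (c1_mul c1_Y (c1_hK t0 1 0))).
Definition YhK : c1 (R := R) :=
  c1_mul (c1_cst (- 2^-1)) (c1_add (c1_mul c1_X (c1_hK t0 1 0)) (c1_mul c1_Y (c1_hK t0 0 1))).

Lemma hK_rot90 i j q : hK t i j (rot90 q) = hK t i j q.
Proof. by rewrite /hK /rot90 /= sqrrN [X in heatH _ _ _ X]addrC. Qed.

Lemma XhK_rot90 q : XhK (rot90 q) = YhK q.
Proof. by rewrite /= !hK_rot90 /rot90 /=; ring. Qed.

Lemma YhK_rot90 q : YhK (rot90 q) = - XhK q.
Proof. by rewrite /= !hK_rot90 /rot90 /=; ring. Qed.

(** Left- and right-invariant fields differ by the sign of their [z] part. For a function of
    [x ^ 2 + y ^ 2] and [z] this only changes the sign of cross terms, which cancel in the sum of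
    the squares. *)
Lemma fisher_densityE q :
  fisher_density e t0 q = (XhK q ^+ 2 + YhK q ^+ 2) / (p q + e).
Proof. by rewrite /fisher_density; congr (_ / _); rewrite /=; ring. Qed.

Lemma intg_fisher_density : mu3.-integrable setT (EFin \o fisher_density e t0).
Proof.
apply/integrableP; split.
  apply/measurable_EFinP; apply: continuous_measurable3.
  exact: fisher_density_continuous.
rewrite (eq_integral (fun q : mR * mR * mR => (fisher_density e t0 q)%:E)).
  by rewrite (le_lt_trans (integral_fisher_le t0 e0))// ltry.
by move=> q _; rewrite /= ger0_norm// fisher_density_ge0.
Qed.

(* The rotation by a right angle exchanges the directions [(a, b)] and [(- b, a)],
   whose contributions add up to the full Fisher information. *)
Lemma directional_fisher (a b : R) :
  mu3.-integrable setT (EFin \o (fun q => (a * XhK q + b * YhK q) ^+ 2 / (p q + e))) /\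
  \int[mu3]_q ((a * XhK q + b * YhK q) ^+ 2 / (p q + e)) <= (a ^+ 2 + b ^+ 2) / t.
Proof.
pose J (a b : R) q := (a * XhK q + b * YhK q) ^+ 2 / (p q + e).
have cJ a' b' : continuous (J a' b').
  apply: div_hK00_continuous => //; apply: continuous_sqr.
  exact: c1_lin_continuous.
have pe q : 0 < p q + e by rewrite ltr_wpDl// hK00_ge0.
have JD a' b' q : J a' b' q + J (- b') a' q = (a' ^+ 2 + b' ^+ 2) * fisher_density e t0 q.
  by rewrite fisher_densityE /J; field; rewrite gt_eqF.
have J0 a' b' q : 0 <= J a' b' q by rewrite divr_ge0 ?sqr_ge0 ?ltW.
have iJ a' b' : mu3.-integrable setT (EFin \o J a' b').
  apply: (@dominated_integrable _ _ _ mu3 setT measurableT _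
    (fun q => (a' ^+ 2 + b' ^+ 2) * fisher_density e t0 q)).
  - exact: continuous_measurable3.
  - exact: intgZ intg_fisher_density.
  - by move=> q _; rewrite -JD ger0_norm// lerDl.
split; first exact: iJ.
have JE : \int[mu3]_q J a b q = \int[mu3]_q J (- b) a q.
  rewrite -(Rintegral_invariant (@ge0_integral_rot90 R)); last first.
    exact: continuous_measurable3.
  apply: eq_Rintegral => q _; rewrite /J XhK_rot90 YhK_rot90 /= hK_rot90.
  by congr (_ / _); ring.
have : 2 * \int[mu3]_q J a b q <= (a ^+ 2 + b ^+ 2) * (2 / t).
  rewrite mulrDl !mul1r [X in X + _]JE addrC -RintegralD//.
  under eq_Rintegral do rewrite JD.
  rewrite RintegralZl//; last exact: intg_fisher_density.
  apply: ler_wpM2l; first by rewrite addr_ge0 ?sqr_ge0.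
  rewrite -[leRHS]/(fine (2 / t)%:E) /Rintegral fine_le//.
    by apply: integrable_fin_num => //; exact: intg_fisher_density.
  exact: integral_fisher_le.
have -> : (a ^+ 2 + b ^+ 2) * (2 / t) = 2 * ((a ^+ 2 + b ^+ 2) / t) by ring.
by rewrite ler_pM2l.
Qed.

(** Pointwise Young inequality [2 g v <= g ^ 2 w / t + t v ^ 2 / w] with [w = p + e]. The parameter
    [t] turns the directional bound [(a ^ 2 + b ^ 2) / t] into [a ^ 2 + b ^ 2]. *)
Lemma young_box (g : R * R * R -> R) r (a b : R) : 0 < r -> continuous g ->
  2 * \int[mu3]_(q in box r) (cutoff (r ^- 2) q * g q * (a * XhK q + b * YhK q)) <=
  t^-1 * \int[mu3]_(q in box r) (cutoff (r ^- 2) q * g q ^+ 2 * (p q + e)) +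
  (a ^+ 2 + b ^+ 2).
Proof.
move=> r0 cg; have mB := measurable_box r.
set k := r ^- 2.
have pe q : 0 < p q + e by rewrite ltr_wpDl// hK00_ge0.
have cv := @c1_lin_continuous R a b XhK YhK.
have i1 : mu3.-integrable (box r) (EFin \o (fun q => cutoff k q * g q * (a * XhK q + b * YhK q))).
  apply: intg_box => q; apply: cvgM; last exact: cv.
  by apply: cvgM; [exact: c1v_cont|exact: cg].
have i2 : mu3.-integrable (box r) (EFin \o (fun q => cutoff k q * g q ^+ 2 * (p q + e))).
  apply: intg_box => q; apply: cvgM.
    by apply: cvgM; [exact: c1v_cont|exact: continuous_sqr].
  by apply: cvgD; [exact: c1v_cont|exact: cvg_cst].
have [i3 le3] := directional_fisher a b.
have i3B : mu3.-integrable (box r) (EFin \o (fun q => (a * XhK q + b * YhK q) ^+ 2 / (p q + e))).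
  by apply: integrableS i3.
have le3B : \int[mu3]_(q in box r) ((a * XhK q + b * YhK q) ^+ 2 / (p q + e)) <= (a ^+ 2 + b ^+ 2) / t.
  apply: le_trans le3; apply: (le_Rintegral_subset mB i3) => q.
  by rewrite divr_ge0 ?sqr_ge0 ?ltW.
have i2' := intgZ mB t^-1 i2; have i3' := intgZ mB t i3B.
rewrite -(RintegralZl _ mB i1).
apply: (le_trans (le_Rintegral mB (intgZ mB 2 i1) (intgD mB i2' i3') _)).
  move=> q Bq; have c1 := cutoff_le1 r0 Bq; have c0 := cutoff_ge0 k q.
  set v := a * _ + _; set w := p q + e; have w0 : 0 < w by exact: pe.
  have Y : 2 * (g q * v) <= t^-1 * (g q ^+ 2 * w) + t * (v ^+ 2 / w).
    rewrite -subr_ge0 (_ : _ - _ = (t * w)^-1 * (g q * w - t * v) ^+ 2); last first.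
      by field; rewrite !gt_eqF.
    by rewrite mulr_ge0 ?sqr_ge0// invr_ge0 mulr_ge0// ltW.
  have V0 : 0 <= t * (v ^+ 2 / w) by rewrite mulr_ge0 ?divr_ge0 ?sqr_ge0// ltW.
  have := ler_wpM2l c0 Y; have := ler_piMl V0 c1.
  rewrite (_ : 2 * (cutoff k q * g q * v) = cutoff k q * (2 * (g q * v))); last by ring.
  rewrite (_ : t^-1 * (cutoff k q * g q ^+ 2 * w) = cutoff k q * (t^-1 * (g q ^+ 2 * w))); last by ring.
  move=> h1 h2; apply: (le_trans h2); rewrite mulrDr lerD2l.
  exact: h1.
rewrite (RintegralD mB i2' i3') (RintegralZl _ mB i2) (RintegralZl _ mB i3B) lerD2l.
by rewrite -ler_pdivlMl// mulrC.
Qed.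

End rotation.

(** * The Cauchy-Schwarz step with cutoff *)

Section gradient.
Context {R : realType} (t : R).
Hypothesis t0 : 0 < t.
Notation mR := (measurableTypeR R).
Notation mu3 := (lebesgue3 : {measure set (mR * mR * mR) -> \bar R}).
Notation p := (c1_hK t0 0 0).
Implicit Types q : R * R * R.

(** [young_box] is applied with [a] and [b] the two integrals themselves: its left side is twice
    [a ^ 2 + b ^ 2], one copy of which is absorbed by the right side. Then [e] tends to [0]. *)
Lemma cutoff_gradient_le (g : R * R * R -> R) r : 0 < r -> continuous g ->
  (\int[mu3]_(q in box r) (cutoff (r ^- 2) q * g q * XhK t0 q)) ^+ 2 +
  (\int[mu3]_(q in box r) (cutoff (r ^- 2) q * g q * YhK t0 q)) ^+ 2 <=
  t^-1 * \int[mu3]_(q in box r) (cutoff (r ^- 2) q * g q ^+ 2 * p q).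
Proof.
move=> r0 cg; have mB := measurable_box r.
set k := r ^- 2; set a := Rintegral _ _ _; set b := Rintegral _ _ _.
have cg2 : continuous (fun q => cutoff k q * g q ^+ 2).
  by move=> q; apply: cvgM; [exact: c1v_cont|exact: continuous_sqr].
have iX : mu3.-integrable (box r) (EFin \o (fun q => cutoff k q * g q * XhK t0 q)).
  apply: intg_box => q; apply: cvgM; last exact: c1v_cont.
  by apply: cvgM; [exact: c1v_cont|exact: cg].
have iY : mu3.-integrable (box r) (EFin \o (fun q => cutoff k q * g q * YhK t0 q)).
  apply: intg_box => q; apply: cvgM; last exact: c1v_cont.
  by apply: cvgM; [exact: c1v_cont|exact: cg].
have ig : mu3.-integrable (box r) (EFin \o (fun q => cutoff k q * g q ^+ 2)) by exact: intg_box.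
have ip : mu3.-integrable (box r) (EFin \o (fun q => cutoff k q * g q ^+ 2 * p q)).
  by apply: intg_box => q; apply: cvgM; [exact: cg2|exact: c1v_cont].
have key (e : R) : 0 < e -> a ^+ 2 + b ^+ 2 <=
    t^-1 * \int[mu3]_(q in box r) (cutoff k q * g q ^+ 2 * p q) +
    e * (t^-1 * \int[mu3]_(q in box r) (cutoff k q * g q ^+ 2)).
  move=> e0; have := young_box t0 e0 a b r0 cg.
  have -> : \int[mu3]_(q in box r) (cutoff (r ^- 2) q * g q * (a * XhK t0 q + b * YhK t0 q)) =
      a ^+ 2 + b ^+ 2.
    transitivity (a * a + b * b); last by ring.
    rewrite -(Rintegral_lin mB a b iX iY); apply: eq_Rintegral => q _.
    by move: (XhK t0 q) (YhK t0 q) (cutoff _ q) => *; ring.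
  have -> : \int[mu3]_(q in box r) (cutoff (r ^- 2) q * g q ^+ 2 * (p q + e)) =
      1 * \int[mu3]_(q in box r) (cutoff k q * g q ^+ 2 * p q) +
      e * \int[mu3]_(q in box r) (cutoff k q * g q ^+ 2).
    rewrite -(Rintegral_lin mB 1 e ip ig); apply: eq_Rintegral => q _.
    by move: (p q) (cutoff _ q) => *; ring.
  set A := Rintegral _ _ _; set B := Rintegral _ _ _.
  rewrite (_ : t^-1 * (1 * A + e * B) = t^-1 * A + e * (t^-1 * B)); last by ring.
  by rewrite mulrDl !mul1r lerD2r.
set A := t^-1 * _ in key *.
have B0 : 0 <= t^-1 * \int[mu3]_(q in box r) (cutoff k q * g q ^+ 2).
  rewrite mulr_ge0 ?invr_ge0 ?(ltW t0)//; apply: Rintegral_ge0 => q _.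
  by rewrite mulr_ge0 ?cutoff_ge0 ?sqr_ge0.
set B := t^-1 * _ in key B0.
apply/ler_addgt0Pr => d d0.
have B1 : 0 < B + 1 by rewrite ltr_wpDl.
apply: (le_trans (key (d / (B + 1)) _)); first by rewrite divr_gt0.
rewrite lerD2l mulrAC ler_pdivrMr// ler_wpM2l ?(ltW d0)// lerDl//.
Qed.

End gradient.

Lemma c1_addE {R : realType} (u v : c1 (R := R)) q : c1_add u v q = u q + v q.
Proof. by []. Qed.

Lemma c1_mulE {R : realType} (u v : c1 (R := R)) q : c1_mul u v q = u q * v q.
Proof. by []. Qed.

Lemma le_lim_sqrD {R : realType} (u v : nat -> R) (a b M : R) :
  u n @[n --> \oo] --> a -> v n @[n --> \oo] --> b ->
  (forall n, u n ^+ 2 + v n ^+ 2 <= M) -> a ^+ 2 + b ^+ 2 <= M.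
Proof.
move=> ua vb uvM.
have c : (u n * u n + v n * v n) @[n --> \oo] --> a * a + b * b.
  by apply: cvgD; apply: cvgM.
rewrite !expr2 -(cvg_lim _ c)//; apply: limr_le.
  by apply/cvg_ex; eexists; exact: c.
by apply: nearW => n; rewrite -!expr2.
Qed.

(** * Removal of the cutoff and the variance bound *)

Section variance.
Context {R : realType} (t : R).
Hypothesis t0 : 0 < t.
Notation mR := (measurableTypeR R).
Notation mu3 := (lebesgue3 : {measure set (mR * mR * mR) -> \bar R}).
Notation p := (c1_hK t0 0 0).
Implicit Types q : R * R * R.
Let r_ n : R := n.+1%:R.
Let k_ n : R := r_ n ^- 2.

Lemma cutoff_integral_cvg (h : R * R * R -> R) : continuous h ->
  mu3.-integrable setT (EFin \o h) ->
  \int[mu3]_(q in box (r_ n)) (cutoff (k_ n) q * h q) @[n --> \oo] --> \int[mu3]_q h q.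
Proof.
move=> ch ih; apply: (cvg_box_integral _ _ (intg_abs ih)).
- by move=> n q; apply: cvgM; [exact: c1v_cont|exact: ch].
- by move=> q; rewrite -[X in _ --> X]mul1r; apply: cvgMr_tmp; exact: cutoff_cvg.
- move=> n q Bq; rewrite normrM ger0_norm ?cutoff_ge0//.
  by apply: ler_piMl => //; exact: cutoff_le1 Bq.
Qed.

(** Right-invariant derivatives of the cutoff, onto which integration by parts moves those of
    [p]. *)
Definition XhC k : c1 (R := R) :=
  c1_add (cutoff_x k) (c1_mul (c1_cst 2^-1) (c1_mul c1_Y (cutoff_z k))).
Definition YhC k : c1 (R := R) :=
  c1_add (cutoff_y k) (c1_mul (c1_cst (- 2^-1)) (c1_mul c1_X (cutoff_z k))).

Lemma cutoff_derivatives_le r q : 0 < r -> box r q ->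
  [/\ `|cutoff_x (r ^- 2) q| <= 4 * r ^- 2 * `|q.1.1|,
      `|cutoff_y (r ^- 2) q| <= 4 * r ^- 2 * `|q.1.2| &
      `|cutoff_z (r ^- 2) q| <= 4 * r ^- 2 * `|q.2|].
Proof.
move=> r0 /boxP[x1 x2 x3].
have k0 : 0 <= r ^- 2 by rewrite invr_ge0 exprn_ge0// ltW.
have [/andP[a0 a1] da _] := bump_bounds k0 (para_box r0 x1).
have [/andP[b0 b1] db _] := bump_bounds k0 (para_box r0 x2).
have [/andP[c0 c1] dc _] := bump_bounds k0 (para_box r0 x3).
have aux (u v w B : R) : `|u| <= B -> 0 <= v <= 1 -> 0 <= w <= 1 -> `|u * v * w| <= B.
  move=> uB /andP[v0 v1] /andP[w0 w1]; rewrite 2!normrM (ger0_norm v0) (ger0_norm w0).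
  apply: le_trans uB; rewrite -mulrA ler_piMr//.
  by apply: mulr_ile1.
split.
- rewrite (_ : cutoff_x _ q = dbump (r ^- 2) q.1.1 * bump (r ^- 2) q.1.2 * bump (r ^- 2) q.2).
    by apply: aux; rewrite ?b0 ?c0.
  by rewrite /= /dbump /bump; ring.
- rewrite (_ : cutoff_y _ q = dbump (r ^- 2) q.1.2 * bump (r ^- 2) q.1.1 * bump (r ^- 2) q.2).
    by apply: aux; rewrite ?a0 ?c0.
  by rewrite /= /dbump /bump; ring.
- rewrite (_ : cutoff_z _ q = dbump (r ^- 2) q.2 * bump (r ^- 2) q.1.1 * bump (r ^- 2) q.1.2).
    by apply: aux; rewrite ?a0 ?b0.
  by rewrite /= /dbump /bump; ring.
Qed.

(** The first bound gives convergence to [0] at a fixed point, the second a domination by [6 p]. *)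
Let hC_bounds (u v w a b c k : R) : 0 <= k <= 1 ->
  k * a ^+ 2 <= 1 -> k * b ^+ 2 <= 1 -> k * c ^+ 2 <= 1 ->
  `|u| <= 4 * k * `|a| -> `|w| <= 4 * k * `|c| -> `|v| = 2^-1 * `|b| ->
  `|u + v * w| <= k * (4 * `|a| + 2 * `|b| * `|c|) /\ `|u + v * w| <= 6.
Proof.
move=> /andP[k0 k1] ka kb kc ua wc vb.
have h : `|u + v * w| <= k * (4 * `|a| + 2 * `|b| * `|c|).
  rewrite (le_trans (ler_normD _ _))// normrM vb.
  rewrite (_ : k * _ = 4 * k * `|a| + 2^-1 * `|b| * (4 * k * `|c|)); last by field.
  by apply: lerD => //; apply: ler_wpM2l => //; rewrite mulr_ge0.
split=> //; apply: (le_trans h).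
have sq (s : R) : 0 <= s -> s ^+ 2 <= 1 -> s <= 1.
  by move=> s0; rewrite -[X in _ <= X -> _](expr1n _ 2%N) ler_pXn2r// nnegrE.
have h1 : k * `|a| <= 1.
  apply: sq; first by rewrite mulr_ge0.
  rewrite exprMn real_normK ?num_real// expr2 -mulrA.
  by apply: mulr_ile1 => //; rewrite mulr_ge0 ?sqr_ge0.
have h2 : k * (`|b| * `|c|) <= 1.
  apply: sq; first by rewrite !mulr_ge0.
  rewrite !exprMn !real_normK ?num_real//.
  rewrite (_ : _ * _ = (k * b ^+ 2) * (k * c ^+ 2)); last by ring.
  by apply: mulr_ile1 => //; rewrite mulr_ge0 ?sqr_ge0.
rewrite (_ : k * _ = 4 * (k * `|a|) + 2 * (k * (`|b| * `|c|))); last by ring.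
by move: (k * `|a|) (k * _) h1 h2 => A B hA hB; lra.
Qed.

Let k_01 n : 0 <= k_ n <= 1.
Proof.
by rewrite /k_ /r_ invr_ge0 exprn_ge0//= invf_le1 ?exprn_gt0// exprn_ege1// ler1n.
Qed.

Lemma hC_le n q : box (r_ n) q ->
  [/\ `|XhC (k_ n) q| <= k_ n * (4 * `|q.1.1| + 2 * `|q.1.2| * `|q.2|),
      `|XhC (k_ n) q| <= 6,
      `|YhC (k_ n) q| <= k_ n * (4 * `|q.1.2| + 2 * `|q.1.1| * `|q.2|) &
      `|YhC (k_ n) q| <= 6].
Proof.
move=> Bq; have r0 : 0 < r_ n by rewrite /r_.
have [dx dy dz] := cutoff_derivatives_le r0 Bq.
have [x1 x2 x3] := (boxP _ _).1 Bq.
have p1 := para_box r0 x1; have p2 := para_box r0 x2; have p3 := para_box r0 x3.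
have nb (s : R) : `|2^-1 * s| = 2^-1 * `|s| by rewrite normrM ger0_norm.
have nb' (s : R) : `|- 2^-1 * s| = 2^-1 * `|s| by rewrite mulNr normrN nb.
have XE : XhC (k_ n) q = cutoff_x (k_ n) q + 2^-1 * q.1.2 * cutoff_z (k_ n) q.
  by rewrite (c1_addE (cutoff_x _)) (c1_mulE (c1_cst _)) (c1_mulE c1_Y) mulrA.
have YE : YhC (k_ n) q = cutoff_y (k_ n) q + - 2^-1 * q.1.1 * cutoff_z (k_ n) q.
  by rewrite (c1_addE (cutoff_y _)) (c1_mulE (c1_cst _)) (c1_mulE c1_X) mulrA.
rewrite XE YE.
have [? ?] := hC_bounds (k_01 n) p1 p2 p3 dx dz (nb _).
by have [? ?] := hC_bounds (k_01 n) p2 p1 p3 dy dz (nb' _).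
Qed.

(** The vanishing of the integral of [XhK] is expressed through cutoffs, since [XhK] is nowhere
    shown to be integrable over the whole space. *)
Lemma integral_cutoff_XhK r : 0 < r ->
  \int[mu3]_(q in box r) (cutoff (r ^- 2) q * XhK t0 q) =
  - \int[mu3]_(q in box r) (XhC (r ^- 2) q * p q).
Proof.
move=> r0; have mB := measurable_box r; set k := r ^- 2.
have rr : `|r| = r by rewrite gtr0_norm.
have Nr : `|- r| = r by rewrite normrN gtr0_norm.
pose P1 := c1_mul (cutoff k) p.
pose P3 := c1_mul (c1_cst 2^-1) (c1_mul c1_Y P1).
have e1 : \int[mu3]_(q in box r) c1x P1 q = 0.
  apply: integral_c1x => [|y z]; first exact: r0.
  have [E _ _ _] := @cutoff_face R r (r, y, z) r0 (Or31 _ _ rr).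
  have [E' _ _ _] := @cutoff_face R r (- r, y, z) r0 (Or31 _ _ Nr).
  by rewrite !(c1_mulE (cutoff k)) E E' !mul0r.
have e3 : \int[mu3]_(q in box r) c1z P3 q = 0.
  apply: integral_c1z => [|x y]; first exact: r0.
  have [E _ _ _] := @cutoff_face R r (x, y, r) r0 (Or33 _ _ rr).
  have [E' _ _ _] := @cutoff_face R r (x, y, - r) r0 (Or33 _ _ Nr).
  by rewrite /P3 !(c1_mulE (c1_cst _)) !(c1_mulE _ P1) !(c1_mulE (cutoff k)) E E' !(mul0r, mulr0).
have i1 : mu3.-integrable (box r) (EFin \o c1x P1) by apply: intg_box; exact: c1x_cont.
have i3 : mu3.-integrable (box r) (EFin \o c1z P3) by apply: intg_box; exact: c1z_cont.
have iX : mu3.-integrable (box r) (EFin \o (fun q => XhC k q * p q)).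
  by apply: intg_box => q; apply: cvgM; exact: c1v_cont.
have i13 := intgD mB i1 i3.
transitivity (1 * \int[mu3]_(q in box r) (c1x P1 q + c1z P3 q) +
    (- 1) * \int[mu3]_(q in box r) (XhC k q * p q)); last first.
  by rewrite (RintegralD mB i1 i3) e1 e3; ring.
rewrite -(Rintegral_lin mB 1 (- 1) i13 iX); apply: eq_Rintegral => q _.
rewrite /P3 /P1.
have hx := cutoff_dx k q; have hz := cutoff_dz k q.
move: hx hz; rewrite /XhC; move: (cutoff k) (cutoff_x k) (cutoff_z k) => C Cx Cz hx hz.
by rewrite /= hx hz; move: (hK t 0 0 q) (hK t 0 1 q) (hK t 1 0 q) => *; field.
Qed.

Lemma integral_cutoff_YhK r : 0 < r ->
  \int[mu3]_(q in box r) (cutoff (r ^- 2) q * YhK t0 q) =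
  - \int[mu3]_(q in box r) (YhC (r ^- 2) q * p q).
Proof.
move=> r0; have mB := measurable_box r; set k := r ^- 2.
have rr : `|r| = r by rewrite gtr0_norm.
have Nr : `|- r| = r by rewrite normrN gtr0_norm.
pose P1 := c1_mul (cutoff k) p.
pose P3 := c1_mul (c1_cst (- 2^-1)) (c1_mul c1_X P1).
have e1 : \int[mu3]_(q in box r) c1y P1 q = 0.
  apply: integral_c1y => [|x z]; first exact: r0.
  have [E _ _ _] := @cutoff_face R r (x, r, z) r0 (Or32 _ _ rr).
  have [E' _ _ _] := @cutoff_face R r (x, - r, z) r0 (Or32 _ _ Nr).
  by rewrite !(c1_mulE (cutoff k)) E E' !mul0r.
have e3 : \int[mu3]_(q in box r) c1z P3 q = 0.
  apply: integral_c1z => [|x y]; first exact: r0.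
  have [E _ _ _] := @cutoff_face R r (x, y, r) r0 (Or33 _ _ rr).
  have [E' _ _ _] := @cutoff_face R r (x, y, - r) r0 (Or33 _ _ Nr).
  by rewrite /P3 !(c1_mulE (c1_cst _)) !(c1_mulE _ P1) !(c1_mulE (cutoff k)) E E' !(mul0r, mulr0).
have i1 : mu3.-integrable (box r) (EFin \o c1y P1) by apply: intg_box; exact: c1y_cont.
have i3 : mu3.-integrable (box r) (EFin \o c1z P3) by apply: intg_box; exact: c1z_cont.
have iX : mu3.-integrable (box r) (EFin \o (fun q => YhC k q * p q)).
  by apply: intg_box => q; apply: cvgM; exact: c1v_cont.
have i13 := intgD mB i1 i3.
transitivity (1 * \int[mu3]_(q in box r) (c1y P1 q + c1z P3 q) +
    (- 1) * \int[mu3]_(q in box r) (YhC k q * p q)); last first.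
  by rewrite (RintegralD mB i1 i3) e1 e3; ring.
rewrite -(Rintegral_lin mB 1 (- 1) i13 iX); apply: eq_Rintegral => q _.
rewrite /P3 /P1.
have hy := cutoff_dy k q; have hz := cutoff_dz k q.
move: hy hz; rewrite /YhC; move: (cutoff k) (cutoff_y k) (cutoff_z k) => C Cy Cz hy hz.
by rewrite /= hy hz; move: (hK t 0 0 q) (hK t 0 1 q) (hK t 1 0 q) => *; field.
Qed.

Lemma cvg_hC_integral (E : nat -> c1 (R := R)) (B : R * R * R -> R) :
  (forall n q, box (r_ n) q -> `|E n q| <= k_ n * B q /\ `|E n q| <= 6) ->
  (- \int[mu3]_(q in box (r_ n)) (E n q * p q)) @[n --> \oo] --> (0 : R).
Proof.
move=> hE; rewrite -oppr0; apply: cvgN.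
have i6 : mu3.-integrable setT (EFin \o (fun q => 6 * p q)) by exact: intgZ (intg_hK00 t0).
have : \int[mu3]_(q in box (r_ n)) (E n q * p q) @[n --> \oo] --> \int[mu3]_q (fun=> 0 : R) q.
  apply: (cvg_box_integral _ _ i6).
  - by move=> n q; apply: cvgM; exact: c1v_cont.
  - move=> q; rewrite -(mul0r (p q)); apply: cvgMr_tmp; apply: norm_cvg0.
    apply: (@squeeze_cvgr _ _ _ _ (fun=> 0) (fun n => k_ n * B q)).
    + near=> n; rewrite normr_ge0/=.
      have Bq : box (r_ n) q by near: n; exact: box_near.
      by have [] := hE n q Bq.
    + exact: cvg_cst.
    + by rewrite -(mul0r (B q)); apply: cvgMr_tmp; exact: cvg_inv_sqr_succ.
  - move=> n q Bq; have p0 := hK00_ge0 t0 q.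
    rewrite normrM (ger0_norm p0); apply: ler_wpM2r => //.
    by have [] := hE n q Bq.
by rewrite /Rintegral integral0.
Unshelve. all: by end_near. Qed.

Lemma intg_box_support (g : R * R * R -> R) r : continuous g ->
  (forall q, ~ box r q -> g q = 0) -> mu3.-integrable setT (EFin \o g).
Proof.
move=> cg g0; have mB := measurable_box r.
have -> : EFin \o g = (EFin \o g) \_ (box r).
  apply/funext => q; rewrite patchE; case: ifPn => // /negP Bq.
  by rewrite /= g0// => h; apply: Bq; rewrite inE.
by apply/integrable_restrict; rewrite ?setTI//; exact: intg_box.
Qed.

Lemma gradient_variance (g : R * R * R -> R) (r : R) : continuous g ->
  (forall q, ~ box r q -> g q = 0) ->
  (\int[mu3]_q (g q * XhK t0 q)) ^+ 2 + (\int[mu3]_q (g q * YhK t0 q)) ^+ 2 <=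
  t^-1 * (\int[mu3]_q (g q ^+ 2 * p q) - (\int[mu3]_q (g q * p q)) ^+ 2).
Proof.
move=> cg g0.
have ip := intg_hK00 t0.
have cgv (v : c1 (R := R)) : continuous (fun q => g q * v q).
  by move=> q; apply: cvgM; [exact: cg|exact: c1v_cont].
have igv (v : c1 (R := R)) : mu3.-integrable setT (EFin \o (fun q => g q * v q)).
  by apply: (@intg_box_support _ r) => // q Bq; rewrite g0// mul0r.
have ig2p : mu3.-integrable setT (EFin \o (fun q => g q ^+ 2 * p q)).
  apply: (@intg_box_support _ r) => [q|q Bq]; last by rewrite g0// expr0n mul0r.
  by apply: cvgM; [exact: continuous_sqr|exact: c1v_cont].
pose c := \int[mu3]_q (g q * p q).
(* Subtracting the constant destroys the compact support, hence the cutoffs below. *)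
pose h q := g q - c.
have ch : continuous h by move=> q; apply: cvgB; [exact: cg|exact: cvg_cst].
pose Q := \int[mu3]_q (g q ^+ 2 * p q) - c ^+ 2.
have r0 n : 0 < r_ n by rewrite /r_.
have hE q : h q ^+ 2 * p q = 1 * (1 * (g q ^+ 2 * p q) + (- (2 * c)) * (g q * p q)) + c ^+ 2 * p q.
  by rewrite /h; move: (p q) => w; ring.
have i12 := intgD measurableT (intgZ measurableT 1 ig2p) (intgZ measurableT (- (2 * c)) (igv p)).
have ih2 : mu3.-integrable setT (EFin \o (fun q => h q ^+ 2 * p q)).
  have -> : (fun q => h q ^+ 2 * p q) = (fun q => 1 * (1 * (g q ^+ 2 * p q) + (- (2 * c)) * (g q * p q)) + c ^+ 2 * p q).
    by apply/funext => q; rewrite hE.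
  by apply: intgD => //; exact: intgZ.
(* The left side is the integral of [g ^ 2 p] minus [2 c ^ 2] plus [c ^ 2 m], with [m] the mass of
   [p]; [m <= 1] gives [Q]. *)
have h2Q : \int[mu3]_q (h q ^+ 2 * p q) <= Q.
  under eq_Rintegral do rewrite hE.
  rewrite (Rintegral_lin measurableT 1 (c ^+ 2) i12 ip).
  rewrite (Rintegral_lin measurableT 1 (- (2 * c)) ig2p (igv p)) -/c /Q.
  have := Rintegral_hK00_le1 t0 measurableT.
  move: (Rintegral _ _ _) (Rintegral _ _ _) => A P1 P1le.
  have := ler_wpM2l (sqr_ge0 c) P1le; rewrite mulr1.
  by move: (c ^+ 2) (c ^+ 2 * _) (expr2 c) => cc ccP -> ?; nra.
have main n : (\int[mu3]_(q in box (r_ n)) (cutoff (k_ n) q * h q * XhK t0 q)) ^+ 2 +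
    (\int[mu3]_(q in box (r_ n)) (cutoff (k_ n) q * h q * YhK t0 q)) ^+ 2 <= t^-1 * Q.
  apply: le_trans (cutoff_gradient_le t0 (r0 n) ch) _.
  apply: ler_wpM2l; first by rewrite invr_ge0 ltW.
  apply: le_trans h2Q.
  have mB := measurable_box (r_ n).
  have hp0 q : 0 <= h q ^+ 2 * p q by rewrite mulr_ge0 ?sqr_ge0// hK00_ge0.
  apply: le_trans (le_Rintegral_subset mB ih2 hp0).
  have ihB : mu3.-integrable (box (r_ n)) (EFin \o (fun q => h q ^+ 2 * p q)).
    by apply: integrableS ih2.
  apply: le_Rintegral => //.
    apply: intg_box => q; apply: cvgM; last exact: c1v_cont.
    by apply: cvgM; [exact: c1v_cont|exact: continuous_sqr].
  move=> q Bq; rewrite -mulrA; apply: ler_piMl; first exact: hp0.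
  exact: cutoff_le1 Bq.
have split_int (v : c1 (R := R)) n : \int[mu3]_(q in box (r_ n)) (cutoff (k_ n) q * h q * v q) =
    1 * \int[mu3]_(q in box (r_ n)) (cutoff (k_ n) q * (g q * v q)) +
    (- c) * \int[mu3]_(q in box (r_ n)) (cutoff (k_ n) q * v q).
  have mB := measurable_box (r_ n).
  have i1 : mu3.-integrable (box (r_ n)) (EFin \o (fun q => cutoff (k_ n) q * (g q * v q))).
    by apply: intg_box => q; apply: cvgM; [exact: c1v_cont|exact: cgv].
  have i2 : mu3.-integrable (box (r_ n)) (EFin \o (fun q => cutoff (k_ n) q * v q)).
    by apply: intg_box => q; apply: cvgM; exact: c1v_cont.
  rewrite -(Rintegral_lin mB 1 (- c) i1 i2); apply: eq_Rintegral => q _; rewrite /h.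
  by move: (cutoff _ q) (v q) => *; ring.
(* The constant [c] multiplies a cutoff integral of [v] alone, which tends to [0]; the compactly
   supported part converges to its full integral. *)
have lim (v : c1 (R := R)) :
    (\int[mu3]_(q in box (r_ n)) (cutoff (k_ n) q * v q)) @[n --> \oo] --> (0 : R) ->
    (\int[mu3]_(q in box (r_ n)) (cutoff (k_ n) q * h q * v q)) @[n --> \oo] -->
    \int[mu3]_q (g q * v q).
  move=> v0; have -> : \int[mu3]_q (g q * v q) = 1 * \int[mu3]_q (g q * v q) + (- c) * 0.
    by rewrite mulr0 addr0 mul1r.
  rewrite (funext (split_int v)).
  by apply: cvgD; apply: cvgMl_tmp; [exact: cutoff_integral_cvg|exact: v0].
have limX := lim (XhK t0) _; have limY := lim (YhK t0) _.
have hX : (\int[mu3]_(q in box (r_ n)) (cutoff (k_ n) q * XhK t0 q)) @[n --> \oo] --> (0 : R).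
  rewrite (funext (fun n => integral_cutoff_XhK (r0 n))).
  apply: (@cvg_hC_integral (fun n => XhC (k_ n))
    (fun q => 4 * `|q.1.1| + 2 * `|q.1.2| * `|q.2|)) => n q Bq.
  by have [? ? _ _] := hC_le Bq.
have hY : (\int[mu3]_(q in box (r_ n)) (cutoff (k_ n) q * YhK t0 q)) @[n --> \oo] --> (0 : R).
  rewrite (funext (fun n => integral_cutoff_YhK (r0 n))).
  apply: (@cvg_hC_integral (fun n => YhC (k_ n))
    (fun q => 4 * `|q.1.2| + 2 * `|q.1.1| * `|q.2|)) => n q Bq.
  by have [_ _ ? ?] := hC_le Bq.
exact: le_lim_sqrD (limX hX) (limY hY) main.
Qed.

End variance.

(** * The gradient of the semigroup *)

Section translation.
Context {R : realType}.
Notation mR := (measurableTypeR R).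
Notation mu3 := (lebesgue3 : {measure set (mR * mR * mR) -> \bar R}).
Implicit Types a p q v : heis R.

Definition hinv p : heis R := (- p.1.1, - p.1.2, - p.2).

Lemma hmulKV p q : hmul (hinv p) (hmul p q) = q.
Proof.
by case: q => [[x y] z]; rewrite /hmul /hinv /=; congr (_, _, _); ring.
Qed.

Lemma continuous_hmul p : continuous (hmul p).
Proof.
move=> q.
have cx : (fun q : heis R => q.1.1) @ q --> q.1.1 by apply: cvg_comp; [exact: cvg_fst|exact: cvg_fst].
have cy : (fun q : heis R => q.1.2) @ q --> q.1.2 by apply: cvg_comp; [exact: cvg_fst|exact: cvg_snd].
have cz : (fun q : heis R => q.2) @ q --> q.2 by exact: cvg_snd.
apply: (@cvg_pair _ _ _ (nbhs q) (nbhs (p.1.1 + q.1.1, p.1.2 + q.1.2))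
  (nbhs (p.2 + q.2 + 2^-1 * (p.1.1 * q.1.2 - p.1.2 * q.1.1)))).
  apply: (@cvg_pair _ _ _ (nbhs q) (nbhs (p.1.1 + q.1.1)) (nbhs (p.1.2 + q.1.2))).
    by apply: cvgD => //; exact: cvg_cst.
  by apply: cvgD => //; exact: cvg_cst.
apply: cvgD; first by apply: cvgD => //; exact: cvg_cst.
by apply: cvgMl_tmp; apply: cvgB; exact: cvgMl_tmp.
Qed.

Lemma continuous_hmul_comp (f : heis R -> R) p :
  continuous f -> continuous (fun q => f (hmul p q)).
Proof.
move=> cf q; have c : hmul p @ q --> hmul p q by exact: continuous_hmul.
by apply: continuous_cvg c; exact: cf.
Qed.

Lemma hmul_box_support (f : heis R -> R) r p : (forall q, ~ box r q -> f q = 0) ->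
  exists r', forall q, ~ box r' q -> f (hmul p q) = 0.
Proof.
case: p => [[a b] c] f0.
(* Inverting the translation gives [|x| <= |r| + |a|] and [|y| <= |r| + |b|]; the last two terms
   cover the twist in [z]. *)
pose s := `|r| + `|a| + `|b| + `|c| + `|a| * (`|r| + `|b|) + `|b| * (`|r| + `|a|).
exists s => -[[x y] z] nB; apply: f0 => -[[/segP + /segP +] /segP]; rewrite /hmul /= => x1 y1 z1.
apply: nB; apply/boxP => /=.
have R0 := ler_norm r.
have xb : `|x| <= `|r| + `|a|.
  rewrite (_ : x = (a + x) - a); last by ring.
  by rewrite (le_trans (ler_normB _ _))// lerD2r (le_trans x1).
have yb : `|y| <= `|r| + `|b|.
  rewrite (_ : y = (b + y) - b); last by ring.
  by rewrite (le_trans (ler_normB _ _))// lerD2r (le_trans y1).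
have A0 := normr_ge0 a; have B0 := normr_ge0 b; have C0 := normr_ge0 c; have r0 := normr_ge0 r.
have ab0 : 0 <= `|a| * (`|r| + `|b|) by rewrite mulr_ge0// addr_ge0.
have ba0 : 0 <= `|b| * (`|r| + `|a|) by rewrite mulr_ge0// addr_ge0.
have ay : `|a * y| <= `|a| * (`|r| + `|b|) by rewrite normrM ler_wpM2l.
have bx : `|b * x| <= `|b| * (`|r| + `|a|) by rewrite normrM ler_wpM2l.
split; rewrite /s.
- by move: (`|a| * _) (`|b| * _) ab0 ba0 => u v *; lra.
- by move: (`|a| * _) (`|b| * _) ab0 ba0 => u v *; lra.
- move: z1 ay bx ab0 ba0.
  move: (`|a| * _) (`|b| * _) => u v z1 ay bx ab0 ba0.
  move: z1 ay bx; rewrite !ler_norml => /andP[z1 z2] /andP[y2 y3] /andP[x2 x3].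
  have := ler_norm c; have := lerNnormlW (lexx `|c|) => c1 c2.
  by apply/andP; split; lra.
Qed.

Lemma compact_support_box (f : heis R -> R) : compactly_supported f ->
  exists r, forall q, ~ box r q -> f q = 0.
Proof.
move=> cf.
have bd (g : heis R -> R) : continuous g -> exists C, forall q, f q != 0 -> `|g q| <= C.
  move=> cg; have ci : compact (g @` closure [set p | f p != 0]).
    by apply: continuous_compact => //; exact: continuous_subspaceT.
  have [M [Mr hM]] := compact_bounded ci.
  exists (M + 1) => q fq; apply: (hM (M + 1)); first by rewrite ltrDl.
  by exists q => //; exact: subset_closure.
have [C1 h1] := bd _ (@c1v_cont R c1_X).
have [C2 h2] := bd _ (@c1v_cont R c1_Y).
have [C3 h3] := bd _ (@c1v_cont R c1_Z).
exists (Num.max C1 (Num.max C2 C3)) => q; apply: contra_notP => /eqP fq.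
apply/boxP; split.
- by rewrite le_max h1.
- by rewrite !le_max h2// orbT.
- by rewrite !le_max h3// !orbT.
Qed.

End translation.

(** * Differentiation under the integral defining the semigroup *)

Section differentiation.
Context {R : realType} (t : R) (f : heis R -> R) (r : R).
Hypotheses (t0 : 0 < t) (cf : continuous f) (f0 : forall q, ~ box r q -> f q = 0).
Notation mR := (measurableTypeR R).
Notation mu3 := (lebesgue3 : {measure set (mR * mR * mR) -> \bar R}).
Implicit Types a p q v : heis R.

(** Moving the translation onto [g] gives a domain of integration that does not depend on [p];
    derivatives in [p] then fall on the kernel and not on [f]. *)
Lemma integral_translate (g : heis R -> R) p : continuous g ->
  \int[mu3]_q (f (hmul p q) * g q) = \int[mu3]_(q in box r) (f q * g (hmul (hinv p) q)).
Proof.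
move=> cg.
have cF : continuous (fun q => f q * g (hmul (hinv p) q)).
  by move=> q; apply: cvgM; [exact: cf|exact: continuous_hmul_comp].
have mF := continuous_measurable3 cF.
rewrite [RHS]Rintegral_mkcond.
transitivity (\int[mu3]_q (f q * g (hmul (hinv p) q))); last first.
  apply: eq_Rintegral => q _; rewrite patchE; case: ifPn => // /negP Bq.
  by rewrite f0 ?mul0r// => h; apply: Bq; rewrite inE.
rewrite -(Rintegral_invariant (@ge0_integral_hmul R p) mF).
by apply: eq_Rintegral => q _; rewrite hmulKV.
Qed.

Lemma heat_semigroupE p :
  heat_semigroup t f p = \int[mu3]_(q in box r) (f q * hK t 0 0 (hmul (hinv p) q)).
Proof.
rewrite /heat_semigroup gt_eqF// -integral_translate; last exact: hK_continuous.
by apply: eq_Rintegral => q _; rewrite heat_kernelE.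
Qed.

(** Derivative in [a], along [v], of the kernel at [w = hmul (hinv a) q]; [q] survives in the
    coefficient through the twist of the product. *)
Definition dir_kernel v q (w : heis R) : R :=
  (- v.2 + 2^-1 * (v.1.2 * q.1.1 - v.1.1 * q.1.2)) * hK t 1 0 w +
  2^-1 * (v.1.1 * w.1.1 + v.1.2 * w.1.2) * hK t 0 1 w.

Definition shifted p v (s : R) : heis R :=
  (p.1.1 + s * v.1.1, p.1.2 + s * v.1.2, p.2 + s * v.2).

Lemma is_derive_kernel p v q (s : R) :
  is_derive s 1 (fun s => hK t 0 0 (hmul (hinv (shifted p v s)) q))
    (dir_kernel v q (hmul (hinv (shifted p v s)) q)).
Proof.
pose X s : R := - (p.1.1 + s * v.1.1) + q.1.1.
pose Y s : R := - (p.1.2 + s * v.1.2) + q.1.2.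
pose Z s : R := - (p.2 + s * v.2) + q.2 +
  2^-1 * (- (p.1.1 + s * v.1.1) * q.1.2 - - (p.1.2 + s * v.1.2) * q.1.1).
have lin (A B : R) (u : R) : is_derive u 1 (fun s => A + B * s) B.
  apply: is_derive_eq (is_deriveD (is_derive_cst A u 1) (is_deriveZ B (is_derive_id u 1))) _.
  by rewrite add0r /GRing.scale/= mulr1.
have dX (u : R) : is_derive u 1 X (- v.1.1).
  rewrite (_ : X = (fun s => (q.1.1 - p.1.1) + (- v.1.1) * s)); first exact: lin.
  by apply/funext => w; rewrite /X; ring.
have dY (u : R) : is_derive u 1 Y (- v.1.2).
  rewrite (_ : Y = (fun s => (q.1.2 - p.1.2) + (- v.1.2) * s)); first exact: lin.
  by apply/funext => w; rewrite /Y; ring.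
have dZ (u : R) : is_derive u 1 Z (- v.2 + 2^-1 * (v.1.2 * q.1.1 - v.1.1 * q.1.2)).
  rewrite (_ : Z = (fun s => (q.2 - p.2 + 2^-1 * (p.1.2 * q.1.1 - p.1.1 * q.1.2)) +
    (- v.2 + 2^-1 * (v.1.2 * q.1.1 - v.1.1 * q.1.2)) * s)); first exact: lin.
  by apply/funext => w; rewrite /Z; ring.
have cc (A : R) : {for s, continuous (cst A : R -> R)} by exact: cvg_cst.
have := @is_derive_hK R t t0 0 0 X Y Z (cst _) (cst _) (cst _) s dX dY dZ (cc _) (cc _) (cc _).
move=> /is_derive_eq; apply; rewrite /dir_kernel /hmul /hinv /shifted /cst /=.
by rewrite /X /Y /Z; field.
Qed.

Lemma dir_kernel_bounded v p : exists C, forall q s, box r q -> `|s| <= 1 ->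
  `|dir_kernel v q (hmul (hinv (shifted p v s)) q)| <= C.
Proof.
have [M1 h1] : exists C, forall q, `|hK t 1 0 q| <= C by eexists => q; exact: hK_le.
have [M2 h2] : exists C, forall q, `|hK t 0 1 q| <= C by eexists => q; exact: hK_le.
exists ((`|v.2| + 2^-1 * (`|v.1.2| * r + `|v.1.1| * r)) * M1 +
  2^-1 * (`|v.1.1| * (`|p.1.1| + `|v.1.1| + r) + `|v.1.2| * (`|p.1.2| + `|v.1.2| + r)) * M2).
move=> q s /boxP[x1 y1 z1] s1.
have lin (a b x : R) : `|x| <= r -> `|- (a + s * b) + x| <= `|a| + `|b| + r.
  move=> xr; rewrite (le_trans (ler_normD _ _))// lerD// normrN.
  rewrite (le_trans (ler_normD _ _))// lerD2l normrM.
  by rewrite ler_piMl.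
rewrite /dir_kernel (le_trans (ler_normD _ _))//; apply: lerD.
  rewrite normrM; apply: ler_pM => //.
  rewrite (le_trans (ler_normD _ _))// normrN lerD2l normrM ger0_norm// ler_wpM2l//.
  by rewrite (le_trans (ler_normB _ _))// !normrM; apply: lerD; apply: ler_wpM2l.
rewrite normrM; apply: ler_pM => //.
rewrite normrM ger0_norm// ler_wpM2l//.
rewrite (le_trans (ler_normD _ _))//; apply: lerD.
  by rewrite normrM ler_wpM2l// /hmul /hinv /shifted /=; exact: lin.
by rewrite normrM ler_wpM2l// /hmul /hinv /shifted /=; exact: lin.
Qed.

Lemma is_derive_semigroup p v :
  is_derive (0 : R) 1 (fun s => heat_semigroup t f (shifted p v s))
    (\int[mu3]_(q in box r) (f q * dir_kernel v q (hmul (hinv p) q))).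
Proof.
have mB := measurable_box r.
pose F s q := f q * hK t 0 0 (hmul (hinv (shifted p v s)) q).
have -> : (fun s => heat_semigroup t f (shifted p v s)) = (fun s => \int[mu3]_(q in box r) F s q).
  by apply/funext => s; rewrite heat_semigroupE.
have [C hC] := box_bounded r cf.
have [D hD] := dir_kernel_bounded v p.
have dF (s : R) q : is_derive s 1 (F ^~ q) (f q * dir_kernel v q (hmul (hinv (shifted p v s)) q)).
  exact: is_deriveZ (is_derive_kernel p v q s).
have I0 : [set` `](-1 : R), 1[] 0 by rewrite /= in_itv/= ltrN10 ltr01.
have intF s : [set` `](-1 : R), 1[] s -> mu3.-integrable (box r) (EFin \o F s).
  move=> _; apply: intg_box => q; apply: cvgM; first exact: cf.
  by apply: continuous_hmul_comp; exact: hK_continuous.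
have derF s q : [set` `](-1 : R), 1[] s -> box r q -> derivable (F ^~ q) s 1.
  by move=> _ _; have [] := dF s q.
pose G (q : mR * mR * mR) : R := `|C| * `|D|.
have G0 q : 0 <= G q by rewrite mulr_ge0.
have iG : mu3.-integrable (box r) (EFin \o G).
  by apply: intg_box => q; exact: cvg_cst.
have Gub s q : [set` `](-1 : R), 1[] s -> box r q -> `|partial1of2 F s q| <= G q.
  rewrite /= in_itv/= => /andP[s1 s2] Bq; rewrite partial1of2E; have [_ ->] := dF s q.
  rewrite normrM; apply: ler_pM => //.
    by rewrite (le_trans (hC q Bq))// ler_norm.
  rewrite (le_trans (hD q s Bq _)) ?ler_norm// ler_norml; apply/andP; split; exact: ltW.
have dE := differentiation_under_integral mB I0 intF derF G0 iG Gub.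
have dd := derivable_under_integral mB I0 intF derF G0 iG Gub.
apply: DeriveDef; first exact: dd.
rewrite -derive1E dE; apply: eq_Rintegral => q _; rewrite partial1of2E.
have [_ ->] := dF 0 q.
by rewrite (_ : shifted p v 0 = p)// /shifted !mul0r !addr0; case: (p) => [[]].
Qed.

Lemma derive_semigroup p v : 'D_v (heat_semigroup t f) p =
  \int[mu3]_(q in box r) (f q * dir_kernel v q (hmul (hinv p) q)).
Proof.
have [_ <-] := is_derive_semigroup p v.
transitivity (lim ((fun h : R => h^-1 *: (heat_semigroup t f (h *: v + p) -
  heat_semigroup t f p)) @ 0^')); first by [].
rewrite (_ : (fun h : R => _) = (fun h : R => h^-1 *: (heat_semigroup t f (shifted p v (h *: 1 + 0)) -
  heat_semigroup t f (shifted p v 0)))); first by [].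
apply/funext => h; congr (_ *: (heat_semigroup t f _ - heat_semigroup t f _)).
  rewrite /shifted addr0 [_ *: 1](mulr1 h).
  by rewrite addrC; case: (p) (v) => [[a b] c] [[x y] z].
by rewrite /shifted !mul0r !addr0; case: (p) => [[]].
Qed.

Lemma dir_kernel_continuous v p : continuous (fun q => dir_kernel v q (hmul (hinv p) q)).
Proof.
have cX : continuous (fun q : heis R => q.1.1) by exact: (@c1v_cont R c1_X).
have cY : continuous (fun q : heis R => q.1.2) by exact: (@c1v_cont R c1_Y).
move=> q; apply: cvgD; apply: cvgM.
- apply: cvgD; first exact: cvg_cst.
  by apply: cvgMl_tmp; apply: cvgB; apply: cvgMl_tmp; [exact: cX|exact: cY].
- by apply: continuous_hmul_comp; exact: hK_continuous.
- apply: cvgMl_tmp; apply: cvgD; apply: cvgMl_tmp.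
    exact: (continuous_hmul_comp cX).
  exact: (continuous_hmul_comp cY).
- by apply: continuous_hmul_comp; exact: hK_continuous.
Qed.

Let intg_dir v p :
  mu3.-integrable (box r) (EFin \o (fun q => f q * dir_kernel v q (hmul (hinv p) q))).
Proof.
by apply: intg_box => q; apply: cvgM; [exact: cf|exact: dir_kernel_continuous].
Qed.

Let intg_c1 (u : c1 (R := R)) p :
  mu3.-integrable (box r) (EFin \o (fun q => f q * u (hmul (hinv p) q))).
Proof.
apply: intg_box => q; apply: cvgM; first exact: cf.
by apply: continuous_hmul_comp; exact: c1v_cont.
Qed.

(** The [dirz] part of the field turns the coordinate [q.1.2] in [dir_kernel] into that of
    [hmul (hinv p) q], so that only the right-invariant derivative of the kernel remains. *)
Lemma vfX_semigroup p : vfX (heat_semigroup t f) p =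
  - \int[mu3]_q (f (hmul p q) * XhK t0 q).
Proof.
have mB := measurable_box r.
rewrite integral_translate; last exact: c1v_cont.
rewrite /vfX !derive_semigroup.
transitivity (1 * \int[mu3]_(q in box r) (f q * dir_kernel dirx q (hmul (hinv p) q)) +
  (- (p.1.2 / 2)) * \int[mu3]_(q in box r) (f q * dir_kernel dirz q (hmul (hinv p) q))).
  by rewrite mul1r mulNr.
rewrite -(Rintegral_lin mB _ _ (intg_dir dirx p) (intg_dir dirz p)) -[RHS]mulN1r.
rewrite -(RintegralZl _ mB (intg_c1 (XhK t0) p)); apply: eq_Rintegral => q _.
rewrite /dir_kernel /=.
by move: (hK t 1 0 _) (hK t 0 1 _) => *; field.
Qed.

Lemma vfY_semigroup p : vfY (heat_semigroup t f) p =
  - \int[mu3]_q (f (hmul p q) * YhK t0 q).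
Proof.
have mB := measurable_box r.
rewrite integral_translate; last exact: c1v_cont.
rewrite /vfY !derive_semigroup.
transitivity (1 * \int[mu3]_(q in box r) (f q * dir_kernel diry q (hmul (hinv p) q)) +
  (p.1.1 / 2) * \int[mu3]_(q in box r) (f q * dir_kernel dirz q (hmul (hinv p) q))).
  by rewrite mul1r.
rewrite -(Rintegral_lin mB _ _ (intg_dir diry p) (intg_dir dirz p)) -[RHS]mulN1r.
rewrite -(RintegralZl _ mB (intg_c1 (YhK t0) p)); apply: eq_Rintegral => q _.
rewrite /dir_kernel /=.
by move: (hK t 1 0 _) (hK t 0 1 _) => *; field.
Qed.

End differentiation.

Theorem theorem3p1 (R : realType) (t : R) (f : heis R -> R) :
  0 <= t -> smooth f -> compactly_supported f ->
  forall p : heis R,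
    t * Gamma (heat_semigroup t f) p <=
    heat_semigroup t (fun q => f q ^+ 2) p - heat_semigroup t f p ^+ 2.
Proof.
move=> + sf supp_f p; rewrite le_eqVlt => /predU1P[<-|t0].
  by rewrite mul0r /heat_semigroup eqxx subrr.
have cf : continuous f := sf 0%N.
have [r f0] := compact_support_box supp_f.
have [r' g0] := hmul_box_support p f0.
have cg := continuous_hmul_comp (p := p) cf.
have := @gradient_variance R t t0 (fun q => f (hmul p q)) r' cg g0.
rewrite /Gamma (vfX_semigroup t0 cf f0) (vfY_semigroup t0 cf f0).
rewrite [X in t * (X + _)]sqrrN [X in t * (_ + X)]sqrrN.
rewrite /heat_semigroup gt_eqF// -ler_pdivlMl//.
have E (h : heis R -> R) : Rintegral lebesgue3 setT (fun q => h q * heat_kernel t q) =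
    Rintegral lebesgue3 setT (fun q => h q * hK t 0 0 q).
  by apply: eq_Rintegral => q _; rewrite heat_kernelE.
by rewrite (E (fun q => f (hmul p q) ^+ 2)) (E (fun q => f (hmul p q))).
Qed.
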